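(* Let $\mathcal{M}^{\mathrm{out}}$ be the class of rooted simple outerplanar maps and let $\mathcal{A}$ be the set of all pairs $(T,\alpha)$ with $T$ a plane tree and $\alpha$ a function that assigns to each vertex $v\in T$ an $\mathcal{R}$-object $\alpha(v)$ of size $d_T^+(v)$, where $d_T^+(v)$ is the out-degree (number of children) of $v$. The function $\Xi:\mathcal{M}^{\mathrm{out}}\to\mathcal{A}$ defined in the context is a bijection. Here maps with $n$ vertices correspond to decorated trees with $n$ vertices.
   Context: Maps. A planar map is a 2-cell embedding of a connected planar multigraph on the sphere, up to orientation-preserving homeomorphism. It is rooted if one edge is distinguished and oriented (the root edge); the origin of the root edge is the root vertex; the face to the right of the root edge is the outer face, taken as the infinite face in plane representations. The map consisting of a single vertex is also considered rooted. A map is simple if it has no loops and no multiple edges. A simple rooted map is outerplanar if every vertex lies on the boundary of the outer face. A map is non-separable if it has at least one edge and removing any vertex does not disconnect it. A block of a map is an inclusion-maximal non-separable submap. A plane tree is a rooted tree in which the children of each vertex are linearly ordered. $\mathcal{C}^{\mathrm{out}}$ is the class of non-separable rooted simple outerplanar maps (the map with two vertices joined by a root edge, and all edge-rooted dissections of polygons). $\mathcal{C}^{\mathrm{out}}_*$ is the same class, but with the root vertex not counted in the size. $\mathcal{R}$ is the class of all finite (possibly empty) sequences $(C_1,\dots,C_t)$ of elements of $\mathcal{C}^{\mathrm{out}}_*$; its size is the total number of non-root vertices of the $C_i$. The non-root vertices of a $\mathcal{C}^{\mathrm{out}}_*$-object are linearly ordered by starting with the vertex the root edge points to and continuing counter-clockwise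 (along the boundary of the outer face); the non-root vertices of an $\mathcal{R}$-object are ordered by concatenating these orders. Definition of $\Xi$. Let $M\in\mathcal{M}^{\mathrm{out}}$ with root vertex $o$. Let $e_1,\dots,e_d$ be the edges incident to $o$ in counter-clockwise order, $e_1$ being the root edge. The edges of this list lying in a common block are consecutive. So the blocks containing $o$ are ordered as $C_1,\dots,C_t$ by their order of appearance in the list ($t=0$ if $M$ is a single vertex); each $C_i$ is rooted at its first edge in the list, oriented away from $o$. Put $R=(C_1,\dots,C_t)\in\mathcal{R}$ with ordered non-root vertices $v_1,\dots,v_r$. Deleting $o$ and all edges of $C_1,\dots,C_t$ from $M$ leaves submaps $M_1,\dots,M_r$ with $M_j$ containing $v_j$; $M_j$ is rooted at the first edge that comes, in counter-clockwise order around $v_j$ in $M$, after the edges of the block $C_i$ containing $v_j$, oriented away from $v_j$ (unless $M_j$ is a single vertex). Then $\Xi(M)=(T,\alpha)$ is defined recursively: the root $u$ of $T$ has $\alpha(u)=R$ and has $r$ ordered children, and the decorated subtree at its $j$-th child is $\Xi(M_j)$, $1\le j\le r$. *)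

(* Defs.v *)
From HB Require Import structures.
From mathcomp Require Import all_boot generic_quotient.
From mathcomp Require Import boolp classical_sets functions.

Set Implicit Arguments.
Unset Strict Implicit.
Unset Printing Implicit Defensive.

(* Maps are given by rotation systems.  A dart is an edge with an orientation; *)
(* it sits at its origin.  [edge] reverses a dart and [rot] sends a dart to    *)
(* the next one counter-clockwise around its origin, so the vertices are the   *)
(* [rot]-cycles, except that the map with a single vertex has no dart at all.  *)
(* The root is the root edge oriented away from the root vertex; only the      *)
(* single-vertex map has none.  [premap] is the raw data, see [is_map].        *)
Record premap (D : finType) := Premap {
  edge : {ffun D -> D};
  rot : {ffun D -> D};
  root : option D }.

HB.instance Definition _ (D : finType) := gen_eqMixin (premap D).
HB.instance Definition _ (D : finType) := gen_choiceMixin (premap D).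

Section Premap.

Variables (D : finType) (M : premap D).

Definition same_vertex (x y : D) : bool := fconnect (rot M) x y.

Definition vertex (v : D) : {set D} := [set x | same_vertex v x].

(* Follows the boundary of the face on the right of a dart: having reached the *)
(* head of x, the next dart with that face on its right is the one following   *)
(* the reverse of x counter-clockwise.                                         *)
Definition face (x : D) : D := rot M (edge M x).

Definition nvertices : nat := if #|D| == 0 then 1 else fcard (rot M) D.
Definition nfaces : nat := if #|D| == 0 then 1 else fcard face D.
Definition nedges : nat := #|D|./2.

Definition step_in (A : {set D}) : rel D :=
  [rel x y | [&& x \in A, y \in A & (y == edge M x) || same_vertex x y]].

Definition connected_in (A : {set D}) : bool :=
  [forall x in A, forall y in A, connect (step_in A) x y].

(* Rooted planar maps: connected, of genus 0 by Euler's formula. *)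
Definition is_map : bool :=
  [&& [forall x, (edge M (edge M x) == x) && (edge M x != x)],
      injectiveb (rot M),
      connected_in [set: D],
      nvertices + nfaces == nedges + 2
    & isSome (root M) == (0 < #|D|)].

Definition simple_map : bool :=
  [forall x, ~~ same_vertex x (edge M x)] &&
  [forall x, forall y,
     same_vertex x y && same_vertex (edge M x) (edge M y) ==> (x == y)].

Definition outer_dart (x : D) : bool :=
  if root M is Some r then fconnect face r x else false.

(* The condition is void for the single-vertex map. *)
Definition outerplanar : bool :=
  [forall x, exists y, outer_dart y && same_vertex x y].

Definition rooted_outerplanar : bool :=
  [&& is_map, simple_map & outerplanar].

(* A submap with at least one edge is the set S of its darts.  Removing the    *)
(* vertex v keeps the darts of S at the other vertices, since these darts      *)
(* represent the remaining vertices, but [step_in] can then no longer cross    *)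
(* the edges incident to v.                                                    *)
Definition nonseparable (S : {set D}) : bool :=
  [&& S != finset.set0,
      [forall x in S, edge M x \in S],
      connected_in S
    & [forall v, connected_in (S :\: vertex v)]].

Definition block (S : {set D}) : bool := maxset nonseparable S.

(* The darts of A in the connected component of the vertex of b; empty if that *)
(* component is a single vertex.                                               *)
Definition component (A : {set D}) (b : D) : {set D} :=
  [set y in A | [exists x in A, same_vertex b x && connect (step_in A) x y]].

(* The submap with dart set S, with the induced rotation: the next dart in S   *)
(* counter-clockwise around the same vertex.                                   *)
Definition submap (S : {set D}) (r : option D) : premap {x : D | x \in S} :=
  Premap
    [ffun x : {x : D | x \in S} => insubd x (edge M (val x))]
    [ffun x : {x : D | x \in S} =>
       insubd x (next [seq y <- orbit (rot M) (val x) | y \in S] (val x))]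
    (obind (fun x => insub x) r).

(* The non-root vertices of a rooted non-separable outerplanar map in their    *)
(* order, each represented by the dart at it on the boundary walk of the       *)
(* outer face; that walk starts at the root vertex.                            *)
Definition nonroot_vertices : seq D :=
  if root M is Some r then behead (orbit face r) else [::].

(* The blocks containing the root vertex, r being the root, by order of        *)
(* appearance counter-clockwise around that vertex.                            *)
Definition root_blocks (r : D) : seq {set D} :=
  let es := orbit (rot M) r in
  sort (fun B C : {set D} =>
          find (fun x => x \in B) es <= find (fun x => x \in C) es)
       (enum [set B : {set D} | block B && has (fun x => x \in B) es]).

Definition rooted_block (r : D) (B : {set D}) : premap {x : D | x \in B} :=
  submap B (ohead [seq x <- orbit (rot M) r | x \in B]).

End Premap.

Section Construction.

Variables (D : finType) (M : premap D).

Definition block_vertices (r : D) (B : {set D}) : seq D :=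
  [seq val x | x <- nonroot_vertices (rooted_block M r B)].

Definition pendant_darts (r b : D) : {set D} :=
  component M [set x | all (fun B : {set D} => x \notin B) (root_blocks M r)] b.

(* The submap left at the vertex of b, where b is a dart of the block B at a   *)
(* non-root vertex.  The darts of B at this vertex are consecutive, so the     *)
(* first dart outside B met when turning from b is the first one after B.      *)
Definition pendant (r : D) (B : {set D}) (b : D) :
    premap {x : D | x \in pendant_darts r b} :=
  submap M (pendant_darts r b)
    (ohead [seq x <- orbit (rot M) b | x \notin B]).

End Construction.

(* Orientation-preserving homeomorphisms respecting the roots. *)
Definition isomorphic (D D' : finType) (M : premap D) (M' : premap D') : Prop :=
  exists f : D -> D',
    [/\ bijective f,
        {morph f : x / edge M x >-> edge M' x},
        {morph f : x / rot M x >-> rot M' x}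
      & omap f (root M) = root M'].

(* Isomorphism classes: every dart set is in bijection with some 'I_n. *)
Definition rawmap := {n : nat & premap 'I_n}.
HB.instance Definition _ := Choice.on rawmap.

Definition raw_iso : rel rawmap :=
  fun m m' => `[< isomorphic (tagged m) (tagged m') >].

Lemma raw_iso_refl : reflexive raw_iso.
Proof.
move=> m; apply/asboolP; exists id; split=> //; first by exists id.
by case: (root _).
Qed.

Lemma raw_iso_sym : symmetric raw_iso.
Proof.
suff imp m m' : raw_iso m m' -> raw_iso m' m.
  by move=> m m'; apply/idP/idP; apply: imp.
move=> /asboolP[f [[g fK gK] fe fr frt]]; apply/asboolP; exists g; split.
- by exists f.
- by move=> x; rewrite -{1}[x]gK -fe fK.
- by move=> x; rewrite -{1}[x]gK -fr fK.
- by rewrite -frt; case: (root _) => //= x; rewrite fK.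
Qed.

Lemma raw_iso_trans : transitive raw_iso.
Proof.
move=> m2 m1 m3 /asboolP[f [fb fe fr frt]] /asboolP[g [gb ge gr grt]].
apply/asboolP; exists (g \o f); split.
- exact: bij_comp.
- by move=> x /=; rewrite fe ge.
- by move=> x /=; rewrite fr gr.
- by rewrite -grt -frt; case: (root _).
Qed.

Canonical raw_iso_equiv : equiv_rel rawmap :=
  EquivRel raw_iso raw_iso_refl raw_iso_sym raw_iso_trans.

Definition map_class := {eq_quot raw_iso}%qT.

Definition relabel (D : finType) (M : premap D) : premap 'I_#|D| :=
  Premap
    [ffun i : 'I_#|D| => enum_rank (edge M (enum_val i))]
    [ffun i : 'I_#|D| => enum_rank (rot M (enum_val i))]
    (omap enum_rank (root M)).

Definition class_of (D : finType) (M : premap D) : map_class :=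
  (\pi_map_class (Tagged (fun n => premap 'I_n) (relabel M)))%qT.

Definition repr_map (m : map_class) : premap 'I_(tag (repr m)) :=
  tagged (repr m).

Definition class_nvertices (m : map_class) : nat := nvertices (repr_map m).

Definition Mout : set map_class := fun m => rooted_outerplanar (repr_map m).

Definition Cout (m : map_class) : bool :=
  rooted_outerplanar (repr_map m) && nonseparable (repr_map m) [set: _].

(* R-objects: sequences of elements of Cout, root vertices not being counted.  *)
Definition is_Robj (R : seq map_class) : bool := all Cout R.
Definition Rsize (R : seq map_class) : nat :=
  \sum_(C <- R) (class_nvertices C).-1.

(* A plane tree together with a function from its vertices to L. *)
Inductive ltree (L : Type) := LNode of L & seq (ltree L).

Fixpoint tree_size (L : Type) (t : ltree L) : nat :=
  let: LNode _ ts := t in (sumn [seq tree_size u | u <- ts]).+1.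

Fixpoint well_decorated (t : ltree (seq map_class)) : bool :=
  let: LNode R ts := t in
  [&& is_Robj R, Rsize R == size ts & all well_decorated ts].

Definition decorated_trees : set (ltree (seq map_class)) :=
  fun t => well_decorated t.

(* The fuel k = #|D| suffices: each pendant submap has fewer darts than M,     *)
(* since it avoids at least the root edge, and a map without darts is the      *)
(* single-vertex map.                                                          *)
Fixpoint Xi_rec (k : nat) (D : finType) (M : premap D) {struct k} :
    ltree (seq map_class) :=
  match k, root M with
  | k'.+1, Some r =>
      let Bs := root_blocks M r in
      LNode [seq class_of (rooted_block M r B) | B <- Bs]
            (flatten [seq [seq Xi_rec k' (pendant M r B b)
                          | b <- block_vertices M r B] | B <- Bs])
  | _, _ => LNode [::] [::]
  end.

Definition Xi_map (D : finType) (M : premap D) : ltree (seq map_class) :=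
  Xi_rec #|D| M.

Definition Xi (m : map_class) : ltree (seq map_class) := Xi_map (repr_map m).

(* Main.v *)
(* A connected rotation system satisfies V + F <= E + 2.  Hence, if a face of  *)
(* a planar map meets a vertex twice, splitting the vertex at these two        *)
(* corners, which adds one vertex and one face, must disconnect the map.       *)
(* Applied to the outer face, this shows that a rooted outerplanar map whose   *)
(* outer walk meets some vertex twice is glued from two smaller ones at a      *)
(* corner of the outer face.  Applied to the inner faces, it shows that they   *)
(* are simple cycles, so that a map whose outer walk meets every vertex once   *)
(* is non-separable.  If P is glued to A at the root corner, then the          *)
(* sequences of blocks and of subtrees of Xi A and Xi P are concatenated.  If  *)
(* A has a single root block and P is glued at a vertex of it that carries     *)
(* nothing else, then Xi P replaces the corresponding leaf of Xi A.  Splitting *)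
(* off the last root block, or else the pendant map of the first vertex met    *)
(* twice by the outer walk, is canonical, and the theorem follows by induction.*)
From mathcomp Require Import boolp classical_sets functions.
From mathcomp Require Import all_boot fingroup perm zify.
Require Import Defs.

Set Implicit Arguments.
Unset Strict Implicit.
Unset Printing Implicit Defensive.

(** * Cycles of permutations *)

(** The inverse of [Xi] is never written down. Instead, [glue], which inserts a map [P] into a
    corner of a map [A], is matched with an operation on decorated trees, and maps and trees are
    both taken apart along it. On the side of maps, all topology comes from the Euler inequality
    [genus_ge0]. Splitting a vertex at two corners of one face adds a vertex and a face without
    adding an edge, so in a planar map it must disconnect ([split_disconnected]). For two outer
    corners this presents the map as a glued one ([split_glue]). For two inner corners it is
    impossible, since every vertex keeps contact with the outer face ([inner_face_simple]). Hence a
    map is non-separable exactly when its outer walk visits each vertex once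
    ([nonseparable_outer_simple], [outer_simple_nonseparable]), and [decompose] leaves three cases:
    a single block, a gluing that splits off the last root block together with all that hangs on it,
    or a gluing that splits off what hangs at the first repeated vertex of the walk. On the side of
    trees, [Xi_glue_root] concatenates the decorations and the children of two roots, and
    [Xi_glue_vertex] substitutes [Xi P] for a leaf child of the root. The three cases can be told
    apart in the tree: one block with only leaf children, at least two blocks, or one block with a
    non-leaf child. That the leaf in question comes at the right place among the children needs the
    walk of the map to begin like the walk of its root block ([one_block_exists]). Injectivity
    ([Xi_inj]) then follows by induction on the number of darts, since the tree determines the case,
    the trees of both parts and the place of gluing. Surjectivity ([Xi_onto]) follows by induction
    on the tree, building each node by the same gluings. Sizes agree because [glue] identifies two
    vertices while the trees share a root or lose a leaf. *)

Section Orbits.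

Variables T T' : finType.

Lemma connect_ind (e : rel T) (P : pred T) :
    (forall x y, e x y -> P x -> P y) ->
  forall x y, connect e x y -> P x -> P y.
Proof.
move=> step x y /connectP[p + ->]; elim: p x => //= z p IHp x /andP[xz zp] Px.
by apply: IHp zp _; apply: step xz Px.
Qed.

Lemma connect_homo (e : rel T) (e' : rel T') (h : T -> T') :
    {homo h : x y / e x y >-> connect e' x y} ->
  {homo h : x y / connect e x y >-> connect e' x y}.
Proof.
move=> step x y xy.
have closed u v : e u v -> connect e' (h x) (h u) -> connect e' (h x) (h v).
  by move=> /step uv xu; apply: connect_trans uv.
exact: (connect_ind (P := fun z => connect e' (h x) (h z)) closed xy (connect0 _ _)).
Qed.

Lemma orbit_cycle_cons (f : T -> T) x s :
  fcycle f (x :: s) -> uniq (x :: s) -> orbit f x = x :: s.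
Proof.
by move=> cs us; rewrite (orbitE cs us) ?mem_head //= eqxx rot0.
Qed.

Lemma orbit_map (f : T -> T) (f' : T' -> T') (h : T -> T') :
    injective h -> {morph h : x / f x >-> f' x} ->
  forall x, orbit f' (h x) = map h (orbit f x).
Proof.
move=> injh hf x.
have hiter n : iter n f' (h x) = h (iter n f x) by elim: n => //= n ->.
have htraj n y : traject f' (h y) n = map h (traject f y n).
  by elim: n y => //= n IHn y; rewrite -hf IHn.
suff eq_ord : fingraph.order f' (h x) = fingraph.order f x by rewrite /orbit eq_ord htraj.
rewrite /fingraph.order -(card_image injh); apply: eq_card => y; apply/idP/imageP => /=.
  by move/iter_findex <-; exists (iter (findex f' (h x) y) f x); rewrite ?hiter ?inE ?fconnect_iter.
by case=> z; rewrite inE => /iter_findex <- ->; rewrite inE -hiter fconnect_iter.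
Qed.

Lemma fconnect_map (f : T -> T) (f' : T' -> T') (h : T -> T') :
    injective h -> {morph h : x / f x >-> f' x} ->
  forall x y, fconnect f' (h x) (h y) = fconnect f x y.
Proof.
by move=> injh hf x y; rewrite !fconnect_orbit (orbit_map injh hf) mem_map.
Qed.

Lemma rot_filter (s : seq T) n (P : pred T) :
  exists k, filter P (seq.rot n s) = seq.rot k (filter P s).
Proof.
exists (size (filter P (take n s))).
have -> : filter P s = filter P (take n s) ++ filter P (drop n s).
  by rewrite -filter_cat cat_take_drop.
by rewrite rot_size_cat /seq.rot filter_cat.
Qed.

Lemma orbit_head (f : T -> T) x : orbit f x = x :: behead (orbit f x).
Proof. by rewrite /orbit -orderSpred. Qed.

End Orbits.

Section CycleCount.

Variable T : finType.

Lemma porbit_fconnect (f : T -> T) (injf : injective f) x y :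
  (y \in porbit (perm injf) x) = fconnect f x y.
Proof.
have iterE i : (perm injf ^+ i)%g x = iter i f x.
  by rewrite permX; elim: i => //= i ->; rewrite permE.
apply/porbitP/idP => [[i ->]|/iter_findex <-]; first by rewrite iterE fconnect_iter.
by exists (findex f x y); rewrite iterE.
Qed.

(** Translates the count of cycles into that of [porbits], for which the effect of multiplying by a
    transposition is known. *)
Lemma fcard_porbits (f : T -> T) (injf : injective f) :
  fcard f T = #|porbits (perm injf)|.
Proof.
pose F x := porbit (perm injf) x.
have porbits_froots : porbits (perm injf) = [set F x | x in [set x | froots f x]].
  apply/setP=> X; apply/imsetP/imsetP => [[x _ ->]|[x _ ->]]; last by exists x.
  exists (froot f x); first by rewrite inE roots_root //; apply: fconnect_sym.
  by apply/eqP; rewrite eq_porbit_mem porbit_fconnect fconnect_sym // connect_root.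
rewrite porbits_froots card_in_imset => [|x y].
  by apply: eq_card => x; rewrite !inE /= andbT.
rewrite !inE => /eqP rx /eqP ry /eqP; rewrite eq_porbit_mem porbit_fconnect => yx.
by rewrite -rx -ry; apply/esym/(rootP (fconnect_sym injf)).
Qed.

(** A transposition cuts a cycle that contains both points and joins two cycles that contain one
    each; the doubled boolean puts both cases into one equation without subtraction. *)
Lemma fcard_tperm_pre (f : T -> T) x y : injective f -> x != y ->
  fcard (f \o tperm x y) T + (~~ fconnect f x y).*2 = (fcard f T).+1.
Proof.
move=> injf xy; have injt : injective (f \o tperm x y).
  exact: inj_comp injf perm_inj.
have := porbits_mul_tperm (perm injf) x y.
rewrite porbit_fconnect fconnect_sym // xy addn1 -fcard_porbits => <-.
rewrite (fcard_porbits injt).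
suff -> : perm injt = (tperm x y * perm injf)%g by [].
by apply/permP => z; rewrite permE permM [RHS]permE.
Qed.

End CycleCount.

Section CycleCountMorphism.

Variables (T T' : finType) (f : T -> T) (f' : T' -> T') (h : T -> T').
Hypotheses (injf : injective f) (injf' : injective f').
Hypotheses (injh : injective h) (hf : {morph h : x / f x >-> f' x}).

Lemma n_comp_codom : n_comp (frel f') (codom h) = fcard f T.
Proof.
have cl : closed (frel f') (codom h).
  apply: intro_closed => [|y _ /eqP <- /codomP[x ->]]; first exact: fconnect_sym.
  by rewrite -hf codom_f.
rewrite (@adjunction_n_comp _ _ h _ _ (fconnect_sym injf') (fconnect_sym injf) _ cl).
  by apply: eq_n_comp_r => x; rewrite !inE codom_f.
apply: strict_adjunction => //; first exact: fconnect_sym.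
by move=> x y _; rewrite /= -hf inj_eq.
Qed.

Lemma fcard_bij : bijective h -> fcard f T = fcard f' T'.
Proof.
case=> g _ gK; rewrite -n_comp_codom; apply: eq_n_comp_r => x.
by rewrite -(gK x) codom_f.
Qed.

End CycleCountMorphism.

(** The products of [f] with a transposition on the left and on the right are conjugate by that
    transposition, so they have equally many cycles. *)
Lemma fcard_tperm (T : finType) (f : T -> T) x y : injective f -> x != y ->
  fcard (tperm x y \o f) T + (~~ fconnect f x y).*2 = (fcard f T).+1.
Proof.
move=> injf xy; rewrite -(fcard_tperm_pre injf xy); congr addn.
apply: (fcard_bij (h := tperm x y)) => [||||]; try exact: perm_inj.
- exact: inj_comp perm_inj injf.
- exact: inj_comp injf perm_inj.
- by move=> z /=; rewrite !tpermK.
- by exists (tperm x y); apply: tpermK.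
Qed.

(** * The Euler inequality *)

(** The part of [is_map] that survives splitting a vertex or passing to a submap, where
    connectedness and planarity may be lost. *)
Definition darts_ok (D : finType) (M : premap D) : Prop :=
  [/\ involutive (edge M), forall x, edge M x != x & injective (rot M)].

Section Darts.

Variables (D : finType) (M : premap D).
Hypothesis okM : darts_ok M.

Local Notation e := (edge M).
Local Notation s := (rot M).

Lemma edgeK : involutive e. Proof. by case: okM. Qed.
Lemma edge_neq x : e x != x. Proof. by case: okM. Qed.
Lemma rot_inj : injective s. Proof. by case: okM. Qed.
Lemma edge_inj : injective e. Proof. exact: inv_inj edgeK. Qed.
Lemma face_inj : injective (face M). Proof. exact: inj_comp rot_inj edge_inj. Qed.

Lemma same_vertex_refl x : same_vertex M x x. Proof. exact: connect0. Qed.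

Lemma same_vertex_sym x y : same_vertex M x y = same_vertex M y x.
Proof. exact: fconnect_sym rot_inj _ _. Qed.

Lemma same_vertex_trans y x z :
  same_vertex M x y -> same_vertex M y z -> same_vertex M x z.
Proof. exact: connect_trans. Qed.

Lemma same_vertex_face x : same_vertex M (e x) (face M x).
Proof. exact: fconnect1. Qed.

Lemma step_in_sym A : symmetric (step_in M A).
Proof.
move=> x y; rewrite /step_in /= same_vertex_sym andbCA.
by rewrite [y == _]eq_sym (inv_eq edgeK).
Qed.

Lemma connect_step_sym A x y :
  connect (step_in M A) x y = connect (step_in M A) y x.
Proof. exact: sym_connect_sym (@step_in_sym A) x y. Qed.

Lemma connected_inP (A : {set D}) :
  reflect {in A &, forall x y, connect (step_in M A) x y} (connected_in M A).
Proof.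
apply: (iffP forall_inP) => [conA x y /conA /forall_inP|conA x xA]; first exact.
by apply/forall_inP => y; apply: conA.
Qed.

Lemma connect_setT (P : pred D) :
    connected_in M [set: D] -> (forall x, P x -> P (e x)) ->
    (forall x, P x -> P (s x)) ->
  forall x y, P x -> P y.
Proof.
move=> /connected_inP conM Pe Ps x y.
have xy : connect (step_in M setT) x y by rewrite conM ?inE.
apply: connect_ind xy => u v /and3P[_ _ /orP[/eqP->|/iter_findex<-]] //; first exact: Pe.
by move=> Pu; elim: (findex _ _ _) => //= n; apply: Ps.
Qed.

(* An Euler inequality proved edge by edge: l labels the connected components  *)
(* of the submap spanned by S.  Each new edge changes the number of faces by   *)
(* one, and an edge that joins two components also joins two faces.            *)
Lemma component_labelling (S : {set D}) : {in S, forall x, e x \in S} ->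
  exists l : D -> D,
    [/\ forall x, l (s x) = l x, {in S, forall x, l (e x) = l x}
      & (fcard s D + fcard (fun x => s (if x \in S then e x else x)) D).*2
        <= #|S| + 4 * #|codom l|].
Proof.
have [n] := ubnP #|S|; elim: n S => // n IHn S leSn eS.
have [->|[x xS]] := set_0Vmem S.
  (* Without edges, each cycle of [s] is a vertex, a face and a component at once, and [froot s]
     gives it a label of its own. *)
  exists (froot s); split=> [x|x|]; first exact/esym/(rootP (fconnect_sym rot_inj))/fconnect1.
    by rewrite inE.
  rewrite cards0 (eq_fcard (f' := s)) => [|x]; last by rewrite inE.
  suff : fcard s D <= #|codom (froot s)| by lia.
  apply/subset_leq_card/subsetP => x.
  by rewrite !inE andbT => /eqP rx; apply/codomP; exists x.
pose S' := S :\ x :\ e x.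
have exS' : e x \in S :\ x by rewrite !inE edge_neq eS.
have cS : #|S| = #|S'|.+2 by rewrite (cardsD1 x) xS (cardsD1 (e x)) exS'.
have eS' : {in S', forall y, e y \in S'}.
  move=> y; rewrite !inE => /and3P[yex yx yS]; rewrite (inj_eq edge_inj) yx eS // andbT.
  by rewrite (inv_eq edgeK) yex.
have [|l [ls le lec]] := IHn S' _ eS'; first by lia.
pose f' y := s (if y \in S' then e y else y).
have injf' : injective f'.
  move=> y z /rot_inj; case: ifP => yS'; case: ifP => zS' // [].
  - exact: edge_inj.
  - by move=> ez; rewrite -ez eS' in zS'.
  - by move=> ez; rewrite ez eS' in yS'.
(* Restoring the edge of [x] multiplies the face permutation by a transposition. *)
have fE : (fun y => s (if y \in S then e y else y)) =1 f' \o tperm x (e x).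
  move=> y; rewrite /f' /=; congr (s _); case: tpermP => [->|->|/eqP yx /eqP yex].
  - by rewrite xS !inE eqxx.
  - by rewrite eS // edgeK !inE eqxx andbF.
  - by rewrite !inE yx yex.
have {}lec : (fcard s D + fcard f' D).*2 <= #|S'| + 4 * #|codom l| := lec.
have [xex ext] : x != e x /\ fcard (f' \o tperm x (e x)) D + (~~ fconnect f' x (e x)).*2
    = (fcard f' D).+1.
  have xex : x != e x by rewrite eq_sym edge_neq.
  by split; last exact: fcard_tperm_pre.
have lf' y : l (f' y) = l y by rewrite /f' ls; case: ifP => // /le.
rewrite (eq_fcard fE); move: ext lec.
move: (fcard (f' \o _) D) (fcard f' D) => F F' ext lec; have [lxex|lxex] := eqVneq (l (e x)) (l x).
  exists l; split=> //.
    move=> y yS; have [->|yx] := eqVneq y x => //; have [->|yex] := eqVneq y (e x).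
      by rewrite edgeK.
    by apply: le; rewrite !inE yx yex.
  case: (fconnect _ _ _) ext => /= ext; rewrite cS; move: lec ext;
    by move: #|S'| #|codom l| (fcard s D) => a b c; clear; lia.
(* Labels are constant along the cycles of [f'], so an edge between differently labelled darts joins
   two faces. Losing one face and at most one label, with two more darts, keeps the bound
   exactly. *)
have nf' : ~~ fconnect f' x (e x).
  apply: contra lxex => xf; rewrite eq_sym; apply/eqP.
  have invl : invariant f' l =1 D by move=> y; apply/eqP/lf'.
  exact: fconnect_invariant invl _ _ xf.
pose l' z := if l z == l x then l (e x) else l z.
exists l'; split=> [z|y yS|].
- by rewrite /l' ls.
- rewrite /l'; have [->|yx] := eqVneq y x; first by rewrite eqxx (negPf lxex).
  have [->|yex] := eqVneq y (e x); first by rewrite edgeK eqxx (negPf lxex).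
  by rewrite le // !inE yx yex.
have : #|codom l| <= #|codom l'|.+1.
  apply: leq_trans (_ : #|[predU1 l x & codom l']| <= _); last first.
    by rewrite cardU1; case: (_ \notin _).
  apply/subset_leq_card/subsetP => _ /codomP[z ->]; rewrite !inE.
  have [//|lz /=] := eqVneq (l z) (l x); apply/codomP; exists z.
  by rewrite /l' (negPf lz).
rewrite nf' in ext; rewrite cS; move: lec ext.
by move: #|S'| #|codom l| #|codom l'| (fcard s D) => a b c d; clear; lia.
Qed.

(** Reversal pairs the darts without fixed point, so the halving in [nedges] loses nothing. *)
Lemma card_darts : #|D| = (nedges D).*2.
Proof.
rewrite /nedges; suff ev (S : {set D}) : {in S, forall x, e x \in S} -> ~~ odd #|S|.
  by rewrite -[LHS]odd_double_half -cardsT (negPf (ev _ _)) // => x; rewrite !inE.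
have [n] := ubnP #|S|; elim: n S => // n IHn S leSn eS.
have [->|[x xS]] := set_0Vmem S; first by rewrite cards0.
have exS : e x \in S :\ x by rewrite !inE edge_neq eS.
move: leSn; rewrite (cardsD1 x) xS (cardsD1 (e x)) exS /= => leSn; rewrite negbK.
apply: IHn => [|y]; first by lia.
rewrite !inE => /and3P[yex yx yS]; rewrite (inj_eq edge_inj) yx eS // andbT.
by rewrite (inv_eq edgeK) yex.
Qed.

(** Connectedness leaves a single label in [component_labelling] with all darts present. Planarity
    being the case of equality, the lemma serves to refute connectedness of split maps and to force
    planarity of the parts of a glued map. *)
Lemma genus_ge0 : connected_in M [set: D] ->
  fcard s D + fcard (face M) D <= nedges D + 2.
Proof.
move=> conM; have [|l [ls le]] := @component_labelling setT.
  by move=> x; rewrite !inE.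
have -> : fcard (fun x => s (if x \in [set: D] then e x else x)) D = fcard (face M) D.
  by apply: eq_fcard => x; rewrite inE.
rewrite cardsT.
suff : #|codom l| <= 1.
  rewrite card_darts; move: #|codom l| (fcard s D) (fcard (face M) D) (nedges D).
  by clear => a b c d; lia.
apply/card_le1_eqP => _ _ /codomP[x ->] /codomP[y ->].
apply/eqP; rewrite eq_sym; apply: (@connect_setT (fun z => l x == l z) conM _ _ x y (eqxx (l x))).
  by move=> z; rewrite le ?inE.
by move=> z; rewrite ls.
Qed.

End Darts.

(** * Isomorphisms, embeddings and submaps *)

Record rop_spec (D : finType) (M : premap D) : Prop := RopSpec {
  rop_ok : darts_ok M;
  rop_conn : connected_in M [set: D];
  rop_euler : nvertices M + nfaces M = nedges D + 2;
  rop_root : root M = (0 < #|D|) :> bool;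
  rop_loop : forall x, ~~ same_vertex M x (edge M x);
  rop_simple : forall x y, same_vertex M x y ->
    same_vertex M (edge M x) (edge M y) -> x = y;
  rop_outer : forall x, exists2 y, outer_dart M y & same_vertex M x y }.

Lemma ropP (D : finType) (M : premap D) :
  reflect (rop_spec M) (rooted_outerplanar M).
Proof.
apply: (iffP and3P).
- case=> /and5P[/forallP eM /injectiveP rM cM /eqP EM /eqP rtM].
  case/andP=> /forallP loopM /forallP sM /forallP oM; split=> //.
  + by split=> // x; have /andP[/eqP] := eM x.
  + move=> x y xy exy; have /forallP /(_ y) := sM x.
    by rewrite xy exy => /eqP.
  + by move=> x; have /existsP[y /andP[oy xy]] := oM x; exists y.
- case=> [[eK eM rM] cM EM rtM lM sM oM]; split.
  + apply/and5P; split=> //; [|exact/injectiveP|exact/eqP|exact/eqP].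
    by apply/forallP => x; rewrite eK eqxx eM.
  + apply/andP; split; first exact/forallP.
    apply/forallP=> x; apply/forallP => y; apply/implyP => /andP[xy exy].
    exact/eqP/sM.
  + by apply/forallP => x; apply/existsP; have [y oy xy] := oM x; exists y; rewrite oy.
Qed.

(** [isomorphic] with its bijection exposed, for arguments that follow given darts or the outer walk
    along [f]. *)
Definition isomorphism (D D' : finType) (M : premap D) (M' : premap D') (f : D -> D') :=
  [/\ bijective f, {morph f : x / edge M x >-> edge M' x},
      {morph f : x / rot M x >-> rot M' x} & omap f (root M) = root M'].

Section Isomorphisms.

Lemma isomorphic_refl (D : finType) (M : premap D) : isomorphic M M.
Proof. by exists id; split=> //; [exists id | case: (root M)]. Qed.

Lemma isomorphic_sym (D D' : finType) (M : premap D) (M' : premap D') :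
  isomorphic M M' -> isomorphic M' M.
Proof.
case=> f [[g fK gK] fe fr frt]; exists g; split.
- by exists f.
- by move=> x; rewrite -{1}[x]gK -fe fK.
- by move=> x; rewrite -{1}[x]gK -fr fK.
- by rewrite -frt; case: (root _) => //= x; rewrite fK.
Qed.

Lemma isomorphic_trans (D1 D2 D3 : finType)
    (M1 : premap D1) (M2 : premap D2) (M3 : premap D3) :
  isomorphic M1 M2 -> isomorphic M2 M3 -> isomorphic M1 M3.
Proof.
case=> f [fb fe fr frt] [g [gb ge gr grt]].
exists (g \o f); split; first exact: bij_comp.
- by move=> x /=; rewrite fe ge.
- by move=> x /=; rewrite fr gr.
- by rewrite -grt -frt; case: (root _).
Qed.

Variables (D D' : finType) (M : premap D) (M' : premap D') (f : D -> D').
Hypotheses (bijf : bijective f) (fe : {morph f : x / edge M x >-> edge M' x}).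
Hypotheses (fr : {morph f : x / rot M x >-> rot M' x}).
Hypothesis frt : omap f (root M) = root M'.

Let injf : injective f := bij_inj bijf.

Lemma iso_same_vertex x y : same_vertex M' (f x) (f y) = same_vertex M x y.
Proof. exact: fconnect_map injf fr x y. Qed.

Lemma iso_face : {morph f : x / face M x >-> face M' x}.
Proof. by move=> x; rewrite /face fr fe. Qed.

Lemma iso_orbit_face x : orbit (face M') (f x) = map f (orbit (face M) x).
Proof. exact: orbit_map injf iso_face x. Qed.

Lemma iso_rop : rop_spec M -> rop_spec M'.
Proof.
have [g fK gK] := bijf.
have cDD : #|D| = #|D'| by exact: bij_eq_card bijf.
case=> [[eK eM rM] cM EM rtM lM sM oM].
have okM : darts_ok M by [].
have eK' : involutive (edge M') by move=> x; rewrite -[x]gK -!fe eK.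
have rM' : injective (rot M').
  by move=> x y; rewrite -[x]gK -[y]gK -!fr => /injf/rM ->.
have okM' : darts_ok M'.
  by split=> // x; rewrite -[x]gK -fe (inj_eq injf).
split=> //.
- apply/connected_inP => x y _ _; rewrite -[x]gK -[y]gK.
  have /connected_inP/(_ (g x) (g y)) := cM; rewrite !inE => /(_ isT isT).
  apply: connect_homo => u v /and3P[_ _ uv]; apply: connect1.
  by rewrite /step_in /= !inE -fe (inj_eq injf) iso_same_vertex.
- rewrite -[nedges D']/(#|D'|./2) -cDD -[_./2]/(nedges D) -EM.
  rewrite /nvertices /nfaces -cDD; case: eqP => // _; congr (_ + _); apply/esym.
    exact: fcard_bij rM rM' injf fr bijf.
  by apply: (fcard_bij _ _ injf iso_face bijf); apply: face_inj.
- by rewrite -frt -cDD -rtM; case: (root M).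
- by move=> x; rewrite -[x]gK -fe iso_same_vertex.
- move=> x y; rewrite -[x]gK -[y]gK -!fe !iso_same_vertex => xy exy.
  by congr f; apply: sM.
- move=> x; have [y] := oM (g x); rewrite /outer_dart -frt.
  case: (root M) => //= r ry xy; exists (f y); last by rewrite -[x]gK iso_same_vertex.
  by rewrite (fconnect_map injf iso_face).
Qed.

End Isomorphisms.

Lemma rop_isomorphic (D D' : finType) (M : premap D) (M' : premap D') :
  isomorphic M M' -> rop_spec M -> rop_spec M'.
Proof. by case=> f [fb fe fr frt]; apply: iso_rop fb fe fr frt. Qed.

Lemma filter_imset (T T' : finType) (i : T -> T') (s : seq T) (s' : seq T') (S : {set T}) :
    injective i -> [seq y <- s' | y \in codom i] = map i s ->
  [seq y <- s' | y \in i @: S] = map i [seq y <- s | y \in S].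
Proof.
move=> injie s'E.
have -> : [seq y <- s' | y \in i @: S]
    = [seq y <- [seq y <- s' | y \in codom i] | y \in i @: S].
  rewrite -filter_predI; apply: eq_in_filter => y _ /=.
  by apply/idP/andP => [yS|[]//]; split=> //; case/imsetP: yS => z _ ->; apply: codom_f.
by rewrite s'E filter_map; congr map; apply: eq_filter => y /=; rewrite mem_imset.
Qed.

(** The last clause says that [M] carries the rotation induced by [M']. Put with filtered orbits, it
    covers submaps, isomorphisms and both sides of a glued map alike. *)
Definition embeds (D D' : finType) (M : premap D) (M' : premap D') (i : D -> D') :=
  [/\ injective i, {morph i : x / edge M x >-> edge M' x}
    & forall x, [seq y <- orbit (rot M') (i x) | y \in codom i]
                = map i (orbit (rot M) x)].

Lemma isomorphism_embeds (D D' : finType) (M : premap D) (M' : premap D') f :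
    bijective f -> {morph f : x / edge M x >-> edge M' x} ->
    {morph f : x / rot M x >-> rot M' x} ->
  embeds M M' f.
Proof.
move=> bijf fe fr; have injf := bij_inj bijf; split=> // x.
rewrite (orbit_map injf fr) (eq_in_filter (a2 := predT)) ?filter_predT //.
by move=> _ /mapP[y _ ->]; rewrite codom_f.
Qed.

Section Embedding.

Variables (D D' : finType) (M : premap D) (M' : premap D') (i : D -> D').
Hypotheses (okM : darts_ok M) (okM' : darts_ok M') (embi : embeds M M' i).

Lemma emb_inj : injective i. Proof. by case: embi. Qed.
Lemma emb_edge : {morph i : x / edge M x >-> edge M' x}. Proof. by case: embi. Qed.

Lemma emb_filter (S : {set D}) x :
  [seq y <- orbit (rot M') (i x) | y \in i @: S]
  = map i [seq y <- orbit (rot M) x | y \in S].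
Proof. by case: embi => injie _ orb; apply: filter_imset. Qed.

Lemma emb_same_vertex x y : same_vertex M' (i x) (i y) = same_vertex M x y.
Proof.
case: embi => injie _ orb; rewrite /same_vertex !fconnect_orbit.
by rewrite -(mem_map injie) -orb mem_filter codom_f.
Qed.

Lemma emb_connect (A : {set D}) x y :
  connect (step_in M' (i @: A)) (i x) (i y) = connect (step_in M A) x y.
Proof.
apply/idP/idP => [/connectP[p pp]|].
  elim: p x pp => [|w p IHp] x /=; first by move=> _ /emb_inj <-.
  case/andP=> /and3P[xA /imsetP[z zA eqw] xz] pp eqy; subst w.
  apply: connect_trans (IHp _ pp eqy); apply: connect1.
  rewrite /step_in /= zA -(mem_imset _ _ emb_inj) xA /=.
  by rewrite -emb_edge (inj_eq emb_inj) emb_same_vertex in xz.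
apply: connect_homo => u v /and3P[uA vA uv]; apply: connect1.
rewrite /step_in /= !(mem_imset _ _ emb_inj) uA vA.
by rewrite -emb_edge (inj_eq emb_inj) emb_same_vertex.
Qed.

Lemma emb_connected_in (A : {set D}) : connected_in M' (i @: A) = connected_in M A.
Proof.
apply/connected_inP/connected_inP => conA x y.
  by move=> xA yA; rewrite -emb_connect conA ?imset_f.
by case/imsetP=> u uA -> /imsetP[v vA ->]; rewrite emb_connect conA.
Qed.

Lemma emb_vertexD (A : {set D}) v :
  (i @: A) :\: vertex M' (i v) = i @: (A :\: vertex M v).
Proof.
apply/setP => y; rewrite inE; apply/andP/imsetP => [[yv /imsetP[x xA eqy]]|[x]].
  by exists x => //; rewrite !inE -emb_same_vertex -eqy xA andbT; rewrite inE in yv.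
by rewrite !inE => /andP[xv xA] ->; rewrite imset_f // emb_same_vertex.
Qed.

Lemma emb_nonseparable (S : {set D}) : nonseparable M' (i @: S) = nonseparable M S.
Proof.
rewrite /nonseparable emb_connected_in.
have -> : (i @: S != set0) = (S != set0).
  apply/set0Pn/set0Pn => [[_ /imsetP[x xS _]]|[x xS]]; first by exists x.
  by exists (i x); apply: imset_f.
have -> : [forall x in i @: S, edge M' x \in i @: S] = [forall x in S, edge M x \in S].
  apply/forall_inP/forall_inP => eS x.
    by move=> xS; rewrite -(mem_imset _ _ emb_inj) emb_edge eS ?imset_f.
  by case/imsetP=> y yS ->; rewrite -emb_edge imset_f ?eS.
apply/and4P/and4P => -[S0 eS cS vS]; split=> //; apply/forallP => v.
  by rewrite -emb_connected_in -emb_vertexD (forallP vS).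
(* Either the vertex [v] of [M'] contains a dart of the image of [S], and its removal is a removal
   in [M], or it misses that image and removes nothing. *)
have [/existsP[w /andP[wS vw]]|nex] := boolP [exists w, (w \in S) && same_vertex M' v (i w)].
  have -> : vertex M' v = vertex M' (i w).
    by apply/setP=> x; rewrite !inE; apply: same_connect (fconnect_sym (rot_inj okM')) _ _ vw x.
  by rewrite emb_vertexD emb_connected_in (forallP vS).
have -> : (i @: S) :\: vertex M' v = i @: S; last by rewrite emb_connected_in.
apply/setDidPl; rewrite -setI_eq0; apply/eqP/setP => x; rewrite !inE.
apply: contraNF nex => /andP[/imsetP[w wS ->] vw].
by apply/existsP; exists w; rewrite wS.
Qed.

(** Non-separability passes along any embedding, but maximality does not; this condition, which both
    sides of a glued map satisfy, makes [block] pass as well. *)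
Definition saturated :=
  forall S, nonseparable M' S -> forall x, i x \in S -> S \subset codom i.

Hypothesis sati : saturated.

Lemma emb_imset_preim (S : {set D'}) :
  S \subset codom i -> S = i @: (i @^-1: S).
Proof.
move=> Si; apply/setP => y; apply/idP/imsetP => [yS|[x]]; last by rewrite inE => ? ->.
by have /codomP[x eqy] := subsetP Si y yS; exists x; rewrite // inE -eqy.
Qed.

Lemma emb_imset_sub (S B : {set D}) : (i @: S \subset i @: B) = (S \subset B).
Proof.
apply/idP/idP => [sub|]; last exact: imsetS.
by apply/subsetP => x /(imset_f i)/(subsetP sub); rewrite mem_imset //; apply: emb_inj.
Qed.

Lemma emb_block (B : {set D}) : block M' (i @: B) = block M B.
Proof.
apply/maxsetP/maxsetP => -[nB maxB].
  rewrite emb_nonseparable in nB; split=> // S nS BS.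
  apply: (imset_inj emb_inj); apply: maxB; first by rewrite emb_nonseparable.
  by rewrite emb_imset_sub.
split=> [|S nS BS]; first by rewrite emb_nonseparable.
have /and4P[/set0Pn[x xB] _ _ _] := nB.
have Si : S \subset codom i by apply: (sati nS (x := x)); apply: (subsetP BS); apply: imset_f.
rewrite (emb_imset_preim Si) in nS BS *; rewrite emb_nonseparable in nS.
by rewrite emb_imset_sub in BS; rewrite (maxB _ nS BS).
Qed.

Lemma emb_block_preim (S : {set D'}) x :
  block M' S -> i x \in S -> exists2 B, block M B & S = i @: B.
Proof.
move=> bS xS; have /maxsetp nS := bS; have Si := sati nS xS.
exists (i @^-1: S); last exact: emb_imset_preim.
by rewrite -emb_block -emb_imset_preim.
Qed.

End Embedding.

(** Changing the base point of an orbit only rotates the filtered list, which [next] and [prev] do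
    not notice; so the rotation of a submap is independent of the dart from which an orbit is
    listed. *)
Lemma orbit_filter_rot (T : finType) (f : T -> T) (P : pred T) x y :
    injective f -> fconnect f x y ->
  exists k, filter P (orbit f y) = seq.rot k (filter P (orbit f x)).
Proof.
move=> injf; rewrite fconnect_orbit => xy.
have [k ->] := orbit_rot_cycle (cycle_orbit injf x) (orbit_uniq f x) xy.
exact: rot_filter.
Qed.

Section Submap.

Variables (D : finType) (M : premap D) (S : {set D}) (r : option D).
Hypotheses (okM : darts_ok M) (eS : {in S, forall x, edge M x \in S}).

Local Notation N := (submap M S r).
Local Notation sorb x := [seq y <- orbit (rot M) x | y \in S].

Lemma submap_edgeE x : val (edge N x) = edge M (val x).
Proof. by rewrite ffunE val_insubd eS ?(valP x). Qed.

Lemma submap_rotE x : val (rot N x) = next (sorb (val x)) (val x).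
Proof.
rewrite ffunE val_insubd; case: ifP => // /negP[].
have : next (sorb (val x)) (val x) \in sorb (val x).
  by rewrite mem_next mem_filter (valP x) in_orbit.
by rewrite mem_filter => /andP[].
Qed.

(** The inverse is [prev] in the filtered orbit, and this orbit may be listed from the image instead
    of the argument. *)
Lemma submap_rot_inj : injective (rot N).
Proof.
have rotK x y : rot N x = y -> val x = prev (sorb (val y)) (val y).
  move=> <-; rewrite submap_rotE; set z := next _ _.
  have zs : z \in sorb (val x) by rewrite mem_next mem_filter (valP x) in_orbit.
  have xz : fconnect (rot M) (val x) z.
    by rewrite fconnect_orbit; move: zs; rewrite mem_filter => /andP[].
  have [k ->] := orbit_filter_rot (mem S) (rot_inj okM) xz.
  have us : uniq (sorb (val x)) by rewrite filter_uniq ?orbit_uniq.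
  by rewrite prev_rot // prev_next.
by move=> x y xy; apply: val_inj; rewrite (rotK _ _ xy) -(rotK _ _ (erefl (rot N y))).
Qed.

Lemma submap_ok : darts_ok N.
Proof.
split=> [x|x|]; last exact: submap_rot_inj.
  by apply: val_inj; rewrite !submap_edgeE edgeK.
by rewrite -(inj_eq val_inj) submap_edgeE edge_neq.
Qed.

Lemma submap_orbit x : map val (orbit (rot N) x) = sorb (val x).
Proof.
set o := sorb (val x); pose o' : seq {x | x \in S} := pmap insub o.
have oE : map val o' = o.
  rewrite /o' (pmap_filter (insubK _)) (@eq_in_filter _ _ predT) ?filter_predT // => y.
  by rewrite mem_filter => /andP[yS _]; rewrite isSome_insub.
have uo : uniq o by rewrite filter_uniq ?orbit_uniq.
have uo' : uniq o' by rewrite -(map_inj_uniq val_inj) oE.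
have [o1 o'E] : exists o1, o' = x :: o1.
  move: oE; rewrite {1}/o orbit_head /= (valP x); case: o' {uo'} => //= y o1 [/val_inj->].
  by exists o1.
rewrite -oE o'E; congr map; apply: orbit_cycle_cons; last by rewrite -o'E.
rewrite -o'E; apply: etrans (cycle_next uo') => //.
apply: (@eq_in_cycle _ (mem o')); last exact/allP.
move=> y w yo' _ /=; congr (_ == _); apply: val_inj; rewrite submap_rotE -(next_map val_inj) //.
have xy : fconnect (rot M) (val x) (val y).
  have : val y \in o by rewrite -oE map_f.
  by rewrite mem_filter -fconnect_orbit => /andP[].
have [k ->] := orbit_filter_rot (mem S) (rot_inj okM) xy.
by rewrite next_rot // -/o oE.

Qed.

Lemma submap_embeds : embeds N M val.
Proof.
split=> [|x|x]; [exact: val_inj|exact: submap_edgeE|].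
rewrite submap_orbit; apply: eq_filter => y; apply/codomP/idP => [[z ->]|yS].
  exact: valP.
by exists (Sub y yS).
Qed.

End Submap.

Lemma submap_setT_isomorphism (D : finType) (M : premap D) : darts_ok M ->
  isomorphism (submap M [set: D] (root M)) M val.
Proof.
move=> okM; have eT : {in [set: D], forall x, edge M x \in [set: D]} by move=> x; rewrite !inE.
split=> [|x|x|]; [|exact: submap_edgeE| |].
- by exists (fun x => Sub x (in_setT x)) => x //=; apply: val_inj.
- rewrite submap_rotE (@eq_filter _ _ predT) ?filter_predT => [|y]; last by rewrite inE.
  apply/esym/eqP; apply: (next_cycle (cycle_orbit (rot_inj okM) _)).
  exact: in_orbit.
- by rewrite /=; case: (root M) => //= x; rewrite insubT ?inE.
Qed.

Lemma submap_setT (D : finType) (M : premap D) : darts_ok M ->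
  isomorphic (submap M [set: D] (root M)) M.
Proof. by exists val; apply: submap_setT_isomorphism. Qed.

Section EmbeddedSubmap.

Variables (D D' : finType) (M : premap D) (M' : premap D') (i : D -> D').
Hypotheses (embi : embeds M M' i).
Variable S : {set D}.
Hypothesis eS : {in S, forall x, edge M x \in S}.

Definition emb_sub (x : {x | x \in S}) : {y | y \in i @: S} :=
  Sub (i (val x)) (imset_f i (valP x)).

Lemma emb_sub_inj : injective emb_sub.
Proof. by move=> x y /(congr1 val) /(emb_inj embi)/val_inj. Qed.

Lemma emb_sub_bij : bijective emb_sub.
Proof.
apply: inj_card_bij emb_sub_inj _; rewrite !card_sig leq_eqVlt; apply/orP; left.
by apply/eqP; rewrite -[RHS](card_imset _ (emb_inj embi)); apply: eq_card => x; rewrite !inE.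
Qed.

Lemma emb_sub_edge r r' :
  {morph emb_sub : x / edge (submap M S r) x >-> edge (submap M' (i @: S) r') x}.
Proof.
move=> x; apply: val_inj; rewrite submap_edgeE /= ?submap_edgeE ?(emb_edge embi) //.
by move=> _ /imsetP[y yS ->]; rewrite -(emb_edge embi) imset_f ?eS.
Qed.

Lemma emb_sub_rot r r' :
  {morph emb_sub : x / rot (submap M S r) x >-> rot (submap M' (i @: S) r') x}.
Proof.
move=> x; apply: val_inj; rewrite [RHS]submap_rotE (emb_filter embi).
rewrite -[LHS]/(i (val (rot (submap M S r) x))) submap_rotE (next_map (emb_inj embi)) //.
by rewrite filter_uniq ?orbit_uniq.
Qed.

Lemma emb_sub_root r :
  omap emb_sub (root (submap M S r)) = root (submap M' (i @: S) (omap i r)).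
Proof.
case: r => //= x; have [xS|xS] := boolP (x \in S).
  rewrite (insubT (mem S) xS) (insubT (mem (i @: S)) (imset_f i xS)) /=.
  by congr Some; apply: val_inj.
by rewrite !insubF ?(mem_imset _ _ (emb_inj embi)) ?(negPf xS).
Qed.

Lemma emb_submap r : isomorphic (submap M S r) (submap M' (i @: S) (omap i r)).
Proof.
exists emb_sub; split; [exact: emb_sub_bij | exact: emb_sub_edge | exact: emb_sub_rot |].
exact: emb_sub_root.
Qed.

Lemma emb_nonroot_vertices r :
  map val (nonroot_vertices (submap M' (i @: S) (omap i r)))
  = map i (map val (nonroot_vertices (submap M S r))).
Proof.
rewrite /nonroot_vertices -emb_sub_root.
case: (root (submap M S r)) => //= x.
rewrite (iso_orbit_face emb_sub_bij (@emb_sub_edge r (omap i r)) (@emb_sub_rot r _)).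
by rewrite behead_map -!map_comp.
Qed.

End EmbeddedSubmap.

(** * Gluing two maps at a corner *)

(* The cycles of a permutation obtained from two disjoint permutations by      *)
(* merging the cycle of b with the cycle of c.                                 *)
Section MergedCycles.

Variables (A P T : finType) (i : A -> T) (j : P -> T).
Variables (f : A -> A) (g : P -> P) (h : T -> T) (b : A) (c : P).
Hypotheses (inji : injective i) (injj : injective j).
Hypothesis ij : forall x y, i x != j y.
Hypotheses (injf : injective f) (injg : injective g).
Hypothesis hi : forall x, h (i x) = if f x == b then j c else i (f x).
Hypothesis hj : forall y, h (j y) = if g y == c then i b else j (g y).

Lemma merged_fpath x p : b \notin p -> fpath f x p -> fpath h (i x) (map i p).
Proof.
elim: p x => //= y p IHp x; rewrite inE negb_or => /andP[yb bp] /andP[/eqP fx pp].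
by rewrite hi fx [_ == b]eq_sym (negPf yb) eqxx IHp.
Qed.

Lemma merged_fpath_r y q : c \notin q -> fpath g y q -> fpath h (j y) (map j q).
Proof.
elim: q y => //= z q IHq y; rewrite inE negb_or => /andP[zc cq] /andP[/eqP gy qq].
by rewrite hj gy [_ == c]eq_sym (negPf zc) eqxx IHq.
Qed.

Lemma merged_disjoint (s : seq A) (t : seq P) : has (mem (map i s)) (map j t) = false.
Proof.
apply/negP => /hasP[_ /mapP[y _ ->] /mapP[x _ /esym/eqP]].
by rewrite (negPf (ij x y)).
Qed.

Lemma merged_uniq (s : seq A) (t : seq P) :
  uniq s -> uniq t -> uniq (map i s ++ map j t).
Proof. by move=> us ut; rewrite cat_uniq !map_inj_uniq // us ut merged_disjoint. Qed.

Lemma fcycle_orbit_cons (U : finType) (k : U -> U) x : injective k ->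
  exists p, [/\ orbit k x = x :: p, x \notin p, uniq p, fpath k x p & k (last x p) = x].
Proof.
move=> injk; exists (behead (orbit k x)); rewrite -orbit_head.
have := orbit_uniq k x; rewrite orbit_head /= => /andP[xp up].
have := cycle_orbit injk x; rewrite {1}orbit_head /= rcons_path => /andP[pp /eqP lp].
by split.
Qed.

Lemma merged_orbit_out x : ~~ fconnect f b x -> orbit h (i x) = map i (orbit f x).
Proof.
rewrite fconnect_sym // fconnect_orbit => bx.
have [p [oE xp up pp lp]] := fcycle_orbit_cons x injf.
rewrite oE /= in bx *; rewrite inE negb_or in bx; case/andP: bx => bx bp.
apply: orbit_cycle_cons; rewrite /= ?(map_inj_uniq inji) ?up ?mem_map ?xp //.
rewrite rcons_path merged_fpath //= last_map hi lp [_ == b]eq_sym (negPf bx) eqxx //.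
Qed.

Lemma merged_orbit : orbit h (i b) = map i (orbit f b) ++ map j (orbit g c).
Proof.
have [p [oE bp up pp lp]] := fcycle_orbit_cons b injf.
have [q [oE' cq uq qq lq]] := fcycle_orbit_cons c injg.
have u1 := merged_uniq (orbit_uniq f b) (orbit_uniq g c).
rewrite oE oE' in u1 *; rewrite map_cons cat_cons in u1 *.
apply: orbit_cycle_cons => //.
rewrite /= rcons_path cat_path last_cat merged_fpath //= last_map hi lp eqxx eqxx /=.
rewrite last_map hj lq eqxx eqxx andbT.
exact: merged_fpath_r.
Qed.

Lemma merged_orbit_in x u v : orbit f x = x :: u ++ b :: v ->
  orbit h (i x) = map i (x :: u) ++ map j (orbit g c) ++ map i (b :: v).
Proof.
move=> oE; have [p [oE0 xp up pp lp]] := fcycle_orbit_cons x injf.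
move: oE0; rewrite oE => -[pE]; rewrite -{}pE in xp up pp lp.
have [q [oE' cq uq qq lq]] := fcycle_orbit_cons c injg.
have bx : b != x by apply: contraNneq xp => <-; rewrite mem_cat mem_head orbT.
have bu : b \notin u.
  by move: up; rewrite cat_uniq => /and3P[_ /norP[]].
have bv : b \notin v.
  by move: up; rewrite cat_uniq => /and3P[_ _ /andP[]].
rewrite map_cons cat_cons; apply: orbit_cycle_cons.
  rewrite cat_path in pp; case/andP: pp => ppu /= /andP[/eqP lu ppv].
  rewrite oE' /= rcons_path !cat_path !last_cat merged_fpath //= last_map hi lu !eqxx /=.
  rewrite cat_path last_cat /= last_map hj lq !eqxx /= last_map hi merged_fpath //=.
  rewrite last_cat /= in lp; rewrite lp [_ == b]eq_sym (negPf bx) eqxx !andbT.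
  exact: merged_fpath_r.
have pu : perm_eq (i x :: map i u ++ map j (orbit g c) ++ map i (b :: v))
                  (map i (x :: u ++ b :: v) ++ map j (orbit g c)).
  by rewrite /= map_cat perm_cons -catA perm_cat2l perm_catC.
rewrite (perm_uniq pu); apply: merged_uniq; last exact: orbit_uniq.
by rewrite -oE orbit_uniq.
Qed.

Variant merged_orbit_spec x : seq T -> seq A -> Prop :=
| MergedOut of ~~ fconnect f b x : merged_orbit_spec x (map i (orbit f x)) (orbit f x)
| MergedAt of x = b :
    merged_orbit_spec x (map i (orbit f b) ++ map j (orbit g c)) (orbit f b)
| MergedIn u v of fconnect f b x & orbit f x = x :: u ++ b :: v :
    merged_orbit_spec x (map i (x :: u) ++ map j (orbit g c) ++ map i (b :: v))
                      (x :: u ++ b :: v).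

Lemma merged_orbitP x : merged_orbit_spec x (orbit h (i x)) (orbit f x).
Proof.
have [bx|bx] := boolP (fconnect f b x); last first.
  by rewrite merged_orbit_out //; constructor.
have [->|xb] := eqVneq x b; first by rewrite merged_orbit; constructor.
have := bx; rewrite fconnect_sym // fconnect_orbit; have := orbit_head f x.
move: (behead _) => s oE; rewrite {1}oE inE eq_sym (negPf xb) /= => bs.
case/splitPr: bs oE => [u v] oE; rewrite oE.
by rewrite (merged_orbit_in oE); constructor.
Qed.

Lemma filter_codom_l (s : seq A) : [seq z <- map i s | z \in codom i] = map i s.
Proof.
by apply/all_filterP/allP => _ /mapP[x _ ->]; apply: codom_f.
Qed.

Lemma filter_codom_r (t : seq P) : [seq z <- map j t | z \in codom i] = [::].
Proof.
rewrite (@eq_in_filter _ _ pred0) ?filter_pred0 // => _ /mapP[y _ ->].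
by apply/negP => /codomP[x /esym/eqP]; rewrite (negPf (ij x y)).
Qed.

Lemma merged_filter x : [seq z <- orbit h (i x) | z \in codom i] = map i (orbit f x).
Proof.
case: merged_orbitP => [bx|_|u v bx oE];
  rewrite ?filter_cat ?filter_codom_r ?filter_codom_l ?cats0 //.
by rewrite /= map_cat.
Qed.

Lemma merged_fconnect_l x x' : fconnect h (i x) (i x') = fconnect f x x'.
Proof.
by rewrite !fconnect_orbit -(mem_map inji) -merged_filter mem_filter codom_f.
Qed.

Lemma mem_map_cross (s : seq A) y : (j y \in map i s) = false.
Proof. by apply/mapP => -[x _ /esym/eqP]; rewrite (negPf (ij x y)). Qed.

Lemma merged_fconnect_lr x y :
  fconnect h (i x) (j y) = fconnect f b x && fconnect g c y.
Proof.
rewrite fconnect_orbit [fconnect g c y]fconnect_orbit.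
case: merged_orbitP => [bx|->|u v bx oE]; rewrite ?mem_cat !mem_map_cross ?mem_map //=.
- by rewrite (negPf bx).
- by rewrite connect0.
- by rewrite bx orbF.
Qed.

End MergedCycles.

(* P is inserted in the corner of A just before the dart b, its dart c coming  *)
(* first.                                                                      *)
Definition glue (DA DP : finType) (A : premap DA) (b : DA) (P : premap DP) (c : DP) :
    premap (DA + DP)%type :=
  Premap
    [ffun z => match z with inl x => inl (edge A x) | inr y => inr (edge P y) end]
    [ffun z => tperm (inl b) (inr c)
       match z with inl x => inl (rot A x) | inr y => inr (rot P y) end]
    (omap inl (root A)).

Lemma inl_inj (U V : Type) : injective (@inl U V). Proof. by move=> x y []. Qed.
Lemma inr_inj (U V : Type) : injective (@inr U V). Proof. by move=> x y []. Qed.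

Lemma fcard_sum (DA DP : finType) (f : DA -> DA) (g : DP -> DP) :
    injective f -> injective g ->
  fcard (fun z : DA + DP => match z with inl x => inl (f x) | inr y => inr (g y) end)
    {: DA + DP} = fcard f DA + fcard g DP.
Proof.
set k := (fun z => _) => injf injg.
have injk : injective k by case=> x [] y // []; [move/injf|move/injg] => ->.
rewrite (n_compC (mem (codom (@inl DA DP)))).
rewrite (n_comp_codom injf injk (@inl_inj _ _)) // -(n_comp_codom injg injk (@inr_inj DA DP)) //.
have inlE (z : DA + DP) : (z \in codom inl) = (z : bool).
  case: z => x; first exact: codom_f.
  by apply/negP => /codomP[].
have inrE (z : DA + DP) : (z \in codom inr) = ~~ z.
  case: z => x; last exact: codom_f.
  by apply/negP => /codomP[].
by congr addn; apply: eq_n_comp_r => z; rewrite inrE !inE inlE.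
Qed.

Section Glue.

Variables (DA DP : finType) (A : premap DA) (P : premap DP) (b : DA) (c : DP).
Hypotheses (okA : darts_ok A) (okP : darts_ok P).

Local Notation G := (glue A b P c).

Lemma glue_edge_l x : edge G (inl x) = inl (edge A x). Proof. by rewrite ffunE. Qed.
Lemma glue_edge_r y : edge G (inr y) = inr (edge P y). Proof. by rewrite ffunE. Qed.

Lemma glue_rot_l x : rot G (inl x) = if rot A x == b then inr c else inl (rot A x).
Proof.
rewrite ffunE; have [->|xb] := eqVneq (rot A x) b; first by rewrite tpermL.
by rewrite tpermD // (inj_eq (@inl_inj _ _)) eq_sym.
Qed.

Lemma glue_rot_r y : rot G (inr y) = if rot P y == c then inl b else inr (rot P y).
Proof.
rewrite ffunE; have [->|yc] := eqVneq (rot P y) c; first by rewrite tpermR.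
by rewrite tpermD // (inj_eq (@inr_inj _ _)) eq_sym.
Qed.

Lemma glue_face_l x : face G (inl x) = if face A x == b then inr c else inl (face A x).
Proof. by rewrite /face glue_edge_l glue_rot_l. Qed.

Lemma glue_face_r y : face G (inr y) = if face P y == c then inl b else inr (face P y).
Proof. by rewrite /face glue_edge_r glue_rot_r. Qed.

Lemma glue_ok : darts_ok G.
Proof.
split=> [[x|y]|[x|y]|].
- by rewrite !glue_edge_l edgeK.
- by rewrite !glue_edge_r edgeK.
- by rewrite glue_edge_l (inj_eq (@inl_inj _ _)) edge_neq.
- by rewrite glue_edge_r (inj_eq (@inr_inj _ _)) edge_neq.
- move=> x y; rewrite !ffunE => /perm_inj.
  by case: x => x; case: y => y // []; [move/(rot_inj okA)|move/(rot_inj okP)] => ->.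
Qed.

Lemma inl_inr (x : DA) (y : DP) : inl x != inr y. Proof. by []. Qed.
Lemma inr_inl (y : DP) (x : DA) : inr y != inl x. Proof. by []. Qed.

Lemma glue_embeds_l : embeds A G inl.
Proof.
split; [exact: inl_inj|by move=> x; rewrite glue_edge_l|].
exact: (merged_filter (@inl_inj _ _) (@inr_inj _ _) inl_inr (rot_inj okA) (rot_inj okP)
    glue_rot_l glue_rot_r).
Qed.

Lemma glue_embeds_r : embeds P G inr.
Proof.
split; [exact: inr_inj|by move=> x; rewrite glue_edge_r|].
exact: (merged_filter (@inr_inj _ _) (@inl_inj _ _) inr_inl (rot_inj okP) (rot_inj okA)
    glue_rot_r glue_rot_l).
Qed.

Lemma glue_same_vertex_l x x' : same_vertex G (inl x) (inl x') = same_vertex A x x'.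
Proof. exact: emb_same_vertex glue_embeds_l x x'. Qed.

Lemma glue_same_vertex_r y y' : same_vertex G (inr y) (inr y') = same_vertex P y y'.
Proof. exact: emb_same_vertex glue_embeds_r y y'. Qed.

Lemma glue_same_vertex_lr x y :
  same_vertex G (inl x) (inr y) = same_vertex A b x && same_vertex P c y.
Proof.
exact: (merged_fconnect_lr (@inl_inj _ _) (@inr_inj _ _) inl_inr (rot_inj okA) (rot_inj okP)
    glue_rot_l glue_rot_r).
Qed.

Lemma glue_fconnect_face_l x x' : fconnect (face G) (inl x) (inl x') = fconnect (face A) x x'.
Proof.
exact: (merged_fconnect_l (@inl_inj _ _) (@inr_inj _ _) inl_inr (face_inj okA) (face_inj okP)
    glue_face_l glue_face_r).
Qed.

Lemma glue_fconnect_face_lr x y :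
  fconnect (face G) (inl x) (inr y) = fconnect (face A) b x && fconnect (face P) c y.
Proof.
exact: (merged_fconnect_lr (@inl_inj _ _) (@inr_inj _ _) inl_inr (face_inj okA) (face_inj okP)
    glue_face_l glue_face_r).
Qed.

(** In the disjoint union, [inl b] and [inr c] lie on different cycles, so the transposition joins
    them. Used for [rot] and for [face]: a gluing loses one vertex and one face, in accordance with
    Euler's formula. *)
Lemma fcard_merged (f : DA -> DA) (g : DP -> DP) (h : DA + DP -> DA + DP) :
    injective f -> injective g ->
    (forall z, h z = tperm (inl b) (inr c)
       match z with inl x => inl (f x) | inr y => inr (g y) end) ->
  (fcard h {: DA + DP}).+1 = fcard f DA + fcard g DP.
Proof.
move=> injf injg hE; rewrite -fcard_sum //; set k := (fun z => _).
have injk : injective k by case=> x [] y // []; [move/injf|move/injg] => ->.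
have kE := fcard_tperm injk (inl_inr b c).
have hk : fcard h {: DA + DP} = fcard (tperm (inl b) (inr c) \o k) {: DA + DP}.
  exact: eq_fcard.
suff nk : ~~ fconnect k (inl b) (inr c).
  by move: kE; rewrite -hk nk; move: (fcard _ _) (fcard _ _) => m n; clear; lia.
apply/negP => bc; have invk : forall y z, fconnect k y z -> y -> z.
  by move=> y z; apply: connect_ind => -[x|x] _ /eqP <-.
by have := invk (inl b) (inr c) bc isT.
Qed.

Lemma glue_fcard_rot : (fcard (rot G) {: DA + DP}).+1 = fcard (rot A) DA + fcard (rot P) DP.
Proof. by apply: fcard_merged; [exact: rot_inj|exact: rot_inj|move=> z; rewrite ffunE]. Qed.

Lemma glue_fcard_face :
  (fcard (face G) {: DA + DP}).+1 = fcard (face A) DA + fcard (face P) DP.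
Proof.
apply: fcard_merged; [exact: face_inj|exact: face_inj|].
by case=> x; rewrite /face !ffunE.
Qed.

Lemma glue_nedges : nedges (DA + DP)%type = nedges DA + nedges DP.
Proof.
have := card_darts okA; have := card_darts okP; have := card_darts glue_ok.
rewrite card_sum; move: #|DA| #|DP| => nA nP.
move: (nedges DA) (nedges DP) (nedges (DA + DP)%type) => n m p; clear; lia.
Qed.

Lemma glue_connected : connected_in A [set: DA] -> connected_in P [set: DP] ->
  connected_in G [set: (DA + DP)%type].
Proof.
move=> cA cP.
have inlP x x' : connect (step_in G setT) (inl x) (inl x').
  have /connected_inP/(_ x x' (in_setT _) (in_setT _)) := cA.
  apply: (connect_homo (h := inl)) => u v /and3P[_ _ uv]; apply: connect1.
  by rewrite /step_in /= !inE glue_same_vertex_l glue_edge_l (inj_eq (@inl_inj _ _)).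
have inrP y y' : connect (step_in G setT) (inr y) (inr y').
  have /connected_inP/(_ y y' (in_setT _) (in_setT _)) := cP.
  apply: (connect_homo (h := inr)) => u v /and3P[_ _ uv]; apply: connect1.
  by rewrite /step_in /= !inE glue_same_vertex_r glue_edge_r (inj_eq (@inr_inj _ _)).
have bc : connect (step_in G setT) (inl b) (inr c).
  by apply: connect1; rewrite /step_in /= !inE glue_same_vertex_lr !same_vertex_refl orbT.
have lr x y : connect (step_in G setT) (inl x) (inr y).
  exact: connect_trans (connect_trans (inlP x b) bc) (inrP c y).
apply/connected_inP => -[x|y] [x'|y'] _ _ //.
by rewrite connect_step_sym //; apply: glue_ok.
Qed.

Hypotheses (loopA : forall x, ~~ same_vertex A x (edge A x)).
Hypotheses (loopP : forall x, ~~ same_vertex P x (edge P x)).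

(** The glued vertex is a cut vertex. A path in [S] between the sides crosses there, from some [u]
    to some [w]. As there are no loops, the reverses of [u] and [w] survive the removal of that
    vertex, and a path between them would have to cross once more, at a vertex that is gone. *)
Lemma glue_nonseparable_side S : nonseparable G S ->
  forall x y, inl x \in S -> inr y \in S -> False.
Proof.
case/and4P=> _ /forall_inP eS cS /forallP vS x y xS yS.
pose left (z : DA + DP) := if z is inl _ then true else false.
have cross B z z' : connect (step_in G B) z z' -> left z -> ~~ left z' ->
    exists x y, [/\ inl x \in B, inr y \in B & same_vertex G (inl x) (inr y)].
  move=> zz' lz; apply: contraNP => nex.
  apply: (connect_ind (P := left)) zz' lz => -[u|u] [w|w] //= /and3P[uB wB].
  by rewrite ffunE /= => uw; case: nex; exists u, w.
have [u [w [uS wS uw]]] := cross S _ _ (connected_inP _ _ cS _ _ xS yS) isT isT.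
have [|u' [w' [u'S w'S uw']]] :=
  cross (S :\: vertex G (inl u)) (inl (edge A u)) (inr (edge P w)) _ isT isT.
  apply: connected_inP (vS (inl u)) _ _ _ _; rewrite !inE.
    by rewrite glue_same_vertex_l loopA -glue_edge_l eS.
  rewrite -glue_edge_r eS // andbT glue_edge_r; move: uw.
  rewrite !glue_same_vertex_lr => /andP[bu cw]; rewrite bu /=.
  by apply: contra (loopP w); apply: same_vertex_trans; rewrite same_vertex_sym.
move: u'S; rewrite !inE glue_same_vertex_l => /andP[/negP[]].
move: uw uw'; rewrite !glue_same_vertex_lr => /andP[bu _] /andP[bu' _].
by apply: (same_vertex_trans _ bu'); rewrite same_vertex_sym.
Qed.

Lemma glue_saturated_l : saturated G inl.
Proof.
move=> S nS x xS; apply/subsetP => -[x' _|y yS]; first exact: codom_f.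
by case: (glue_nonseparable_side nS xS yS).
Qed.

Lemma glue_saturated_r : saturated G inr.
Proof.
move=> S nS y yS; apply/subsetP => -[x xS|y' _]; last exact: codom_f.
by case: (glue_nonseparable_side nS xS yS).
Qed.

End Glue.

Lemma nverticesE (D : finType) (M : premap D) (x : D) : nvertices M = fcard (rot M) D.
Proof. by rewrite /nvertices (cardD1 x) inE. Qed.

Lemma nfacesE (D : finType) (M : premap D) (x : D) : nfaces M = fcard (face M) D.
Proof. by rewrite /nfaces (cardD1 x) inE. Qed.

Section GlueOuterplanar.

Variables (DA DP : finType) (A : premap DA) (P : premap DP) (b : DA) (c : DP).

Local Notation G := (glue A b P c).

Lemma glue_nvertices : darts_ok A -> darts_ok P -> (nvertices G).+1 = nvertices A + nvertices P.
Proof.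
move=> okA okP; rewrite (nverticesE G (inl b)) (nverticesE A b) (nverticesE P c).
exact: glue_fcard_rot.
Qed.

Lemma glue_nfaces : darts_ok A -> darts_ok P -> (nfaces G).+1 = nfaces A + nfaces P.
Proof.
move=> okA okP; rewrite (nfacesE G (inl b)) (nfacesE A b) (nfacesE P c).
exact: glue_fcard_face.
Qed.

(** As [b] is on the outer face of [A] and [c] is the root of [P], the two faces that merge are the
    outer ones, so no vertex is cut off from the outer face. *)
Lemma glue_rop : rop_spec A -> rop_spec P -> outer_dart A b -> root P = Some c ->
  rop_spec G.
Proof.
move=> [okA cA EA rtA lA sA oA] [okP cP EP rtP lP sP oP] ob rP.
split=> [|||||[x|x] [y|y]|[x|y]].
- exact: glue_ok.
- exact: glue_connected.
- rewrite (glue_nedges b c okA okP); move: EA EP (glue_nvertices okA okP) (glue_nfaces okA okP).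
  by clear; lia.
- rewrite /= card_sum addn_gt0 -rtA; move: ob; rewrite /outer_dart.
  by case: (root A).
- by case=> x; rewrite ?glue_edge_l ?glue_edge_r (glue_same_vertex_l, glue_same_vertex_r).
- by rewrite !glue_edge_l !glue_same_vertex_l // => xy exy; congr inl; apply: sA.
- rewrite glue_edge_l glue_edge_r !glue_same_vertex_lr // => /andP[bx _] /andP[bex _].
  by have := lA x; rewrite (same_vertex_trans _ bex) // same_vertex_sym.
- rewrite glue_edge_l glue_edge_r !(same_vertex_sym (glue_ok b c okA okP) (inr _)).
  rewrite !glue_same_vertex_lr // => /andP[bx _] /andP[bex _].
  by have := lA y; rewrite (same_vertex_trans _ bex) // same_vertex_sym.
- by rewrite !glue_edge_r !glue_same_vertex_r // => xy exy; congr inr; apply: sP.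
- have [y oy xy] := oA x; exists (inl y); last by rewrite glue_same_vertex_l.
  move: oy; rewrite /outer_dart /=; case: (root A) => //= r.
  by rewrite glue_fconnect_face_l.
- have [z oz yz] := oP y; exists (inr z); last by rewrite glue_same_vertex_r.
  move: ob oz; rewrite /outer_dart /= rP; case: (root A) => //= r rb cz.
  by rewrite glue_fconnect_face_lr // cz fconnect_sym ?rb //; apply: face_inj.
Qed.

Lemma glue_rop_inv r :
    darts_ok A -> darts_ok P ->
    connected_in A [set: DA] -> connected_in P [set: DP] ->
    root A = Some r -> root P = Some c -> outer_dart G (inl b) -> rop_spec G ->
  rop_spec A /\ rop_spec P.
Proof.
move=> okA okP cA cP rA rP ob [_ _ EG rtG lG sG oG].
have cb : fconnect (face A) b r.
  move: ob; rewrite /outer_dart /= rA /= glue_fconnect_face_l // fconnect_sym //.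
  exact: face_inj.
have oA x : outer_dart G x -> if x is inl x' then outer_dart A x' : bool else true.
  by case: x => // x; rewrite /outer_dart /= rA /= glue_fconnect_face_l.
have oP x : outer_dart G x -> if x is inr x' then outer_dart P x' : bool else true.
  by case: x => // x; rewrite /outer_dart /= rA rP /= glue_fconnect_face_lr // => /andP[].
(* Both parts satisfy the Euler inequality, and planarity of the glued map makes the sum of the two
   inequalities an equality. *)
have [EA EP] : nvertices A + nfaces A = nedges DA + 2 /\ nvertices P + nfaces P = nedges DP + 2.
  have := genus_ge0 okA cA; have := genus_ge0 okP cP.
  move: EG (glue_nvertices okA okP) (glue_nfaces okA okP).
  rewrite (glue_nedges b c okA okP) !(nverticesE A b) !(nverticesE P c).
  rewrite !(nfacesE A b) !(nfacesE P c).
  by clear; lia.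
split; split=> //.
- by rewrite rA (cardD1 b) inE.
- by move=> x; have := lG (inl x); rewrite glue_edge_l glue_same_vertex_l.
- move=> x y xy exy; apply: inl_inj; apply: sG; first by rewrite glue_same_vertex_l.
  by rewrite !glue_edge_l glue_same_vertex_l.
- move=> x; have [[y|y] oy] := oG (inl x).
    by rewrite glue_same_vertex_l // => xy; exists y => //; apply: oA oy.
  rewrite glue_same_vertex_lr // => /andP[bx _]; exists b; first exact: oA ob.
  by rewrite same_vertex_sym.
- by rewrite rP (cardD1 c) inE.
- by move=> x; have := lG (inr x); rewrite glue_edge_r glue_same_vertex_r.
- move=> x y xy exy; apply: inr_inj; apply: sG; first by rewrite glue_same_vertex_r.
  by rewrite !glue_edge_r glue_same_vertex_r.
- move=> x; have [[y|y] oy] := oG (inr x); last first.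
    by rewrite glue_same_vertex_r // => xy; exists y => //; apply: oP oy.
  rewrite same_vertex_sym ?glue_same_vertex_lr //; last exact: glue_ok.
  move=> /andP[_ cx]; exists c; last by rewrite same_vertex_sym.
  by rewrite /outer_dart rP.
Qed.

End GlueOuterplanar.

Section GlueIso.

Variables (DA DP DA' DP' : finType) (A : premap DA) (P : premap DP).
Variables (A' : premap DA') (P' : premap DP') (f : DA -> DA') (g : DP -> DP').
Hypotheses (bijf : bijective f) (bijg : bijective g).
Hypotheses (fe : {morph f : x / edge A x >-> edge A' x}).
Hypotheses (ge : {morph g : x / edge P x >-> edge P' x}).
Hypotheses (fr : {morph f : x / rot A x >-> rot A' x}).
Hypotheses (gr : {morph g : x / rot P x >-> rot P' x}).
Hypothesis frt : omap f (root A) = root A'.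

Definition sum_map (z : DA + DP) : DA' + DP' :=
  match z with inl x => inl (f x) | inr y => inr (g y) end.

Lemma glue_isomorphic b c : isomorphic (glue A b P c) (glue A' (f b) P' (g c)).
Proof.
have injf := bij_inj bijf; have injg := bij_inj bijg.
have smE (z : DA + DP) : rot (glue A' (f b) P' (g c)) (sum_map z)
    = sum_map (rot (glue A b P c) z).
  case: z => z /=.
    by rewrite !glue_rot_l -fr (inj_eq injf); case: ifP.
  by rewrite !glue_rot_r -gr (inj_eq injg); case: ifP.
exists sum_map; split=> [|[x|y]|z|].
- have [[f' fK f'K] [g' gK g'K]] := (bijf, bijg).
  exists (fun z => match z with inl x => inl (f' x) | inr y => inr (g' y) end).
    by case=> x /=; rewrite ?fK ?gK.
  by case=> x /=; rewrite ?f'K ?g'K.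
- by rewrite !glue_edge_l /= fe.
- by rewrite !glue_edge_r /= ge.
- by rewrite smE.
- by rewrite /= -frt; case: (root A).
Qed.

End GlueIso.

(** * Splitting a vertex *)

(** Meant for sets closed under [rot] and [edge], such as components; unlike in [submap], no dart
    has to be skipped around a vertex. *)
Definition restriction (D : finType) (M : premap D) (K : {set D}) (r : option {x | x \in K}) :
    premap {x | x \in K} :=
  Premap [ffun x : {x | x \in K} => insubd x (edge M (val x))]
         [ffun x : {x | x \in K} => insubd x (rot M (val x))] r.

Section Restriction.

Variables (D : finType) (M : premap D) (K : {set D}).
Variable r : option {x | x \in K}.
Hypotheses (okM : darts_ok M).
Hypotheses (eK : forall x, (edge M x \in K) = (x \in K)).
Hypotheses (sK : forall x, (rot M x \in K) = (x \in K)).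

Local Notation R := (restriction M r).

Lemma restriction_edgeE x : val (edge R x) = edge M (val x).
Proof. by rewrite ffunE val_insubd eK (valP x). Qed.

Lemma restriction_rotE x : val (rot R x) = rot M (val x).
Proof. by rewrite ffunE val_insubd sK (valP x). Qed.

Lemma restriction_ok : darts_ok R.
Proof.
split=> [x|x|x y /(congr1 val)].
- by apply: val_inj; rewrite !restriction_edgeE edgeK.
- by rewrite -(inj_eq val_inj) restriction_edgeE edge_neq.
- by rewrite !restriction_rotE => /(rot_inj okM)/val_inj.
Qed.

Lemma restriction_same_vertex x y : same_vertex R x y = same_vertex M (val x) (val y).
Proof.
by apply/esym; apply: (fconnect_map val_inj) => z; rewrite restriction_rotE.
Qed.

Lemma restriction_connected :
    {in K &, forall x y, connect (step_in M [set: D]) x y} ->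
  connected_in R [set: {x | x \in K}].
Proof.
move=> cK; apply/connected_inP => x y _ _.
pose Q z := [forall y, (val y == z) ==> connect (step_in R setT) x y].
suff /forallP/(_ y) : Q (val y) by rewrite eqxx.
have xy := cK _ _ (valP x) (valP y).
apply: (connect_ind _ xy); last first.
  by apply/forallP => z; apply/implyP => /eqP/val_inj->.
move=> u w /and3P[_ _ uw] /forallP Qu; apply/forallP => w'; apply/implyP => /eqP eqw.
have uK : u \in K.
  have := valP w'; rewrite eqw; case/orP: uw => [/eqP->|uw]; first by rewrite eK.
  rewrite -(closed_connect _ uw) // => z _ /eqP<-; exact/esym/sK.
apply: connect_trans (implyP (Qu (Sub u uK)) (eqxx _)) _; apply: connect1.
by rewrite /step_in /= !inE restriction_same_vertex -(inj_eq val_inj) restriction_edgeE eqw.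
Qed.

End Restriction.

(** For [p] and [q] at one vertex, the transposition cuts its cycle into one through [p] and one
    through [q]; gluing will apply the same transposition again. *)
Definition split_map (D : finType) (M : premap D) (p q : D) : premap D :=
  Premap (edge M) [ffun z => tperm p q (rot M z)] (root M).

Section Split.

Variables (D : finType) (M : premap D) (p q : D).
Hypotheses (ropM : rop_spec M) (pq : p != q) (vpq : same_vertex M p q).

Let okM : darts_ok M := rop_ok ropM.

Local Notation N := (split_map M p q).
Local Notation linked := (connect (step_in N [set: D])).

Lemma split_ok : darts_ok N.
Proof.
split; [exact: (edgeK okM)|exact: (edge_neq okM)|].
by move=> x y; rewrite !ffunE => /perm_inj/(rot_inj okM).
Qed.

Lemma split_rot_notin z : rot N z \notin [:: p; q] -> rot M z = rot N z.
Proof.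
rewrite !inE negb_or => /andP[]; rewrite ffunE; case: tpermP => [->|->|//].
  by rewrite eqxx.
by rewrite eqxx.
Qed.

Lemma split_linked_edge x : linked x (edge M x).
Proof. by apply: connect1; rewrite /step_in /= !inE eqxx. Qed.

Lemma split_linked_rot x : linked x (rot N x).
Proof. by apply: connect1; rewrite /step_in /= !inE /same_vertex fconnect1 orbT. Qed.

Lemma split_linked_rot_or x : linked x (rot M x) \/ rot M x = p \/ rot M x = q.
Proof.
have [|/split_rot_notin ->] := boolP (rot N x \in [:: p; q]); last first.
  by left; apply: split_linked_rot.
rewrite !inE ffunE; case: tpermP => [-> _|-> _|]; [by right; left|by right; right|].
by move=> /eqP/negPf-> /eqP/negPf->.
Qed.

(** Splitting redirects only the rotation steps that lead to [p] or [q], so a path of [M] can be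
    resumed from one of these two darts. *)
Lemma split_linkedP x : linked p x || linked q x.
Proof.
have pp : linked p p || linked q p by rewrite connect0.
apply: (connect_setT (P := fun z => linked p z || linked q z) (rop_conn ropM) _ _ _ pp) => y.
  by case/orP=> py; rewrite (connect_trans py (split_linked_edge y)) ?orbT.
move=> py; have [yy|[->|->]] := split_linked_rot_or y.
- by case/orP: py => py; rewrite (connect_trans py yy) ?orbT.
- by rewrite connect0.
- by rewrite connect0 orbT.
Qed.

(* Splitting the vertex splits the face as well, so that the split map would   *)
(* have negative genus if it was connected.                                    *)
Lemma split_disconnected : fconnect (face M) p q -> ~~ linked p q.
Proof.
move=> fpq; apply/negP => lpq.
have cN : connected_in N [set: D].
  suff cp z : linked p z.
    apply/connected_inP => x y _ _; apply: connect_trans (cp y).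
    by rewrite connect_step_sym //; apply: split_ok.
  by case/orP: (split_linkedP z) => // qz; apply: connect_trans lpq qz.
have := genus_ge0 split_ok cN; have := rop_euler ropM; rewrite (nverticesE M p) (nfacesE M p).
have := fcard_tperm (rot_inj okM) pq; rewrite [fconnect _ _ _]vpq.
have := fcard_tperm (face_inj okM) pq; rewrite fpq.
have -> : fcard (tperm p q \o rot M) D = fcard (rot N) D.
  by apply: eq_fcard => z; rewrite ffunE.
have -> : fcard (tperm p q \o face M) D = fcard (face N) D.
  by apply: eq_fcard => z; rewrite /face ffunE.
move: (fcard _ _) (fcard _ _) (fcard _ _) (fcard _ _) (nedges D) => a b c d e.
by clear; lia.
Qed.

Hypotheses (op : outer_dart M p) (oq : outer_dart M q).

Lemma outer_fconnect x y : outer_dart M x -> outer_dart M y -> fconnect (face M) x y.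
Proof.
rewrite /outer_dart; case: (root M) => // r rx ry; apply: connect_trans ry.
by rewrite fconnect_sym //; apply: face_inj.
Qed.

(** The two components of the split map are the parts. The one that contains the root of [M] is [A],
    the other one is rooted at [q], and [glue_rop_inv] makes both outerplanar. *)
Lemma split_glue r : root M = Some r -> linked p r ->
  exists (DA DP : finType) (A : premap DA) (P : premap DP) (b : DA) (c : DP)
         (f : D -> DA + DP),
    [/\ rop_spec A /\ rop_spec P, root P = Some c, isomorphism M (glue A b P c) f,
        f p = inl b & f q = inr c].
Proof.
move=> rM lpr; have npq := split_disconnected (outer_fconnect op oq).
have lsym x y : linked x y = linked y x by exact: (connect_step_sym split_ok).
pose K := [set z | linked p z].
have eK x : (edge N x \in K) = (x \in K).
  rewrite !inE; apply/idP/idP => px; apply: connect_trans px _; last exact: split_linked_edge.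
  by rewrite lsym; apply: split_linked_edge.
have sK x : (rot N x \in K) = (x \in K).
  rewrite !inE; apply/idP/idP => px; apply: connect_trans px _; last exact: split_linked_rot.
  by rewrite lsym; apply: split_linked_rot.
have eKC x : (edge N x \in ~: K) = (x \in ~: K) by rewrite !in_setC eK.
have sKC x : (rot N x \in ~: K) = (x \in ~: K) by rewrite !in_setC sK.
have pK : p \in K by rewrite inE connect0.
have rK : r \in K by rewrite inE.
have qK : q \in ~: K by rewrite !inE.
pose b : {x | x \in K} := Sub p pK; pose c : {x | x \in ~: K} := Sub q qK.
pose A := restriction N (Some (Sub r rK : {x | x \in K})).
pose P := restriction N (Some c).
have okA : darts_ok A by apply: (restriction_ok _ split_ok).
have okP : darts_ok P by apply: (restriction_ok _ split_ok).
have cA : connected_in A [set: _].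
  apply: restriction_connected => // x y; rewrite !inE => px py.
  by apply: connect_trans py; rewrite lsym.
have cP : connected_in P [set: _].
  apply: restriction_connected => // x y; rewrite !inE => px py.
  have qx : linked q x by case/orP: (split_linkedP x) => // px'; rewrite px' in px.
  have qy : linked q y by case/orP: (split_linkedP y) => // py'; rewrite py' in py.
  by apply: connect_trans qy; rewrite lsym.
pose g (z : {x | x \in K} + {x | x \in ~: K}) : D :=
  match z with inl x => val x | inr y => val y end.
pose f (z : D) : {x | x \in K} + {x | x \in ~: K} :=
  if insub z is Some x then inl x else inr (insubd c z).
have gK : cancel f g.
  move=> z; rewrite /f; case: insubP => [x _ //|zK] /=.
  by rewrite val_insubd inE zK.
have fK : cancel g f.
  case=> x; rewrite /f /=; first by rewrite valK.
  rewrite insubF; last by have := valP x; rewrite inE => /negbTE.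
  by rewrite valKd.
have bijg : bijective g by exists f.
have ge : {morph g : z / edge (glue A b P c) z >-> edge M z}.
  case=> x; first by rewrite glue_edge_l; apply: (restriction_edgeE _ eK).
  by rewrite glue_edge_r; apply: (restriction_edgeE _ eKC).
(* The rotation of the glued map applies the transposition of [p] and [q] a second time, which
   undoes the split. *)
have gr : {morph g : z / rot (glue A b P c) z >-> rot M z}.
  case=> x; rewrite ?glue_rot_l ?glue_rot_r /=.
    have vx : val (rot A x) = tperm p q (rot M (val x)) by rewrite restriction_rotE // ffunE.
    case: eqP => [xb|/eqP xb] /=.
      apply: (@perm_inj _ (tperm p q)); rewrite -vx xb tpermR //.
    rewrite -[RHS](tpermK p q) -vx tpermD //; first by rewrite eq_sym.
    by apply: contraTneq (valP (rot A x)) => <-; move: (qK); rewrite in_setC.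
  have vx : val (rot P x) = tperm p q (rot M (val x)) by rewrite restriction_rotE // ffunE.
  case: eqP => [xc|/eqP xc] /=.
    apply: (@perm_inj _ (tperm p q)); rewrite -vx xc tpermL //.
  rewrite -[RHS](tpermK p q) -vx tpermD //; last by rewrite eq_sym.
  by apply: contraTneq (valP (rot P x)) => <-; rewrite in_setC pK.
have fe : {morph f : z / edge M z >-> edge (glue A b P c) z}.
  by move=> z; rewrite -{1}[z]gK -ge fK.
have fr : {morph f : z / rot M z >-> rot (glue A b P c) z}.
  by move=> z; rewrite -{1}[z]gK -gr fK.
have frt : omap f (root M) = root (glue A b P c).
  by rewrite rM /= -[r in f r]/(g (inl (Sub r rK))) fK.
have isof : isomorphism M (glue A b P c) f by split=> //; exists g.
have fp : f p = inl b by rewrite -[p in f p]/(g (inl b)) fK.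
have fq : f q = inr c by rewrite -[q in f q]/(g (inr c)) fK.
exists _, _, A, P, b, c, f; split=> //.
apply: (@glue_rop_inv _ _ A P b c (Sub r rK)) => //.
  have := op; rewrite /outer_dart -frt rM /= -fp (fconnect_map _ (iso_face fe fr)) //.
  exact: can_inj gK.
by apply: rop_isomorphic ropM; exists f.
Qed.

End Split.

Lemma split_mapC (D : finType) (M : premap D) p q : split_map M p q = split_map M q p.
Proof. by congr Premap; apply/ffunP => z; rewrite !ffunE tpermC. Qed.

Lemma isomorphism_nonseparable (D D' : finType) (M : premap D) (M' : premap D') f :
    isomorphism M M' f -> darts_ok M -> darts_ok M' ->
  nonseparable M' [set: D'] = nonseparable M [set: D].
Proof.
case=> bijf fe fr _ okM okM'; have embf := isomorphism_embeds bijf fe fr.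
rewrite -(emb_nonseparable okM' embf); congr nonseparable.
apply/setP => y; rewrite inE; have [g _ gK] := bijf.
by rewrite -[y]gK imset_f ?inE.
Qed.

(** * Outer walk, inner faces and non-separability *)

Section OuterFace.

Variables (D : finType) (M : premap D) (r : D).
Hypotheses (ropM : rop_spec M) (rM : root M = Some r).

Let okM : darts_ok M := rop_ok ropM.

Lemma outer_dartE x : outer_dart M x = fconnect (face M) r x.
Proof. by rewrite /outer_dart rM. Qed.

(* If an inner face met a vertex twice, splitting that vertex would detach a   *)
(* part of the map that does not contain the outer face.                       *)
Lemma inner_face_simple x y : ~~ outer_dart M x ->
  fconnect (face M) x y -> same_vertex M x y -> x = y.
Proof.
move=> nox fxy vxy; apply/eqP; apply/negPn/negP => xy.
have ndisc := split_disconnected ropM xy vxy fxy.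
set N := split_map M x y in ndisc; have okN : darts_ok N by apply: split_ok.
have noy : ~~ outer_dart M y.
  apply: contra nox; rewrite !outer_dartE => ry; apply: connect_trans ry _.
  by rewrite fconnect_sym //; apply: face_inj.
have lsym := @connect_step_sym _ _ okN setT.
(* Neither [x] nor [y] is on the outer face, so its walk survives the split. *)
have outN z : outer_dart M z -> connect (step_in N setT) r z.
  rewrite outer_dartE => rz; pose Q z := outer_dart M z && connect (step_in N setT) r z.
  suff /andP[] : Q z by [].
  apply: (connect_ind (P := Q) _ rz); last by rewrite /Q outer_dartE !connect0.
  move=> u w /eqP <- /andP[ou ru]; have ofu : outer_dart M (face M u).
    by move: ou; rewrite !outer_dartE => ou; apply: connect_trans ou (fconnect1 _ _).
  rewrite /Q ofu; apply: connect_trans ru _.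
  apply: connect_trans (split_linked_edge _ _ _ _) _.
  have -> : face M u = rot N (edge M u); last exact: split_linked_rot.
  apply: split_rot_notin; rewrite ffunE -[rot M _]/(face M u) tpermD; last 2 first.
  - by apply: contraNneq nox => ->.
  - by apply: contraNneq noy => ->.
  by rewrite !inE negb_or; apply/andP; split; [apply: contraNneq nox|apply: contraNneq noy] => <-.
have vN u w : ~~ same_vertex M x u -> same_vertex M u w -> connect (step_in N setT) u w.
  move=> xu uw; pose Q z := same_vertex M u z && connect (step_in N setT) u z.
  suff /andP[] : Q w by [].
  apply: (connect_ind (P := Q) _ uw); last by rewrite /Q same_vertex_refl connect0.
  move=> z _ /eqP <- /andP[uz lz]; have uz' := connect_trans uz (fconnect1 (rot M) z).
  rewrite /Q [same_vertex _ _ _]uz' /=; apply: connect_trans lz _.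
  have [//|eqz] := split_linked_rot_or M x y z.
  case/negP: xu; case: eqz => eqz; rewrite eqz -/(same_vertex M u _) in uz'.
    by rewrite same_vertex_sym.
  by apply: same_vertex_trans vxy _; rewrite same_vertex_sym.
(* Without loops, the other end of [z] is a vertex that the split leaves intact, and this vertex has
   an outer dart. So both halves of the split vertex reach the root. *)
have toR z : same_vertex M x z -> connect (step_in N setT) z r.
  move=> xz; apply: connect_trans (split_linked_edge M x y z) _.
  have [o oo zo] := rop_outer ropM (edge M z).
  rewrite lsym; apply: connect_trans (outN o oo) _; rewrite lsym; apply: vN zo.
  apply: contra (rop_loop ropM z) => xe; apply: (same_vertex_trans _ xe).
  by rewrite same_vertex_sym.
case/negP: ndisc; apply: connect_trans (toR x (same_vertex_refl M x)) _.
by rewrite lsym; apply: toR.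
Qed.

(** A repeated vertex on the outer walk would present [M] as a glued map, whose full dart set has
    darts on both sides, against [glue_nonseparable_side]. *)
Lemma nonseparable_outer_simple : nonseparable M [set: D] ->
  forall x y, outer_dart M x -> outer_dart M y -> same_vertex M x y -> x = y.
Proof.
move=> nM x y ox oy vxy; apply/eqP; apply/negPn/negP => xy.
suff [DA [DP [A [P [b [c [f [[rA rP] rtP isof _ _]]]]]]]] :
    exists (DA DP : finType) (A : premap DA) (P : premap DP) (b : DA) (c : DP)
         (f : D -> DA + DP),
    [/\ rop_spec A /\ rop_spec P, root P = Some c, isomorphism M (glue A b P c) f,
        True & True].
  have okG : darts_ok (glue A b P c) by apply: glue_ok; apply: rop_ok.
  rewrite -(isomorphism_nonseparable isof) // in nM.
  by apply: (glue_nonseparable_side (rop_ok rA) (rop_ok rP) (rop_loop rA) (rop_loop rP) nM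
    (x := b) (y := c)); rewrite inE.
(* The half of the split that contains the root has to play the role of [A], which may require
   exchanging [x] and [y]. *)
have := split_linkedP x y ropM r; case/orP => lr.
  have [DA [DP [A [P [b [c [f [? ? ? ? ?]]]]]]]] := split_glue ropM xy vxy ox oy rM lr.
  by exists DA, DP, A, P, b, c, f.
rewrite eq_sym in xy; rewrite same_vertex_sym // in vxy; rewrite split_mapC in lr.
have [DA [DP [A [P [b [c [f [? ? ? ? ?]]]]]]]] := split_glue ropM xy vxy oy ox rM lr.
by exists DA, DP, A, P, b, c, f.
Qed.

Hypothesis simple_outer :
  forall x y, outer_dart M x -> outer_dart M y -> same_vertex M x y -> x = y.

Lemma edge_off_vertex v z : z \in vertex M v -> edge M z \notin vertex M v.
Proof.
rewrite !inE => vz; apply: contra (rop_loop ropM z); apply: same_vertex_trans.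
by rewrite same_vertex_sym.
Qed.

Lemma same_vertex_mem v x y : same_vertex M x y -> (x \in vertex M v) = (y \in vertex M v).
Proof.
by move=> xy; rewrite !inE; apply: (same_connect_r (fconnect_sym (rot_inj okM))).
Qed.

(** The corner between [z] and [rot M z] belongs to an inner face, which visits [v] only there by
    [inner_face_simple]. The rest of the boundary of this face leads from one neighbour to the next
    while avoiding [v]. *)
Lemma inner_corner_connect v z : z \in vertex M v -> ~~ outer_dart M (rot M z) ->
  connect (step_in M (setT :\: vertex M v)) (edge M (rot M z)) (edge M z).
Proof.
set y := rot M z => zv ny; set st := step_in _ _.
have yv : y \in vertex M v by rewrite -(same_vertex_mem v (fconnect1 _ z)).
have fez : face M (edge M z) = y by rewrite /face edgeK.
have [p [oE yp up pp lp]] := fcycle_orbit_cons y (face_inj okM).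
have pv w : w \in p -> w \notin vertex M v.
  move=> wp; apply/negP => wv; suff eqw : y = w by rewrite eqw wp in yp.
  apply: inner_face_simple => //; first by rewrite fconnect_orbit oE inE wp orbT.
  by move: yv wv; rewrite !inE => vy; apply: same_vertex_trans; rewrite same_vertex_sym.
have lpE : last y p = edge M z by apply: (face_inj okM); rewrite lp fez.
rewrite -lpE; have stP u w : u \notin vertex M v -> w \notin vertex M v ->
    (w == edge M u) || same_vertex M u w -> connect st u w.
  by move=> uv wv uw; apply: connect1; apply/and3P; rewrite !in_setD !in_setT !andbT.
have ezv := edge_off_vertex yv.
have : forall u, edge M u \notin vertex M v -> fpath (face M) u p ->
    p != [::] -> connect st (edge M u) (last u p).
  elim: p pv {lp lpE oE up yp pp} => // w p IHp pv u eu /andP[/eqP fu pp] _ /=.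
  have wv : w \notin vertex M v by apply: pv; rewrite mem_head.
  have euw : connect st (edge M u) w.
    by apply: stP => //; rewrite -fu same_vertex_face orbT.
  case: (eqVneq p [::]) => [->//|p0]; apply: connect_trans euw _.
  have ewv : edge M w \notin vertex M v.
    case: p p0 pp pv {IHp} => // w' p _ /andP[/eqP fw _] pv.
    by rewrite (same_vertex_mem v (same_vertex_face M w)) fw pv // !inE eqxx orbT.
  apply: connect_trans (stP _ _ wv ewv _) _; first by rewrite eqxx.
  by apply: IHp => // w' w'p; apply: pv; rewrite inE w'p orbT.
apply=> //; apply: contraTneq yv => p0; rewrite p0 /= in pp *.
by move: lpE; rewrite p0 /= => ->; apply: edge_off_vertex.
Qed.

(** Exactly one corner at [v] is outer, the one before [o]. Turning from [o] through less than a
    full turn crosses only inner corners, so all neighbours of [v] are linked without passing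
    through [v]. *)
Lemma vertex_star_connect v x y : x \in vertex M v -> y \in vertex M v ->
  connect (step_in M (setT :\: vertex M v)) (edge M x) (edge M y).
Proof.
have [o oo vo] := rop_outer ropM v; rewrite !inE.
have star x' : same_vertex M v x' ->
    connect (step_in M (setT :\: vertex M v)) (edge M o) (edge M x').
  move=> vx; have ox : fconnect (rot M) o x'.
    by apply: connect_trans vx; rewrite -/(same_vertex M o v) same_vertex_sym.
  rewrite -(iter_findex ox); have := findex_max ox.
  elim: (findex _ _ _) => //= n IHn ltn; have ltn' := ltnW ltn.
  apply: connect_trans (IHn ltn') _; rewrite connect_step_sym //.
  apply: inner_corner_connect.
    by rewrite inE; apply: same_vertex_trans vo (fconnect_iter _ _ _).
  rewrite -iterS; apply/negP => on; have /eqP := findex_iter ltn.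
  rewrite -(simple_outer oo on); last exact: fconnect_iter.
  by rewrite findex0.
move=> vx vy; apply: connect_trans (star y vy); rewrite connect_step_sym //.
exact: star.
Qed.

Lemma outer_simple_nonseparable : nonseparable M [set: D].
Proof.
apply/and4P; split; [|by apply/forall_inP => x; rewrite !inE|exact: rop_conn|].
  by apply/set0Pn; exists r; rewrite inE.
apply/forallP => v; apply/connected_inP => x y; rewrite !inE !andbT => xv yv.
set st := step_in _ _.
(* A path through [M] is followed by a path avoiding [v]: while the former is at [v], the latter
   waits at the other end of the current dart, and it moves among the neighbours by
   [vertex_star_connect]. *)
pose Q z := if z \in vertex M v then connect st x (edge M z) else connect st x z.
suff : Q y by rewrite /Q inE (negPf yv).
have stP u w : u \notin vertex M v -> w \notin vertex M v ->
    (w == edge M u) || same_vertex M u w -> connect st u w.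
  by move=> uv wv uw; apply: connect1; apply/and3P; rewrite !in_setD !in_setT !andbT.
apply: (connect_setT (P := Q) (rop_conn ropM) _ _ _ (x := x)) => [z|z|].
- rewrite /Q; case: ifP => zv; first by rewrite (negPf (edge_off_vertex zv)).
  case: ifP => ezv xz; first by rewrite edgeK.
  by apply: connect_trans xz (stP _ _ _ _ _); rewrite ?zv ?ezv ?eqxx.
- rewrite /Q -(same_vertex_mem v (fconnect1 _ z)); case: ifP => zv xz.
    apply: connect_trans xz (vertex_star_connect zv _).
    by rewrite -(same_vertex_mem v (fconnect1 _ z)).
  apply: connect_trans xz (stP _ _ _ _ _); rewrite -?(same_vertex_mem v (fconnect1 _ z)) ?zv //.
  by rewrite /same_vertex fconnect1 orbT.
- by rewrite /Q inE (negPf xv) connect0.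
Qed.

End OuterFace.

(** * Decomposition of outerplanar maps *)

Section SeqSplitting.

Variable T : eqType.
Implicit Types (s t : seq T) (p : pred T).

Lemma uniq_cat_inj s1 s2 t1 t2 x : uniq (s1 ++ x :: s2) ->
  s1 ++ x :: s2 = t1 ++ x :: t2 -> s1 = t1 /\ s2 = t2.
Proof.
have idx s t : uniq (s ++ x :: t) -> index x (s ++ x :: t) = size s.
  rewrite cat_uniq => /and3P[_ /norP[/negPf xs _] _].
  by rewrite index_cat xs /= eqxx addn0.
move=> us eqst; have := idx _ _ us; rewrite {1}eqst idx -?eqst // => eqsz.
by move/eqP: eqst; rewrite eqseq_cat ?eqsz // => /andP[/eqP-> /eqP[->]].
Qed.

Lemma split_first p s : has p s ->
  exists s1 x s2, [/\ s = s1 ++ x :: s2, p x & ~~ has p s1].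
Proof.
elim: s => //= x s IHs; have [px _|npx /= /IHs[s1 [y [s2 [-> py ns1]]]]] := boolP (p x).
  by exists [::], x, s.
by exists (x :: s1), y, s2; rewrite /= (negPf npx).
Qed.

Lemma split_last p s : has p s ->
  exists s1 x s2, [/\ s = s1 ++ x :: s2, p x & ~~ has p s2].
Proof.
rewrite -has_rev => /split_first[s1 [x [s2 [eqs px ns1]]]].
exists (rev s2), x, (rev s1); rewrite has_rev; split=> //.
by rewrite -[s]revK eqs rev_cat rev_cons cat_rcons.
Qed.

End SeqSplitting.

Definition walk (D : finType) (M : premap D) : seq D :=
  if root M is Some r then orbit (face M) r else [::].

Definition lone (D : finType) (M : premap D) (x : D) : bool :=
  all (fun y => same_vertex M x y ==> (y == x)) (walk M).

Lemma loneP (D : finType) (M : premap D) (x : D) :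
  reflect {in walk M, forall y, same_vertex M x y -> y = x} (lone M x).
Proof.
apply: (iffP allP) => [lx y yM xy|lx y yM]; first by apply/eqP; apply: implyP (lx y yM) xy.
by apply/implyP => xy; apply/eqP/lx.
Qed.

Section Walk.

Variables (D : finType) (M : premap D).

Lemma mem_walk x : (x \in walk M) = outer_dart M x.
Proof. by rewrite /walk /outer_dart; case: (root M) => // r; rewrite fconnect_orbit. Qed.

Lemma walk_uniq : uniq (walk M).
Proof. by rewrite /walk; case: (root M) => // r; apply: orbit_uniq. Qed.

Lemma walk_cons r : root M = Some r -> walk M = r :: behead (walk M).
Proof. by rewrite /walk => ->; apply: orbit_head. Qed.

Lemma isomorphism_walk (D' : finType) (M' : premap D') f :
  isomorphism M M' f -> walk M' = map f (walk M).
Proof.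
case=> bijf fe fr frt; rewrite /walk -frt; case: (root M) => //= r.
exact: (iso_orbit_face bijf fe fr).
Qed.

Lemma isomorphism_lone (D' : finType) (M' : premap D') f x :
  isomorphism M M' f -> lone M' (f x) = lone M x.
Proof.
move=> isof; rewrite /lone (isomorphism_walk isof) all_map; case: isof => bijf _ fr _.
by apply: eq_all => y /=; rewrite (iso_same_vertex bijf fr) (inj_eq (bij_inj bijf)).
Qed.

End Walk.

Section GlueWalk.

Variables (DA DP : finType) (A : premap DA) (P : premap DP) (b : DA) (c : DP).
Hypotheses (okA : darts_ok A) (okP : darts_ok P) (rP : root P = Some c).

Lemma glue_walk_root : root A = Some b ->
  walk (glue A b P c) = map inl (walk A) ++ map inr (walk P).
Proof.
move=> rA; rewrite /walk /= rA rP /=.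
apply: merged_orbit; [exact: inl_inj|exact: inr_inj|exact: inl_inr|exact: face_inj|
  exact: face_inj|exact: glue_face_l|exact: glue_face_r].
Qed.

Lemma glue_walk_in s1 s2 : walk A = s1 ++ b :: s2 -> s1 != [::] ->
  walk (glue A b P c) = map inl s1 ++ map inr (walk P) ++ map inl (b :: s2).
Proof.
rewrite /walk /= rP; case: (root A) => [r|]; last by case: s1.
case: s1 => //= x s1 oE _; have xr : r = x by move: oE; rewrite orbit_head => -[].
rewrite {}xr /= in oE *; rewrite -cat_cons -map_cons -!map_cons.
apply: merged_orbit_in oE; [exact: inl_inj|exact: inr_inj|exact: inl_inr|exact: face_inj|
  exact: face_inj|exact: glue_face_l|exact: glue_face_r].
Qed.

End GlueWalk.

(** The loneness conditions make the choice canonical. At the root, [P] carries just one root block,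
    hence the last one of [M]. At a vertex, [b] and all darts before it on the walk of [A] are lone,
    so that in [M] the vertex of [b] is the first one met twice and [P] is all that hangs there. *)
Variant decomposition (D : finType) (M : premap D) : Prop :=
| IsBlock of nonseparable M [set: D]
| AtRoot (DA DP : finType) (A : premap DA) (P : premap DP) b c f of
    rop_spec A & rop_spec P & root A = Some b & root P = Some c & lone P c
    & isomorphism M (glue A b P c) f
| AtVertex (DA DP : finType) (A : premap DA) (P : premap DP) b c f s1 s2 of
    rop_spec A & rop_spec P & root P = Some c & walk A = s1 ++ b :: s2 & s1 != [::]
    & all (lone A) (rcons s1 b) & isomorphism M (glue A b P c) f.

Lemma decompose (D : finType) (M : premap D) r : rop_spec M -> root M = Some r ->
  decomposition M.
Proof.
move=> ropM rM; have okM := rop_ok ropM; have vsym := same_vertex_sym okM.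
have [/allP allw|] := boolP (all (lone M) (walk M)).
  apply: IsBlock; apply: (outer_simple_nonseparable ropM rM) => x y.
  by rewrite -!mem_walk => xw yw xy; apply/esym/(loneP _ _ (allw x xw)).
rewrite -has_predC => /split_first[s1 [x [s [wE /= /negP nlx nls1]]]].
have ls1 z : z \in s1 -> lone M z.
  by move=> zs1; apply: contraNT nls1 => nlz; apply/hasP; exists z.
have xw : x \in walk M by rewrite wE mem_cat mem_head orbT.
(* [x] is the first dart that is not lone and [y] is the last return to its vertex. This choice
   makes [c] lone in [P] if [x] is the root, and [b] lone in [A] otherwise. *)
have /split_last[s2 [y [s3 [sE xy ns3]]]] : has (same_vertex M x) s.
  apply/negPn/negP => /hasPn ns; apply: nlx; apply/loneP => y; rewrite wE mem_cat inE.
  case/or3P=> [ys1|/eqP->//|/ns/negP//] xy.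
  by apply/esym/(loneP _ _ (ls1 y ys1)) => //; rewrite vsym.
rewrite {s}sE in wE; have uw : uniq (s1 ++ x :: s2 ++ y :: s3) by rewrite -wE walk_uniq.
have yw : y \in walk M by rewrite wE !(mem_cat, inE) eqxx !orbT.
have neq_xy : x != y.
  move: uw; rewrite cat_uniq => /and3P[_ _ /= /andP[]].
  by rewrite mem_cat inE !negb_or => /and3P[].
have ox : outer_dart M x by rewrite -mem_walk.
have oy : outer_dart M y by rewrite -mem_walk.
have [s10|s10] := eqVneq s1 [::].
  rewrite {s1 nls1 ls1}s10 /= in wE uw; have xr : x = r by move: wE; rewrite (walk_cons rM) => -[].
  have [|DA [DP [A [P [b [c [f [[rA rP] rtP isof fx fy]]]]]]]] :=
    split_glue ropM neq_xy xy ox oy rM.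
    by rewrite xr connect0.
  have rtA : root A = Some b.
    case: isof => _ _ _; rewrite rM -xr /= fx; case: (root A) => //= b'.
    by move=> [->].
  apply: (AtRoot rA rP rtA rtP _ isof); apply/loneP => z zP cz.
  have := isomorphism_walk isof; rewrite (glue_walk_root (rop_ok rA) (rop_ok rP) rtP rtA) wE.
  rewrite (walk_cons rtP) -cat_cons map_cat /= fy => /esym eqw.
  have [|_ s3E] := uniq_cat_inj (s1 := f x :: map f s2) _ eqw.
    by rewrite -fy -!map_cons -map_cat map_inj_uniq //; case: isof => /bij_inj.
  move: zP; rewrite (walk_cons rtP) inE => /predU1P[//|zP].
  have : inr z \in map f s3 by rewrite s3E; apply: map_f.
  case/mapP => w ws3 fw; case/negP: ns3; apply/hasP; exists w => //.
  apply: same_vertex_trans xy _; have [bijf fe fr _] := isof.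
  by rewrite -(iso_same_vertex bijf fr) fy -fw glue_same_vertex_r //; apply: rop_ok.
have yx : same_vertex M y x by rewrite vsym.
(* The walk from the root up to [x] survives the split, except that its last step now ends in [y].
   So the root is on the side of [y], and [P] is the stretch of the walk that starts at [x]. *)
have linked s u t : fpath (face M) u (s ++ x :: t) -> x \notin s -> y \notin s ->
    connect (step_in (split_map M y x) setT) u y.
  have stepN v : connect (step_in (split_map M y x) setT) v (face (split_map M y x) v).
    by apply: connect_trans (split_linked_edge _ _ _ _) (split_linked_rot _ _ _ _).
  have faceN v : face (split_map M y x) v = tperm y x (face M v) by rewrite /face ffunE.
  elim: s u => [|v s IHs] u /= /andP[/eqP fu pp].
    by have := stepN u; rewrite faceN fu tpermR.
  rewrite !inE !negb_or => /andP[xv xs] /andP[yv ys].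
  apply: connect_trans (stepN u) _; rewrite faceN fu tpermD //.
  exact: IHs.
have [||DA [DP [A [P [b [c [f [[rA rP] rtP isof fy fx]]]]]]]] :=
  split_glue ropM _ yx oy ox rM.
- by rewrite eq_sym.
- have okN : darts_ok (split_map M y x) by apply: split_ok.
  rewrite connect_step_sym //; case: s1 s10 wE uw {nls1 ls1} => // r' s1 _ wE uw.
  have [rr' behE] : r = r' /\ behead (walk M) = s1 ++ x :: s2 ++ y :: s3.
    by move: wE; rewrite (walk_cons rM) => -[].
  apply: (linked s1 r (s2 ++ y :: s3)).
  + have := cycle_orbit (face_inj okM) r; have := walk_cons rM; rewrite {1}/walk rM => ->.
    by rewrite behE /= rcons_path => /andP[].
  + by move: uw => /= /andP[_]; rewrite cat_uniq => /and3P[_ /norP[]].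
  + move: uw => /= /andP[_]; rewrite cat_uniq => /and3P[_ /hasPn ns1 _].
    by apply: ns1; rewrite !(mem_cat, inE) eqxx !orbT.
have [bijf fe fr frt] := isof; have injf := bij_inj bijf.
case rtA: (root A) => [r'|]; last by move: frt; rewrite rM /= rtA.
have fr' : f r = inl r' by move: frt; rewrite rM /= rtA => -[].
have r'b : r' != b.
  have : r != y.
    case: s1 s10 wE uw {nls1 ls1} => // r1 s1 _ wE; rewrite -wE (walk_cons rM) /=.
    move: wE; rewrite (walk_cons rM) => -[_ ->] /andP[+ _].
    by apply: contraNneq => ->; rewrite !(mem_cat, inE) eqxx !orbT.
  by apply: contraNneq => r'b; apply/eqP/injf; rewrite fr' fy r'b.
have okA := rop_ok rA; have okP := rop_ok rP.
have bA : b \in walk A.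
  rewrite mem_walk /outer_dart rtA -(glue_fconnect_face_l b c okA okP) -fr' -fy.
  rewrite (fconnect_map injf (iso_face fe fr)).
  by move: oy; rewrite /outer_dart rM.
have [t1 [t3 [wAE t10]]] : exists t1 t3, walk A = t1 ++ b :: t3 /\ t1 != [::].
  move: bA; rewrite (walk_cons rtA) inE eq_sym (negPf r'b) /= => /splitPr[t1 t3].
  by exists (r' :: t1), t3.
have := isomorphism_walk isof; rewrite (glue_walk_in okA okP rtP wAE t10) wE.
rewrite (walk_cons rtP) map_cat /= fx => /esym eqw.
have ufw : uniq (map f s1 ++ inr c :: map f (s2 ++ y :: s3)).
  by rewrite -fx -map_cons -map_cat map_inj_uniq.
have [s1E eqw2] := uniq_cat_inj ufw eqw.
rewrite map_cat /= fy in eqw2.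
have [|_ s3E] := uniq_cat_inj _ eqw2.
  move: ufw; rewrite (cat_uniq (map f s1)) => /and3P[_ _ /andP[_]].
  by rewrite map_cat /= fy.
have lt1 z : z \in t1 -> lone A z.
  move=> zt1; have : inl z \in map f s1 by rewrite s1E map_f.
  case/mapP=> z0 z0s1 fz0; apply/loneP => z' z'A zz'.
  have : inl z' \in map f (walk M).
    rewrite -(isomorphism_walk isof) (glue_walk_in okA okP rtP wAE t10).
    move: z'A; rewrite wAE !mem_cat => /orP[z'A|z'A].
      by rewrite map_f.
    by rewrite (map_f inl z'A) !orbT.
  case/mapP=> w wM fw; apply: (@inl_inj DA DP); rewrite fw fz0; congr f.
  apply: (loneP _ _ (ls1 z0 z0s1)) => //.
  by rewrite -(iso_same_vertex bijf fr) -fz0 -fw glue_same_vertex_l.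
apply: (AtVertex rA rP rtP wAE t10 _ isof); rewrite all_rcons.
apply/andP; split; last exact/allP.
apply/loneP => z zA bz; move: (zA); rewrite wAE mem_cat inE => /or3P[zt1|/eqP//|zt3].
  by apply/esym/(loneP _ _ (lt1 z zt1)) => //; rewrite same_vertex_sym.
have : inl z \in map f s3 by rewrite s3E; apply: map_f.
case/mapP => w ws3 fw; case/negP: ns3; apply/hasP; exists w => //.
apply: same_vertex_trans xy _.
by rewrite -(iso_same_vertex bijf fr) fy -fw glue_same_vertex_l.
Qed.

(** * Blocks and decorated trees *)

Section Classes.

Lemma relabel_isomorphic (D : finType) (M : premap D) : isomorphic M (relabel M).
Proof.
exists enum_rank; split.
- by exists enum_val; [exact: enum_rankK | exact: enum_valK].
- by move=> x; rewrite ffunE enum_rankK.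
- by move=> x; rewrite ffunE enum_rankK.
- by [].
Qed.

Lemma class_of_eqP (D D' : finType) (M : premap D) (M' : premap D') :
  class_of M = class_of M' <-> isomorphic M M'.
Proof.
split=> [/eqmodP/asboolP/= iso|iso].
  apply: isomorphic_trans (relabel_isomorphic M) _; apply: isomorphic_trans iso _.
  exact/isomorphic_sym/relabel_isomorphic.
apply/eqmodP/asboolP => /=; apply: isomorphic_trans (isomorphic_sym (relabel_isomorphic M)) _.
exact: isomorphic_trans iso (relabel_isomorphic M').
Qed.

Lemma repr_mapK (m : map_class) : class_of (repr_map m) = m.
Proof.
rewrite -[RHS]reprK; apply/eqmodP/asboolP => /=.
exact/isomorphic_sym/relabel_isomorphic.
Qed.

Lemma repr_map_isomorphic (D : finType) (M : premap D) :
  isomorphic (repr_map (class_of M)) M.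
Proof. by apply/class_of_eqP; rewrite repr_mapK. Qed.

End Classes.

Section Blocks.

Variables (D : finType) (M : premap D).
Hypotheses (okM : darts_ok M) (loopM : forall x, ~~ same_vertex M x (edge M x)).

Lemma step_in_mono (A B : {set D}) : A \subset B ->
  subrel (connect (step_in M A)) (connect (step_in M B)).
Proof.
move=> AB; apply: connect_sub => x y /and3P[xA yA xy]; apply: connect1.
by rewrite /step_in /= (subsetP AB _ xA) (subsetP AB _ yA).
Qed.

Lemma connected_in_setU (A B : {set D}) x : x \in A -> x \in B ->
  connected_in M A -> connected_in M B -> connected_in M (A :|: B).
Proof.
move=> xA xB /connected_inP cA /connected_inP cB.
have cx z : z \in A :|: B -> connect (step_in M (A :|: B)) x z.
  case/setUP=> zAB.
    by apply: step_in_mono (cA _ _ xA zAB); apply: subsetUl.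
  by apply: step_in_mono (cB _ _ xB zAB); apply: subsetUr.
apply/connected_inP => y z yAB zAB; apply: connect_trans (cx z zAB).
by rewrite connect_step_sym // cx.
Qed.

Lemma nonseparable_edge_closed (S : {set D}) :
  nonseparable M S -> {in S, forall x, edge M x \in S}.
Proof. by case/and4P=> _ /forall_inP eS _ _ x /eS. Qed.

(** The two sets share the edge of [x], hence two distinct vertices, and the removal of a vertex
    leaves a shared dart at one of them. Thus different blocks have no dart in common. *)
Lemma nonseparable_setU (S S' : {set D}) x : x \in S -> x \in S' ->
  nonseparable M S -> nonseparable M S' -> nonseparable M (S :|: S').
Proof.
move=> xS xS' nS nS'; have eS := nonseparable_edge_closed nS.
have eS' := nonseparable_edge_closed nS'.
have /and4P[_ _ cS /forallP vS] := nS; have /and4P[_ _ cS' /forallP vS'] := nS'.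
apply/and4P; split.
- by apply/set0Pn; exists x; rewrite inE xS.
- apply/forall_inP => y; rewrite !inE.
  by case/orP=> [/eS ->|/eS' ->] //; rewrite orbT.
- exact: connected_in_setU xS xS' cS cS'.
apply/forallP => v; rewrite setDUl.
have [xv|xv] := boolP (x \in vertex M v); last first.
  by apply: (connected_in_setU (x := x)) => //; rewrite in_setD xv.
have exv : edge M x \notin vertex M v.
  move: xv; rewrite !inE => vx; apply: contra (loopM x); apply: same_vertex_trans.
  by rewrite same_vertex_sym.
by apply: (connected_in_setU (x := edge M x)) => //; rewrite in_setD exv ?eS ?eS'.
Qed.

Lemma block_nonseparable (B : {set D}) : block M B -> nonseparable M B.
Proof. exact: maxsetp. Qed.

Lemma block_edge_closed (B : {set D}) : block M B -> {in B, forall x, edge M x \in B}.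
Proof. by move/block_nonseparable; apply: nonseparable_edge_closed. Qed.

Lemma block_eq (B C : {set D}) x : block M B -> block M C -> x \in B -> x \in C -> B = C.
Proof.
move=> /maxsetP[nB maxB] /maxsetP[nC maxC] xB xC.
have nU := nonseparable_setU xB xC nB nC.
exact: etrans (esym (maxB _ nU (subsetUl _ _))) (maxC _ nU (subsetUr _ _)).
Qed.

Lemma edge_nonseparable x : nonseparable M [set x; edge M x].
Proof.
have cA (A : {set D}) : A \subset [set x; edge M x] -> connected_in M A.
  move=> sA; apply/connected_inP => y z yA zA; have := subsetP sA y yA; have := subsetP sA z zA.
  have [->//|yz] := eqVneq y z; rewrite !inE => zx yx.
  apply: connect1; rewrite /step_in /= yA zA /=; apply/orP; left.
  case/orP: zx yz => /eqP->; case/orP: yx => /eqP->; rewrite ?eqxx ?edgeK ?eqxx //.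
apply/and4P; split; [|apply/forall_inP => y; rewrite !inE|exact: cA|].
- by apply/set0Pn; exists x; rewrite !inE eqxx.
- by case/orP=> /eqP->; rewrite ?edgeK // eqxx ?orbT.
- by apply/forallP => v; apply: cA; apply: subsetDl.
Qed.

Lemma block_exists x : exists2 B, block M B & x \in B.
Proof.
have [B mB sB] := maxset_exists (edge_nonseparable x).
by exists B => //; apply: (subsetP sB); rewrite !inE eqxx.
Qed.

Section RootBlocks.

Variable r : D.

Local Notation es := (orbit (rot M) r).

Definition first_in (B : {set D}) : nat := find (fun x => x \in B) es.

Lemma mem_root_blocks (B : {set D}) :
  (B \in root_blocks M r) = block M B && has (fun x => x \in B) es.
Proof. by rewrite /root_blocks mem_sort mem_enum inE. Qed.

Lemma first_in_inj (B C : {set D}) : B \in root_blocks M r -> C \in root_blocks M r ->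
  first_in B = first_in C -> B = C.
Proof.
rewrite !mem_root_blocks => /andP[bB hB] /andP[bC hC] eqBC.
by apply: (block_eq bB bC (nth_find r hB)); rewrite -/(first_in B) eqBC; apply: nth_find.
Qed.

Lemma root_blocks_sorted : sorted (relpre first_in ltn) (root_blocks M r).
Proof.
have : sorted (relpre first_in leq) (root_blocks M r).
  by apply: sort_sorted => B C; apply: leq_total.
have : uniq (root_blocks M r) by rewrite sort_uniq enum_uniq.
have le_tr : transitive (relpre first_in leq) by move=> C B E /=; apply: leq_trans.
have lt_tr : transitive (relpre first_in ltn) by move=> C B E /=; apply: ltn_trans.
rewrite (sorted_pairwise le_tr) (sorted_pairwise lt_tr).
have : {subset root_blocks M r <= root_blocks M r} by [].
elim: {1 3 4 5}(root_blocks M r) => //= B s IHs sub /andP[Bs us] /andP[leBs ps].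
rewrite IHs //; last by move=> C Cs; apply: sub; rewrite inE Cs orbT.
rewrite andbT; apply/allP => C Cs; have /= leBC := allP leBs C Cs; rewrite /= ltn_neqAle leBC andbT.
apply: contra Bs => /eqP eqBC; rewrite (first_in_inj _ _ eqBC) //; apply: sub.
  by rewrite mem_head.
by rewrite inE Cs orbT.
Qed.

(** A strictly sorted list is determined by its members; this reduces every computation of
    [root_blocks] to finding the blocks and comparing their first darts. *)
Lemma root_blocks_eq (s : seq {set D}) :
    (forall B, (B \in s) = block M B && has (fun x => x \in B) es) ->
    sorted (relpre first_in ltn) s ->
  root_blocks M r = s.
Proof.
move=> mem_s ss; apply: (@irr_sorted_eq _ (relpre first_in ltn)) => //.
- by move=> C B E /=; apply: ltn_trans.
- by move=> B /=; rewrite ltnn.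
- exact: root_blocks_sorted.
- by move=> B; rewrite mem_s mem_root_blocks.
Qed.

Definition outside : {set D} := [set x | all (fun B : {set D} => x \notin B) (root_blocks M r)].

Lemma outsideP x : reflect (forall B, B \in root_blocks M r -> x \notin B) (x \in outside).
Proof. by rewrite inE; apply: allP. Qed.

Lemma outside_edge_closed : {in outside, forall x, edge M x \in outside}.
Proof.
move=> x /outsideP xo; apply/outsideP => B Br; apply: contra (xo B Br) => exB.
rewrite -(edgeK okM x); apply: block_edge_closed exB.
by move: Br; rewrite mem_root_blocks => /andP[].
Qed.

Lemma outside_root x : same_vertex M r x -> x \notin outside.
Proof.
move=> rx; have [B bB xB] := block_exists x; apply/negP => /outsideP/(_ B) nB.
suff : x \notin B by rewrite xB.
apply: nB; rewrite mem_root_blocks bB; apply/hasP; exists x => //.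
by rewrite -fconnect_orbit.
Qed.

End RootBlocks.

Lemma componentP (A : {set D}) b y :
  reflect (y \in A /\ exists x, [/\ x \in A, same_vertex M b x & connect (step_in M A) x y])
          (y \in component M A b).
Proof.
rewrite inE; apply: (iffP andP) => -[yA].
  by case/exists_inP=> x xA /andP[bx xy]; split=> //; exists x.
by case=> x [xA bx xy]; split=> //; apply/exists_inP; exists x; rewrite // bx.
Qed.

Lemma component_edge_closed (A : {set D}) b : {in A, forall x, edge M x \in A} ->
  {in component M A b, forall x, edge M x \in component M A b}.
Proof.
move=> eA y /componentP[yA [x [xA bx xy]]]; apply/componentP; split; first exact: eA.
exists x; split=> //; apply: connect_trans xy (connect1 _).
by rewrite /step_in /= yA eA ?eqxx.
Qed.

Lemma pendant_edge_closed r b :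
  {in pendant_darts M r b, forall x, edge M x \in pendant_darts M r b}.
Proof. exact/component_edge_closed/outside_edge_closed. Qed.

(** The root dart lies in a root block, hence in no pendant submap; this is why the recursion
    ends. *)
Lemma card_pendant r b : #|{: {x : D | x \in pendant_darts M r b}}| < #|D|.
Proof.
rewrite card_sig; apply: proper_card; apply/properP; split; first exact/subsetP.
exists r => //; apply/negP => /componentP[ro _].
by case/negP: (outside_root (same_vertex_refl M r)).
Qed.

Lemma pendant_ok r B b : darts_ok (pendant M r B b).
Proof. exact/submap_ok/pendant_edge_closed. Qed.

Lemma pendant_loop r B b x : ~~ same_vertex (pendant M r B b) x (edge (pendant M r B b) x).
Proof.
have emb := submap_embeds (ohead [seq x <- orbit (rot M) b | x \notin B]) okM
  (@pendant_edge_closed r b).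
by rewrite -(emb_same_vertex emb) (emb_edge emb).
Qed.

End Blocks.

(** * Unfolding of [Xi_map] and its invariance *)

Section XiUnfolding.

Definition loopless (D : finType) (M : premap D) := forall x, ~~ same_vertex M x (edge M x).

Lemma Xi_rec_fuel k k' (D : finType) (M : premap D) : #|D| <= k -> #|D| <= k' ->
  darts_ok M -> loopless M -> Xi_rec k M = Xi_rec k' M.
Proof.
elim: k k' D M => [|k IHk] [|k'] D M //=.
- by rewrite leqn0 => /eqP/card0_eq D0; case: (root M) => // r; have := D0 r.
- by rewrite leqn0 => _ /eqP/card0_eq D0; case: (root M) => // r; have := D0 r.
move=> leDk leDk' okM loopM; case: (root M) => // r; congr LNode.
congr flatten; apply/eq_in_map => B _; apply/eq_in_map => b _.
have ltP := card_pendant okM r b.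
by apply: IHk; rewrite -1?ltnS ?(leq_trans ltP) //; [apply: pendant_ok|apply: pendant_loop].
Qed.

Lemma Xi_mapE (D : finType) (M : premap D) r :
    darts_ok M -> loopless M -> root M = Some r ->
  Xi_map M = LNode [seq class_of (rooted_block M r B) | B <- root_blocks M r]
    (flatten [seq [seq Xi_map (pendant M r B b) | b <- block_vertices M r B]
             | B <- root_blocks M r]).
Proof.
move=> okM loopM rM; rewrite {1}/Xi_map.
case eqD : #|D| => [|k] /=; first by have := card0_eq eqD r.
rewrite rM; congr LNode.
congr flatten; apply/eq_in_map => B _; apply/eq_in_map => b _.
have ltP := card_pendant okM r b.
by apply: Xi_rec_fuel; rewrite ?leqnn -1?ltnS -?eqD //; [apply: pendant_ok|apply: pendant_loop].
Qed.

Lemma Xi_map_rootless (D : finType) (M : premap D) : root M = None -> Xi_map M = LNode [::] [::].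
Proof. by rewrite /Xi_map; case: #|D| => //= n ->. Qed.

Lemma Xi_map_empty (D : finType) (M : premap D) : #|D| = 0 -> Xi_map M = LNode [::] [::].
Proof. by rewrite /Xi_map => ->. Qed.

End XiUnfolding.

Section EmbeddedBlocks.

Variables (D D' : finType) (M : premap D) (M' : premap D') (i : D -> D').
Hypotheses (okM : darts_ok M) (okM' : darts_ok M') (embi : embeds M M' i).

Section RootedBlock.

Variables (r : D) (r' : D') (B : {set D}).
Hypothesis orb_r : [seq y <- orbit (rot M') r' | y \in codom i] = map i (orbit (rot M) r).
Hypothesis eB : {in B, forall x, edge M x \in B}.

Lemma ohead_map (U V : Type) (k : U -> V) (s : seq U) : ohead (map k s) = omap k (ohead s).
Proof. by case: s. Qed.

Lemma emb_rooted_block : class_of (rooted_block M' r' (i @: B)) = class_of (rooted_block M r B).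
Proof.
apply/class_of_eqP/isomorphic_sym.
rewrite /rooted_block (filter_imset B (emb_inj embi) orb_r) ohead_map.
exact: (emb_submap embi eB).
Qed.

Lemma emb_block_vertices : block_vertices M' r' (i @: B) = map i (block_vertices M r B).
Proof.
rewrite /block_vertices /rooted_block (filter_imset B (emb_inj embi) orb_r) ohead_map.
exact: (emb_nonroot_vertices embi eB).
Qed.

End RootedBlock.

(** Edge steps never leave the image of an embedding, and the hypotheses forbid vertex steps within
    [X] that do; so the component can be computed inside [M]. *)
Lemma emb_component (X : {set D'}) b :
    (forall x z, i x \in X -> z \in X -> same_vertex M' (i x) z -> z \in codom i) ->
    (forall z, z \in X -> same_vertex M' (i b) z -> z \in codom i) ->
  component M' X (i b) = i @: component M (i @^-1: X) b.
Proof.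
move=> stepX startX; have injie := emb_inj embi.
have iX : i @: (i @^-1: X) \subset X.
  by apply/subsetP => _ /imsetP[x + ->]; rewrite inE.
apply/setP => y; apply/componentP/imsetP => [[yX [x [xX bx xy]]]|[y' + ->]]; last first.
  case/componentP; rewrite inE => yX [x [+ bx xy]]; rewrite inE => xX; split=> //.
  exists (i x); split=> //; first by rewrite (emb_same_vertex embi).
  by apply: (step_in_mono iX); rewrite (emb_connect embi).
have /codomP[x' eqx] := startX x xX bx; rewrite {x}eqx in xX bx xy.
pose Q z := (z \in codom i) && connect (step_in M' (i @: (i @^-1: X))) (i x') z.
have : Q y.
  apply: (connect_ind (P := Q) _ xy); last by rewrite /Q codom_f connect0.
  move=> u w /and3P[uX wX uw] /andP[/codomP[u' equ] xu]; rewrite {u}equ in uX uw xu *.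
  have /codomP[w' eqw] : w \in codom i.
    case/orP: uw => [/eqP->|uw]; first by rewrite -(emb_edge embi) codom_f.
    exact: stepX uX wX uw.
  rewrite {w}eqw in wX uw *; rewrite /Q codom_f; apply: connect_trans xu (connect1 _).
  by rewrite /step_in /= !(mem_imset _ _ injie) !inE uX wX.
case/andP=> /codomP[y' eqy] xy'; rewrite {y}eqy in yX xy' xy *.
exists y' => //; apply/componentP; rewrite inE; split=> //.
exists x'; rewrite inE -(emb_same_vertex embi); split=> //.
by rewrite -(emb_connect embi).
Qed.

Lemma emb_pendant r r' B b :
    pendant_darts M' r' (i b) = i @: pendant_darts M r b ->
    {in pendant_darts M r b, forall x, edge M x \in pendant_darts M r b} ->
    orbit (rot M') (i b) = map i (orbit (rot M) b) ->
  isomorphic (pendant M r B b) (pendant M' r' (i @: B) (i b)).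
Proof.
move=> pE eP oE; rewrite /pendant pE oE filter_map.
have -> : [seq y <- orbit (rot M) b | preim i (fun x => x \notin i @: B) y]
    = [seq y <- orbit (rot M) b | y \notin B].
  by apply: eq_filter => y /=; rewrite mem_imset //; apply: emb_inj embi.
by rewrite ohead_map; apply: (emb_submap embi eP).
Qed.

End EmbeddedBlocks.

Section XiInvariance.

Lemma isomorphism_root_blocks (D D' : finType) (M : premap D) (M' : premap D') f r :
    isomorphism M M' f -> darts_ok M -> loopless M -> darts_ok M' ->
  root_blocks M' (f r) = map (fun B : {set D} => f @: B) (root_blocks M r).
Proof.
move=> [bijf fe fr frt] okM loopM okM'; have embf := isomorphism_embeds bijf fe fr.
have injf := bij_inj bijf; have orb := orbit_map injf fr r.
have satf : saturated M' f.
  move=> S _ x _; apply/subsetP => y _; have [g _ gK] := bijf.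
  by rewrite -[y]gK codom_f.
have loopM' : loopless M'.
  by have [g _ gK] := bijf; move=> x; rewrite -[x]gK -fe (iso_same_vertex bijf fr).
have fiB (B : {set D}) : first_in M' (f r) (f @: B) = first_in M r B.
  rewrite /first_in orb find_map; apply: eq_find => x /=.
  by rewrite mem_imset.
have hasE (B : {set D}) : has (fun x => x \in f @: B) (orbit (rot M') (f r))
    = has (fun x => x \in B) (orbit (rot M) r).
  by rewrite orb has_map; apply: eq_has => x /=; rewrite mem_imset.
apply: root_blocks_eq => // [B|].
  apply/mapP/andP => [[C + ->]|[bB hB]].
    by rewrite mem_root_blocks hasE (emb_block okM' embf satf) => /andP[].
  have /hasP[x' + xB] := hB; rewrite orb => /mapP[x _ eqx]; rewrite {x'}eqx in xB.
  have [C bC eqB] := emb_block_preim okM' embf satf bB xB.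
  by exists C => //; rewrite mem_root_blocks bC -hasE -eqB.
rewrite sorted_map; have := root_blocks_sorted okM loopM r; rewrite /sorted.
case: (root_blocks M r) => // B s; rewrite (eq_path (e' := relpre (first_in M r) ltn)) //.
by move=> B1 B2 /=; rewrite !fiB.
Qed.

Lemma Xi_rec_isomorphic k (D D' : finType) (M : premap D) (M' : premap D') :
    isomorphic M M' -> darts_ok M -> loopless M -> darts_ok M' -> loopless M' ->
  Xi_rec k M = Xi_rec k M'.
Proof.
elim: k D D' M M' => //= k IHk D D' M M' [f isof] okM loopM okM' loopM'.
have [bijf fe fr frt] := isof; rewrite -frt; case: (root M) => //= r.
have embf := isomorphism_embeds bijf fe fr; have injf := bij_inj bijf.
have orb := orbit_map injf fr.
have orbc x : [seq y <- orbit (rot M') (f x) | y \in codom f] = map f (orbit (rot M) x).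
  by case: embf.
rewrite (isomorphism_root_blocks r isof) // -!map_comp.
have eB (B : {set D}) : B \in root_blocks M r -> {in B, forall x, edge M x \in B}.
  by rewrite mem_root_blocks => /andP[/block_edge_closed].
congr LNode.
  by apply/eq_in_map => B /eB eBB; rewrite /= (emb_rooted_block embf (orbc r) eBB).
congr flatten; apply/eq_in_map => B Br; have eBB := eB B Br.
rewrite /= (emb_block_vertices embf (orbc r) eBB) -map_comp.
apply/eq_in_map => b _ /=.
have pE : pendant_darts M' (f r) (f b) = f @: pendant_darts M r b.
  have codf z : z \in codom f by have [g _ gK] := bijf; rewrite -[z]gK codom_f.
  rewrite [LHS](emb_component embf) // /pendant_darts; congr (f @: component M _ b).
  apply/setP => x; rewrite !inE (isomorphism_root_blocks r isof) // all_map.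
  by apply: eq_all => C /=; rewrite mem_imset.
have iso := emb_pendant embf B pE (pendant_edge_closed okM (r := r) (b := b)) (orb b).
by apply: IHk => //; do ?[apply: pendant_ok | apply: pendant_loop].
Qed.

Lemma Xi_map_isomorphic (D D' : finType) (M : premap D) (M' : premap D') :
    isomorphic M M' -> darts_ok M -> loopless M -> darts_ok M' -> loopless M' ->
  Xi_map M = Xi_map M'.
Proof.
move=> iso; rewrite /Xi_map; have [f [/bij_eq_card <- _ _ _]] := iso.
exact: Xi_rec_isomorphic.
Qed.

Lemma Xi_map_rop_isomorphic (D D' : finType) (M : premap D) (M' : premap D') :
  isomorphic M M' -> rop_spec M -> Xi_map M = Xi_map M'.
Proof.
move=> iso rM; have rM' := rop_isomorphic iso rM.
by apply: Xi_map_isomorphic => //; [case: rM|case: rM|case: rM'|case: rM'].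
Qed.

End XiInvariance.

Notation leaf := (LNode [::] [::]).

Section EmptyPendant.

Variables (D : finType) (M : premap D) (r b : D).

Lemma pendant_darts_empty : (forall x, x \in outside M r -> ~~ same_vertex M b x) ->
  pendant_darts M r b = set0.
Proof.
move=> nb; apply/setP => y; rewrite in_set0; apply/negP => /componentP[_ [x [xo bx _]]].
by have := nb x xo; rewrite bx.
Qed.

Lemma Xi_pendant_empty B : pendant_darts M r b = set0 -> Xi_map (pendant M r B b) = leaf.
Proof.
by move=> p0; apply: Xi_map_empty; rewrite card_sig -[RHS](cards0 D) -p0; apply: eq_card.
Qed.

End EmptyPendant.

(** The orbit of [b] matters only for rooting the pendant submap. It does change at a glued vertex,
    but when nothing is pendant there, both sides are leaves. *)
Lemma emb_Xi_pendant (D D' : finType) (M : premap D) (M' : premap D') i r r' (B : {set D}) b :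
    darts_ok M -> loopless M -> darts_ok M' -> loopless M' -> embeds M M' i ->
    pendant_darts M' r' (i b) = i @: pendant_darts M r b ->
    orbit (rot M') (i b) = map i (orbit (rot M) b) \/ pendant_darts M r b = set0 ->
  Xi_map (pendant M' r' (i @: B) (i b)) = Xi_map (pendant M r B b).
Proof.
move=> okM loopM okM' loopM' embi pE [oE|p0]; last first.
  by rewrite !Xi_pendant_empty // pE p0 imset0.
apply/esym/Xi_map_isomorphic.
- by apply: (emb_pendant embi B pE _ oE); apply: pendant_edge_closed.
- exact: pendant_ok.
- by move=> x; apply: pendant_loop.
- exact: pendant_ok.
- by move=> x; apply: pendant_loop.
Qed.

(** * The effect of gluing on the decorated tree *)

Section GlueXi.

Variables (DA DP : finType) (A : premap DA) (P : premap DP) (b : DA) (c : DP).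
Hypotheses (ropA : rop_spec A) (ropP : rop_spec P) (rP : root P = Some c).
Hypothesis ob : outer_dart A b.

Local Notation G := (glue A b P c).

Let okA : darts_ok A := rop_ok ropA.
Let okP : darts_ok P := rop_ok ropP.
Let ropG : rop_spec G := glue_rop ropA ropP ob rP.
Let okG : darts_ok G := rop_ok ropG.
Let embl : embeds A G inl := glue_embeds_l b c okA okP.
Let embr : embeds P G inr := glue_embeds_r b c okA okP.
Let satl : saturated G inl :=
  glue_saturated_l okA okP (rop_loop ropA) (rop_loop ropP).
Let satr : saturated G inr :=
  glue_saturated_r okA okP (rop_loop ropA) (rop_loop ropP).

Lemma mem_imset_l (B : {set DA}) x : (inl x \in @inl DA DP @: B) = (x \in B).
Proof. by rewrite mem_imset //; apply: inl_inj. Qed.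

Lemma mem_imset_r (B : {set DP}) y : (inr y \in @inr DA DP @: B) = (y \in B).
Proof. by rewrite mem_imset //; apply: inr_inj. Qed.

Lemma inr_notin_imset_l (B : {set DA}) y : (inr y \in @inl DA DP @: B) = false.
Proof. by apply/imsetP => -[]. Qed.

Lemma inl_notin_imset_r (B : {set DP}) x : (inl x \in @inr DA DP @: B) = false.
Proof. by apply/imsetP => -[]. Qed.

Lemma has_imset_l (B : {set DA}) s t :
  has (fun z => z \in @inl DA DP @: B) (map inl s ++ map inr t) = has (fun x => x \in B) s.
Proof.
rewrite has_cat !has_map [X in _ || X](eq_has (a2 := pred0)) ?has_pred0 ?orbF => [|y].
  by apply: eq_has => x; rewrite /= mem_imset_l.
by rewrite /= inr_notin_imset_l.
Qed.

Lemma has_imset_r (B : {set DP}) s t :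
  has (fun z => z \in @inr DA DP @: B) (map inl s ++ map inr t) = has (fun y => y \in B) t.
Proof.
rewrite has_cat !has_map [X in X || _](eq_has (a2 := pred0)) ?has_pred0 => [|x].
  by apply: eq_has => y; rewrite /= mem_imset_r.
by rewrite /= inl_notin_imset_r.
Qed.

Lemma find_imset_l (B : {set DA}) s t : has (fun x => x \in B) s ->
  find (fun z => z \in @inl DA DP @: B) (map inl s ++ map inr t) = find (fun x => x \in B) s.
Proof.
move=> hB; rewrite find_cat; have := has_imset_l B s [::]; rewrite cats0 hB => ->.
by rewrite find_map; apply: eq_find => x; rewrite /= mem_imset_l.
Qed.

Lemma find_imset_r (B : {set DP}) s t :
  find (fun z => z \in @inr DA DP @: B) (map inl s ++ map inr t)
  = size s + find (fun y => y \in B) t.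
Proof.
rewrite find_cat; have := has_imset_r B s [::]; rewrite cats0 => -> /=.
by rewrite size_map find_map; congr addn; apply: eq_find => y; rewrite /= mem_imset_r.
Qed.

Lemma glue_orbit_away b' : ~~ same_vertex A b b' ->
  orbit (rot G) (inl b') = map inl (orbit (rot A) b').
Proof.
move=> nb; apply: merged_orbit_out nb; [exact: inl_inj|exact: rot_inj|exact: glue_rot_l].
Qed.

Lemma glue_orbit_away_r y : ~~ same_vertex P c y ->
  orbit (rot G) (inr y) = map inr (orbit (rot P) y).
Proof.
move=> nc; apply: merged_orbit_out nc; [exact: inr_inj|exact: rot_inj|exact: glue_rot_r].
Qed.

Lemma glue_orbit_at : orbit (rot G) (inl b)
  = map inl (orbit (rot A) b) ++ map inr (orbit (rot P) c).
Proof.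
apply: merged_orbit; [exact: inl_inj|exact: inr_inj|exact: inl_inr|exact: rot_inj|
  exact: rot_inj|exact: glue_rot_l|exact: glue_rot_r].
Qed.

Lemma codom_inl (z : DA + DP) : (z \in codom inl) = (z : bool).
Proof. by case: z => x; [exact: codom_f|apply/negP => /codomP[]]. Qed.

Lemma codom_inr (z : DA + DP) : (z \in codom inr) = ~~ z.
Proof. by case: z => x; [apply/negP => /codomP[]|exact: codom_f]. Qed.

Section AtRoot.

Hypothesis rA : root A = Some b.

Local Notation imgs := (map (fun B : {set DA} => @inl DA DP @: B) (root_blocks A b)
  ++ map (fun B : {set DP} => @inr DA DP @: B) (root_blocks P c)).

(** By saturation the blocks of both sides stay blocks and there are no others; and around the root
    vertex the darts of [A] come before those of [P]. *)
Lemma glue_root_blocks : root_blocks G (inl b) = imgs.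
Proof.
have hasl (B : {set DA}) : has (fun z => z \in @inl DA DP @: B) (orbit (rot G) (inl b))
    = has (fun x => x \in B) (orbit (rot A) b).
  by rewrite glue_orbit_at has_imset_l.
have hasr (B : {set DP}) : has (fun z => z \in @inr DA DP @: B) (orbit (rot G) (inl b))
    = has (fun x => x \in B) (orbit (rot P) c).
  by rewrite glue_orbit_at has_imset_r.
apply: root_blocks_eq => // [|B|]; first exact: rop_loop.
  rewrite mem_cat; apply/orP/andP => [[] /mapP[C + ->]|[bB hB]].
  - by rewrite mem_root_blocks hasl (emb_block okG embl satl) => /andP[].
  - by rewrite mem_root_blocks hasr (emb_block okG embr satr) => /andP[].
  - have /hasP[[x|y] _ zB] := hB.
      have [C bC eqB] := emb_block_preim okG embl satl bB zB.
      by left; apply/mapP; exists C; rewrite // mem_root_blocks bC -hasl -eqB.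
    have [C bC eqB] := emb_block_preim okG embr satr bB zB.
    by right; apply/mapP; exists C; rewrite // mem_root_blocks bC -hasr -eqB.
have lt_tr : transitive (relpre (first_in G (inl b)) ltn).
  by move=> C B E /=; apply: ltn_trans.
have firstl (B : {set DA}) : B \in root_blocks A b ->
    first_in G (inl b) (inl @: B) = first_in A b B.
  rewrite mem_root_blocks => /andP[_ hB].
  by rewrite /first_in glue_orbit_at find_imset_l.
have firstr (B : {set DP}) : first_in G (inl b) (inr @: B)
    = size (orbit (rot A) b) + first_in P c B.
  by rewrite /first_in glue_orbit_at find_imset_r.
have ltA : transitive (relpre (first_in A b) ltn) by move=> C B E /=; apply: ltn_trans.
have ltP : transitive (relpre (first_in P c) ltn) by move=> C B E /=; apply: ltn_trans.
have := root_blocks_sorted okA (rop_loop ropA) b.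
have := root_blocks_sorted okP (rop_loop ropP) c.
rewrite (sorted_pairwise lt_tr) (sorted_pairwise ltA) (sorted_pairwise ltP) => sP sA.
rewrite pairwise_cat !pairwise_map; apply/and3P; split.
- apply/allrelP => _ _ /mapP[B Br ->] /mapP[C Cr ->] /=; rewrite firstl // firstr.
  apply: ltn_addr; move: Br; rewrite mem_root_blocks => /andP[_].
  by rewrite has_find.
- apply: (sub_in_pairwise (P := mem (root_blocks A b))) sA => [B C Br Cr /=|]; last exact/allP.
  by rewrite !firstl.
- by apply: sub_pairwise sP => B C /=; rewrite !firstr ltn_add2l.
Qed.

Lemma glue_outside_l : inl @^-1: outside G (inl b) = outside A b.
Proof.
apply/setP => x; rewrite [_ \in _ @^-1: _]inE; apply/outsideP/outsideP; rewrite glue_root_blocks.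
  move=> xo B Br; rewrite -mem_imset_l; apply: xo.
  by rewrite mem_cat; apply/orP; left; apply/mapP; exists B.
move=> xo B'; rewrite mem_cat => /orP[]/mapP[B Br ->]; last by rewrite inl_notin_imset_r.
by rewrite mem_imset_l xo.
Qed.

Lemma glue_outside_r : inr @^-1: outside G (inl b) = outside P c.
Proof.
apply/setP => y; rewrite [_ \in _ @^-1: _]inE; apply/outsideP/outsideP; rewrite glue_root_blocks.
  move=> yo B Br; rewrite -mem_imset_r; apply: yo.
  by rewrite mem_cat; apply/orP; right; apply/mapP; exists B.
move=> yo B'; rewrite mem_cat => /orP[]/mapP[B Br ->]; first by rewrite inr_notin_imset_l.
by rewrite mem_imset_r yo.
Qed.

Lemma glue_outside_cross x y : inl x \in outside G (inl b) \/ inr y \in outside G (inl b) ->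
  ~~ same_vertex G (inl x) (inr y).
Proof.
rewrite glue_same_vertex_lr // => xyo; apply/negP => /andP[bx cy]; case: xyo => zo.
  have /negP := outside_root okA bx; case.
  by rewrite -glue_outside_l inE.
have /negP := outside_root okP cy; case.
by rewrite -glue_outside_r inE.
Qed.

Lemma Xi_glue_root RA tsA RP tsP :
    Xi_map A = LNode RA tsA -> Xi_map P = LNode RP tsP ->
  Xi_map G = LNode (RA ++ RP) (tsA ++ tsP).
Proof.
have rG : root G = Some (inl b) by rewrite /= rA.
rewrite (Xi_mapE okG (rop_loop ropG) rG) (Xi_mapE okA (rop_loop ropA) rA).
rewrite (Xi_mapE okP (rop_loop ropP) rP) => -[<- <-] [<- <-].
have orbl : [seq y <- orbit (rot G) (inl b) | y \in codom inl] = map inl (orbit (rot A) b).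
  by case: embl.
have orbr : [seq y <- orbit (rot G) (inl b) | y \in codom inr] = map inr (orbit (rot P) c).
  rewrite glue_orbit_at filter_cat filter_codom_l filter_codom_r //.
have eA (B : {set DA}) : B \in root_blocks A b -> {in B, forall x, edge A x \in B}.
  by rewrite mem_root_blocks => /andP[/block_edge_closed].
have eP (B : {set DP}) : B \in root_blocks P c -> {in B, forall x, edge P x \in B}.
  by rewrite mem_root_blocks => /andP[/block_edge_closed].
rewrite glue_root_blocks !map_cat -!map_comp flatten_cat; congr (LNode (_ ++ _) (_ ++ _)).
- by apply/eq_in_map => B /eA eB; rewrite /= (emb_rooted_block embl orbl eB).
- by apply/eq_in_map => B /eP eB; rewrite /= (emb_rooted_block embr orbr eB).
- congr flatten; apply/eq_in_map => B /eA eB /=.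
  rewrite (emb_block_vertices embl orbl eB) -map_comp; apply/eq_in_map => b' _ /=.
  apply: emb_Xi_pendant => //; do ?exact: rop_loop.
    rewrite [LHS](emb_component embl) ?glue_outside_l // => [x [z|z] xo zo|[z|z] zo] xz;
      rewrite codom_inl //=.
      by move: xz; rewrite (negPf (glue_outside_cross (or_introl xo))).
    by move: xz; rewrite (negPf (glue_outside_cross (or_intror zo))).
  (* Gluing alters an orbit of [A] only at the root vertex, where every dart belongs to a root block
     and nothing is pendant. *)
  have [bb'|/glue_orbit_away] := boolP (same_vertex A b b'); last by left.
  right; apply: pendant_darts_empty => x xo; apply: contraL xo => b'x.
  by apply: (outside_root okA); apply: same_vertex_trans bb' b'x.
- congr flatten; apply/eq_in_map => B /eP eB /=.
  rewrite (emb_block_vertices embr orbr eB) -map_comp; apply/eq_in_map => b' _ /=.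
  apply: emb_Xi_pendant => //; do ?exact: rop_loop.
    rewrite [LHS](emb_component embr) ?glue_outside_r // => [x [z|z] xo zo|[z|z] zo] xz;
      rewrite codom_inr //=; move: xz; rewrite same_vertex_sym //.
      by rewrite (negPf (glue_outside_cross (or_introl zo))).
    by rewrite (negPf (glue_outside_cross (or_introl zo))).
  have [bb'|/glue_orbit_away_r] := boolP (same_vertex P c b'); last by left.
  right; apply: pendant_darts_empty => x xo; apply: contraL xo => b'x.
  by apply: (outside_root okP); apply: same_vertex_trans bb' b'x.
Qed.

End AtRoot.

Section AtVertex.

Variables (r : DA) (B : {set DA}) (v1 v2 : seq DA).
Hypotheses (rA : root A = Some r) (rb : ~~ same_vertex A r b).
Hypothesis blocksA : root_blocks A r = [:: B].
Hypothesis vertexB : forall x, same_vertex A b x -> x \in B.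
Hypothesis verticesA : block_vertices A r B = v1 ++ b :: v2.
Hypothesis away : {in v1 ++ v2, forall b', ~~ same_vertex A b b'}.

Lemma glue_rootl : root G = Some (inl r). Proof. by rewrite /= rA. Qed.

Lemma glue_orbit_root : orbit (rot G) (inl r) = map inl (orbit (rot A) r).
Proof. by rewrite glue_orbit_away // same_vertex_sym. Qed.

Lemma vertex_root_blocks : root_blocks G (inl r) = [:: inl @: B].
Proof.
have hasl (C : {set DA}) : has (fun z => z \in @inl DA DP @: C) (orbit (rot G) (inl r))
    = has (fun x => x \in C) (orbit (rot A) r).
  by rewrite glue_orbit_root; have := has_imset_l C (orbit (rot A) r) [::]; rewrite cats0.
have blockP (C : {set DA}) : block A C && has (fun x => x \in C) (orbit (rot A) r) = (C == B).
  by rewrite -mem_root_blocks // blocksA inE.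
apply: root_blocks_eq => // [|C]; first exact: rop_loop.
rewrite inE; apply/eqP/andP => [->|[bC hC]].
  by rewrite hasl (emb_block okG embl satl); apply/andP; rewrite blockP.
have /hasP[z + zC] := hC; rewrite glue_orbit_root => /mapP[x _ eqz]; rewrite {z}eqz in zC.
have [C' bC' eqC] := emb_block_preim okG embl satl bC zC.
suff eqB : C' = B by rewrite eqC eqB.
by apply/eqP; rewrite -blockP bC' -hasl -eqC.
Qed.

Lemma vertex_block_edge : {in B, forall x, edge A x \in B}.
Proof.
apply: (@block_edge_closed _ A).
have : B \in root_blocks A r by rewrite blocksA inE.
by rewrite mem_root_blocks => /andP[].
Qed.

Lemma vertex_block_vertices : block_vertices G (inl r) (inl @: B) = map inl (v1 ++ b :: v2).
Proof.
rewrite -verticesA; apply: (emb_block_vertices embl _ vertex_block_edge).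
by case: embl.
Qed.

Lemma vertex_class : class_of (rooted_block G (inl r) (inl @: B)) = class_of (rooted_block A r B).
Proof.
apply: (emb_rooted_block embl _ vertex_block_edge).
by case: embl.
Qed.

Lemma vertex_outside_l : inl @^-1: outside G (inl r) = outside A r.
Proof.
apply/setP => x; rewrite [_ \in _ @^-1: _]inE /outside vertex_root_blocks blocksA !inE /=.
by rewrite mem_imset_l.
Qed.

Lemma vertex_outside_r y : inr y \in outside G (inl r).
Proof. by rewrite /outside vertex_root_blocks inE /= inr_notin_imset_l. Qed.

Lemma vertex_outside_away x : x \in outside A r -> ~~ same_vertex A b x.
Proof. by rewrite /outside blocksA inE /= andbT; apply/contra/vertexB. Qed.

Lemma vertex_outside_cross x y : inl x \in outside G (inl r) ->
  ~~ same_vertex G (inl x) (inr y).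
Proof.
move=> xo; rewrite glue_same_vertex_lr // negb_and vertex_outside_away //.
by rewrite -vertex_outside_l inE.
Qed.

Lemma Xi_pendant_away b' : ~~ same_vertex A b b' ->
  Xi_map (pendant G (inl r) (inl @: B) (inl b')) = Xi_map (pendant A r B b').
Proof.
move=> nb; apply: emb_Xi_pendant => //; do ?exact: rop_loop.
  rewrite [LHS](emb_component embl) ?vertex_outside_l // => [x [z|z] xo zo|[z|z] zo] xz;
    rewrite codom_inl //=.
    by move: xz; rewrite (negPf (vertex_outside_cross z xo)).
  by move: xz; rewrite glue_same_vertex_lr // (negPf nb).
by left; apply: glue_orbit_away.
Qed.

(** All darts of [A] at this vertex lie in [B], so what remains there outside the root block is the
    connected map [P]. *)
Lemma vertex_pendant_darts : pendant_darts G (inl r) (inl b) = inr @: [set: DP].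
Proof.
have bc : same_vertex G (inl b) (inr c) by rewrite glue_same_vertex_lr // !same_vertex_refl.
have -> : pendant_darts G (inl r) (inl b) = component G (outside G (inl r)) (inr c).
  apply/setP => y; rewrite /pendant_darts !inE; congr (_ && _).
  apply: eq_existsb => x; congr [&& _, _ & _].
  exact: (same_connect (fconnect_sym (rot_inj okG)) bc).
rewrite (emb_component embr) => [|x [z|z] xo zo|[z|z] zo].
- have -> : inr @^-1: outside G (inl r) = setT.
    by apply/setP => y; rewrite [LHS]inE vertex_outside_r inE.
  suff -> : component P setT c = setT by [].
  apply/setP => y; rewrite [RHS]inE; apply/componentP; split; first by rewrite inE.
  exists c; rewrite inE same_vertex_refl; split=> //.
  by apply: (connected_inP _ _ (rop_conn ropP)); rewrite inE.
- by rewrite same_vertex_sym // (negPf (vertex_outside_cross x zo)).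
- by rewrite codom_inr.
- by rewrite same_vertex_sym // (negPf (vertex_outside_cross c zo)).
- by rewrite codom_inr.
Qed.

Lemma Xi_pendant_at : Xi_map (pendant G (inl r) (inl @: B) (inl b)) = Xi_map P.
Proof.
rewrite /pendant vertex_pendant_darts glue_orbit_at filter_cat.
(* Turning from [b], the darts of [A] come first and are all in [B], so the first dart outside the
   block is [c]: the pendant submap gets the root of [P]. *)
have -> : [seq z <- map (@inl DA DP) (orbit (rot A) b) | z \notin @inl DA DP @: B] = [::].
  rewrite (@eq_in_filter _ _ pred0) ?filter_pred0 // => _ /mapP[x + ->] /=.
  by rewrite mem_imset_l -fconnect_orbit => /vertexB ->.
rewrite orbit_head /= inr_notin_imset_l /=.
have eT : {in [set: DP], forall y, edge P y \in [set: DP]} by move=> y; rewrite !inE.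
have iso := emb_submap embr eT (Some c).
apply/esym; apply: (Xi_map_rop_isomorphic _ ropP).
by apply: isomorphic_trans iso; rewrite -rP; apply/isomorphic_sym/submap_setT.
Qed.

Lemma Xi_glue_vertex :
  Xi_map A = LNode [:: class_of (rooted_block A r B)]
    (map (fun b' => Xi_map (pendant A r B b')) v1 ++ leaf
     :: map (fun b' => Xi_map (pendant A r B b')) v2)
  /\ Xi_map G = LNode [:: class_of (rooted_block A r B)]
    (map (fun b' => Xi_map (pendant A r B b')) v1 ++ Xi_map P
     :: map (fun b' => Xi_map (pendant A r B b')) v2).
Proof.
split.
  rewrite (Xi_mapE okA (rop_loop ropA) rA) blocksA /= cats0 verticesA map_cat /=.
  rewrite [Xi_map (pendant A r B b)]Xi_pendant_empty // pendant_darts_empty //.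
  by move=> x /vertex_outside_away.
rewrite (Xi_mapE okG (rop_loop ropG) glue_rootl) vertex_root_blocks /= cats0.
rewrite vertex_class vertex_block_vertices -map_comp map_cat /= Xi_pendant_at.
congr (LNode _ (_ ++ _ :: _)); apply/eq_in_map => b' b'v /=; apply: Xi_pendant_away; apply: away.
  by rewrite mem_cat b'v.
by rewrite mem_cat b'v orbT.
Qed.

End AtVertex.

End GlueXi.

(** * Maps with a single root block *)

(** The outer walk meets each vertex at least once by outerplanarity and at most once by
    [nonseparable_outer_simple]. *)
Lemma nvertices_nonseparable (D : finType) (M : premap D) r :
  rop_spec M -> root M = Some r -> nonseparable M [set: D] -> nvertices M = size (walk M).
Proof.
move=> ropM rM nM; have okM := rop_ok ropM; rewrite (nverticesE M r).
have sym := fconnect_sym (rot_inj okM).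
rewrite -(card_uniqP (walk_uniq M)) -(@card_in_image _ _ (froot (rot M)) (mem (walk M))).
  apply: eq_card => x; rewrite !inE andbT; apply/eqP/imageP => [rx|[y _ ->]].
    have [y oy xy] := rop_outer ropM x; exists y; first by rewrite mem_walk.
    by rewrite -{1}rx; apply/(rootP sym).
  by rewrite root_root.
move=> x y; rewrite !mem_walk => ox oy /(rootP sym).
exact: nonseparable_outer_simple ropM rM nM x y ox oy.
Qed.

(* M has a single block B at its root r, and the first n darts of the outer    *)
(* walk meet only vertices of that block which carry no pendant submap.        *)
Record one_block (D : finType) (M : premap D) (r : D) (B : {set D}) (n : nat) : Prop :=
  OneBlock {
  ob_root : root M = Some r;
  ob_blocks : root_blocks M r = [:: B];
  ob_distinct : pairwise (fun x y => ~~ same_vertex M x y) (r :: block_vertices M r B);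
  ob_take : take n (walk M) = take n (r :: block_vertices M r B);
  ob_own : {in take n (walk M), forall x y, same_vertex M x y -> y \in B} }.

Section WholeBlock.

Variables (D : finType) (M : premap D) (r : D).
Hypotheses (ropM : rop_spec M) (rM : root M = Some r) (nM : nonseparable M [set: D]).

Let okM : darts_ok M := rop_ok ropM.

Lemma whole_root_blocks : root_blocks M r = [:: setT].
Proof.
apply: root_blocks_eq => // [|B]; first exact: rop_loop.
have bT : block M setT by apply/maxsetP; split=> // C _; rewrite subTset => /eqP.
rewrite inE; apply/eqP/andP => [->|[/maxsetP[_ maxB] _]].
  by split=> //; apply/hasP; exists r; rewrite ?in_orbit ?inE.
by apply/esym/maxB => //; apply: subsetT.
Qed.

Lemma whole_rooted_block : rooted_block M r setT = submap M setT (root M).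
Proof.
rewrite /rooted_block rM; congr submap.
by rewrite orbit_head /= in_setT.
Qed.

Lemma whole_block_vertices : block_vertices M r setT = behead (walk M).
Proof.
rewrite /block_vertices whole_rooted_block (isomorphism_walk (submap_setT_isomorphism okM)).
by rewrite behead_map /nonroot_vertices /walk; case: (root (submap _ _ _)).
Qed.

Lemma whole_one_block n : one_block M r setT n.
Proof.
have wE := walk_cons rM; split=> //.
- exact: whole_root_blocks.
- rewrite whole_block_vertices -wE; have := walk_uniq M; rewrite uniq_pairwise.
  apply: (sub_in_pairwise (P := mem (walk M))) => [x y|]; last exact/allP.
  rewrite !mem_walk => ox oy; apply: contraNN => xy; apply/eqP.
  exact: nonseparable_outer_simple ropM rM nM x y ox oy xy.
- by rewrite whole_block_vertices -wE.
Qed.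

Lemma Xi_whole : Xi_map M = LNode [:: class_of M] (nseq (size (walk M)).-1 leaf).
Proof.
rewrite (Xi_mapE okM (rop_loop ropM) rM) whole_root_blocks /= cats0 whole_block_vertices.
have -> : class_of (rooted_block M r setT) = class_of M.
  rewrite whole_rooted_block; apply/class_of_eqP.
  exact: submap_setT.
congr LNode.
rewrite -size_behead; elim: (behead _) => //= b s ->; congr cons.
apply: Xi_pendant_empty; apply: pendant_darts_empty => x.
by rewrite /outside whole_root_blocks inE /= in_setT.
Qed.

End WholeBlock.

Lemma one_block_pendant_leaf (D : finType) (M : premap D) r B n b :
    one_block M r B n -> b \in take n (walk M) ->
  Xi_map (pendant M r B b) = leaf.
Proof.
case=> _ bM _ _ own bn; apply: Xi_pendant_empty; apply: pendant_darts_empty => x.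
by rewrite /outside bM inE /= andbT; apply/contra/own.
Qed.

(** The dart [b] has the same index [size s1] on the outer walk and among the vertices of the block;
    as the root has index 0, it corresponds to the child of index [(size s1).-1]. Only the darts
    before [b] are still bare after the gluing, whence the new bound. *)
Lemma one_block_glue (DA DP : finType) (A : premap DA) (P : premap DP) r B n b c s1 s2 :
    rop_spec A -> rop_spec P -> root P = Some c -> one_block A r B n ->
    walk A = s1 ++ b :: s2 -> 0 < size s1 < n ->
  one_block (glue A b P c) (inl r) (inl @: B) (size s1)
  /\ exists C v, Xi_map A = LNode [:: C] (nseq (size s1).-1 leaf ++ leaf :: v)
       /\ Xi_map (glue A b P c) = LNode [:: C] (nseq (size s1).-1 leaf ++ Xi_map P :: v).
Proof.
move=> ropA ropP rP [rA bA dA tA oA] wA /andP[s1_gt0 s1n].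
have okA := rop_ok ropA; have okP := rop_ok ropP.
have ob : outer_dart A b by rewrite -mem_walk wA mem_cat mem_head orbT.
have [v2 bvE] : exists v2, r :: block_vertices A r B = s1 ++ b :: v2.
  exists (drop (size s1).+1 (r :: block_vertices A r B)).
  rewrite -cat_rcons -[LHS](cat_take_drop (size s1).+1); congr (_ ++ _).
  rewrite -[LHS](take_takel _ s1n) -tA take_takel // wA -cat_rcons.
  by rewrite take_size_cat ?size_rcons.
case: s1 => // r' v1 in s1_gt0 s1n wA bvE *; case: bvE => rr' bvE; subst r'.
have sn : {subset rcons (r :: v1) b <= take n (walk A)}.
  move=> x; rewrite wA -cat_rcons take_cat size_rcons; case: ltnP; last by rewrite mem_cat => _ ->.
  by move=> nlt; move: s1n; rewrite leqNgt nlt.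
have vertexB x : same_vertex A b x -> x \in B.
  by apply: oA; apply: sn; rewrite mem_rcons mem_head.
have dab x y : x \in r :: v1 -> y \in b :: v2 -> ~~ same_vertex A x y.
  move: dA; rewrite bvE -cat_cons pairwise_cat => /and3P[/allrelP d _ _].
  exact: d.
have dv2 y : y \in v2 -> ~~ same_vertex A b y.
  move: dA; rewrite bvE -cat_cons pairwise_cat => /and3P[_ _ /= /andP[/allP d _]].
  exact: d.
have rb : ~~ same_vertex A r b by apply: dab; rewrite mem_head.
have away : {in v1 ++ v2, forall b', ~~ same_vertex A b b'}.
  move=> b'; rewrite mem_cat => /orP[b'v|/dv2//].
  by rewrite same_vertex_sym // dab ?mem_head // inE b'v orbT.
have wG : walk (glue A b P c) = map inl (r :: v1) ++ map inr (walk P) ++ map inl (b :: s2).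
  by apply: glue_walk_in.
split; first split.
- by rewrite /= rA.
- exact: (vertex_root_blocks ropA ropP rP ob rb bA).
- rewrite (vertex_block_vertices c ropA ropP bA bvE) -bvE -map_cons pairwise_map.
  apply: sub_pairwise dA => x y /=; rewrite glue_same_vertex_l //.
- rewrite wG (vertex_block_vertices c ropA ropP bA bvE).
  by rewrite map_cat -cat_cons -map_cons !take_size_cat ?size_map.
- rewrite wG take_size_cat ?size_map // => _ /mapP[x xv ->] [y|y].
    rewrite glue_same_vertex_l // => xy; rewrite mem_imset_l; apply: oA xy.
    by apply: sn; rewrite mem_rcons inE xv orbT.
  rewrite glue_same_vertex_lr // => /andP[bx _].
  by have := dab x b xv (mem_head _ _); rewrite same_vertex_sym // bx.
have [XA XG] := Xi_glue_vertex ropA ropP rP ob rA rb bA vertexB bvE away.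
exists (class_of (rooted_block A r B)), [seq Xi_map (pendant A r B b') | b' <- v2].
suff leafs : [seq Xi_map (pendant A r B b') | b' <- v1] = nseq (size v1) leaf.
  by rewrite XA XG leafs.
have : {subset v1 <= take n (walk A)}.
  by move=> x xv; apply: sn; rewrite mem_rcons !inE xv !orbT.
elim: (v1) => //= x s IHs sub; rewrite IHs => [|y ys]; last by apply: sub; rewrite inE ys orbT.
congr cons; apply: (@one_block_pendant_leaf _ _ _ _ n); first by split.
by apply: sub; rewrite mem_head.
Qed.

(** The dart of index [size s1] on the glued walk is [inr c], which is not lone, since [inl b] comes
    later at the same vertex. *)
Lemma lone_glue_size (DA DP : finType) (A : premap DA) (P : premap DP) b c s1 s2 t1 t2 :
    darts_ok A -> darts_ok P -> root P = Some c ->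
    walk A = s1 ++ b :: s2 -> s1 != [::] ->
    walk (glue A b P c) = t1 ++ t2 -> all (lone (glue A b P c)) t1 ->
  size t1 <= size s1.
Proof.
move=> okA okP rP wA s10 wG lt1; rewrite leqNgt; apply/negP => lts.
have wE := glue_walk_in okA okP rP wA s10.
have ct1 : inr c \in t1.
  have <- : nth (inr c) t1 (size s1) = inr c.
    have -> : nth (inr c) t1 (size s1) = nth (inr c) (t1 ++ t2) (size s1) by rewrite nth_cat lts.
    by rewrite -wG wE nth_cat size_map ltnn subnn (walk_cons rP).
  exact: mem_nth.
have /loneP/(_ (inl b)) := allP lt1 _ ct1.
rewrite wE !mem_cat mem_head !orbT same_vertex_sym; last exact: glue_ok.
by rewrite glue_same_vertex_lr // !same_vertex_refl => /(_ isT isT).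
Qed.

(** By induction along [decompose]: a non-separable map is its own root block, and in a map glued at
    a vertex the block is inherited from [A] by [one_block_glue]. The block is found in a
    reassembled map, whence the passage to an isomorphic [M']. *)
Lemma one_block_exists (D : finType) (M : premap D) r s1 s2 :
    rop_spec M -> root M = Some r -> walk M = s1 ++ s2 -> s1 != [::] -> all (lone M) s1 ->
  exists (D' : finType) (M' : premap D') r' B',
    isomorphic M M' /\ one_block M' r' B' (size s1).
Proof.
have [n] := ubnP #|D|; elim: n D M r s1 s2 => // n IHn D M r s1 s2 leDn ropM rM wM s10 ls1.
case: (decompose ropM rM) => [nM|DA DP A P b c f ropA ropP rA rP _ isof|
                              DA DP A P b c f t1 t2 ropA ropP rP wA t10 lt1 isof].
- exists D, M, r, setT; split; first exact: isomorphic_refl.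
  exact: whole_one_block.
- have okA := rop_ok ropA; have okP := rop_ok ropP.
  have [bijf fe fr frt] := isof; have injf := bij_inj bijf.
  have fr0 : f r = inl b by move: frt; rewrite rM /= rA => -[].
  (* A gluing at the root is excluded: the outer walk would return to the root vertex at [inr c]. *)
  have lr : lone M r.
    apply: (allP ls1); case: s1 s10 wM {ls1} => // r1 s1 _.
    by rewrite (walk_cons rM) => -[-> _]; apply: mem_head.
  have := lr; rewrite -(isomorphism_lone r isof) fr0 => /loneP/(_ (inr c)).
  rewrite (glue_walk_root okA okP rP rA) mem_cat (map_f inr) ?orbT; last first.
    by rewrite (walk_cons rP) mem_head.
  by rewrite glue_same_vertex_lr // !same_vertex_refl => /(_ isT isT).
have okA := rop_ok ropA; have okP := rop_ok ropP.
have [bijf fe fr frt] := isof; have injf := bij_inj bijf.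
case rA : (root A) => [rA'|]; last by move: frt; rewrite rM /= rA.
have ltA : #|DA| < n.
  apply: leq_trans (_ : #|D| <= _); last by rewrite -ltnS.
  by rewrite (bij_eq_card bijf) card_sum -addn1 leq_add2l (cardD1 c) inE.
have [||DA' [A' [r' [B' [[g isog] obA]]]]] := IHn _ A rA' (rcons t1 b) t2 ltA ropA rA _ _ lt1.
- by rewrite cat_rcons.
- by case: (t1).
have szt : size s1 <= size t1.
  rewrite -(size_map f s1).
  apply: (lone_glue_size okA okP rP wA t10 (t1 := map f s1) (t2 := map f s2)).
    by rewrite (isomorphism_walk isof) wM map_cat.
  by rewrite all_map; apply: sub_all ls1 => x /=; rewrite (isomorphism_lone x isof).
have ropA' : rop_spec A' by apply: rop_isomorphic ropA; exists g.
have wA' : walk A' = map g t1 ++ g b :: map g t2.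
  by rewrite (isomorphism_walk isog) wA map_cat.
rewrite size_rcons in obA.
have [|[rG bG dG tG oG] _] := one_block_glue ropA' ropP rP obA wA'.
  by rewrite size_map leqnn lt0n size_eq0 t10.
exists _, (glue A' (g b) P c), (inl r'), (inl @: B'); split.
  apply: isomorphic_trans (_ : isomorphic _ (glue A b P c)) _; first by exists f.
  have [bijg ge gr grt] := isog.
  have bijid : bijective (@id DP) by exists id.
  exact: (@glue_isomorphic _ _ _ _ A P A' P g id bijg bijid).
rewrite size_map in tG oG; split=> //.
- by rewrite -(take_takel _ szt) tG take_takel.
- move=> x xt; apply: oG.
  by move: xt; rewrite -(take_takel (walk _) szt); apply: mem_take.
Qed.

(** * Bijectivity *)

Section Cat.

Variable T : Type.
Implicit Types (s t : seq T).

Lemma cat_inj s1 s2 t1 t2 : size s1 = size t1 -> s1 ++ s2 = t1 ++ t2 -> s1 = t1 /\ s2 = t2.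
Proof.
move=> eqsz eqst; split.
  by rewrite -(take_size_cat s2 (erefl (size s1))) eqst eqsz take_size_cat.
by rewrite -(drop_size_cat s2 (erefl (size s1))) eqst eqsz drop_size_cat.
Qed.

Lemma nseq_cat_eq (x y : T) n k s : nseq n x = nseq k x ++ y :: s -> y = x.
Proof.
move=> /(congr1 (fun s => nth x s k)) /=.
by rewrite nth_nseq nth_cat size_nseq ltnn subnn /= => <-; case: ifP.
Qed.

(** Used with [x] the leaf: a list of subtrees determines the place and the value of its first
    non-leaf. *)
Lemma nseq_cat_inj (x y y' : T) k k' s s' : y <> x -> y' <> x ->
  nseq k x ++ y :: s = nseq k' x ++ y' :: s' -> [/\ k = k', y = y' & s = s'].
Proof.
move=> yx y'x; elim: k k' => [|k IHk] [|k'] //= [].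
- by move=> -> ->.
- by move=> eqx; case: yx.
- by move=> eqx; case: y'x.
- by move/IHk => [-> -> ->].
Qed.

End Cat.

Section Counting.

Lemma isomorphic_nvertices (D D' : finType) (M : premap D) (M' : premap D') :
  isomorphic M M' -> darts_ok M -> darts_ok M' -> nvertices M = nvertices M'.
Proof.
case=> f [bijf fe fr _] okM okM'; rewrite /nvertices (bij_eq_card bijf); case: eqP => // _.
exact: fcard_bij (rot_inj okM) (rot_inj okM') (bij_inj bijf) fr bijf.
Qed.

Lemma class_nverticesE (D : finType) (M : premap D) : rop_spec M ->
  class_nvertices (class_of M) = nvertices M.
Proof.
move=> ropM; have iso := repr_map_isomorphic M.
apply: (isomorphic_nvertices iso _ (rop_ok ropM)).
exact: rop_ok (rop_isomorphic (isomorphic_sym iso) ropM).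
Qed.

Lemma isomorphic_nonseparable (D D' : finType) (M : premap D) (M' : premap D') :
    isomorphic M M' -> darts_ok M -> darts_ok M' ->
  nonseparable M' [set: D'] = nonseparable M [set: D].
Proof. by case=> f isof; apply: isomorphism_nonseparable isof. Qed.

Lemma Cout_class (D : finType) (M : premap D) : rop_spec M -> nonseparable M [set: D] ->
  Cout (class_of M).
Proof.
move=> ropM nM; have iso := isomorphic_sym (repr_map_isomorphic M).
have ropR := rop_isomorphic iso ropM; apply/andP; split; first exact/ropP.
by rewrite (isomorphic_nonseparable iso) //; apply: rop_ok.
Qed.

Lemma Rsize_cat R R' : Rsize (R ++ R') = Rsize R + Rsize R'.
Proof. exact: big_cat. Qed.

Lemma Rsize1 C : Rsize [:: C] = (class_nvertices C).-1.
Proof. exact: big_seq1. Qed.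

Lemma rop_rootless (D : finType) (M : premap D) : rop_spec M -> root M = None -> #|D| = 0.
Proof. by move=> ropM rM; have := rop_root ropM; rewrite rM lt0n => /esym/negbFE/eqP. Qed.

End Counting.

Section XiStructure.

Lemma Xi_rooted (D : finType) (M : premap D) r : rop_spec M -> root M = Some r ->
  exists C R ts, Xi_map M = LNode (C :: R) ts.
Proof.
move=> ropM rM; have okM := rop_ok ropM; rewrite (Xi_mapE okM (rop_loop ropM) rM).
have [B bB rB] := block_exists okM r.
have : B \in root_blocks M r.
  by rewrite mem_root_blocks bB; apply/hasP; exists r; rewrite ?in_orbit.
by case: (root_blocks M r) => //= C s _; do 3!eexists.
Qed.

Lemma Xi_rooted_neq (D : finType) (M : premap D) r : rop_spec M -> root M = Some r ->
  Xi_map M <> leaf.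
Proof. by move=> ropM rM; have [C [R [ts ->]]] := Xi_rooted ropM rM. Qed.

Lemma Xi_lone (D : finType) (M : premap D) r : rop_spec M -> root M = Some r -> lone M r ->
  exists C ts, Xi_map M = LNode [:: C] ts.
Proof.
move=> ropM rM lr; have wM : walk M = [:: r] ++ behead (walk M) := walk_cons rM.
have [|D' [M' [r' [B [iso ob]]]]] := one_block_exists ropM rM wM isT; first by rewrite /= lr.
rewrite (Xi_map_rop_isomorphic iso ropM); have ropM' := rop_isomorphic iso ropM.
rewrite (Xi_mapE (rop_ok ropM') (rop_loop ropM') (ob_root ob)) (ob_blocks ob) /=.
by do 2!eexists.
Qed.

(** Loneness of the darts up to and including [b] gives, by [one_block_exists], a block whose
    vertices come in the order of the walk and carry nothing. The predecessor appears because the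
    first dart of [s1] is at the root vertex, which is no child. *)
Lemma Xi_at_vertex (DA DP : finType) (A : premap DA) (P : premap DP) b c s1 s2 :
    rop_spec A -> rop_spec P -> root P = Some c -> walk A = s1 ++ b :: s2 -> s1 != [::] ->
    all (lone A) (rcons s1 b) ->
  exists C v, Xi_map A = LNode [:: C] (nseq (size s1).-1 leaf ++ leaf :: v)
    /\ Xi_map (glue A b P c) = LNode [:: C] (nseq (size s1).-1 leaf ++ Xi_map P :: v).
Proof.
move=> ropA ropP rP wA s10 ls.
case rA : (root A) => [r|]; last by move: wA; rewrite /walk rA; case: (s1).
have ob : outer_dart A b by rewrite -mem_walk wA mem_cat mem_head orbT.
have [||DA' [A' [r' [B' [[g isog] obA]]]]] := one_block_exists (s2 := s2) ropA rA _ _ ls.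
- by rewrite cat_rcons.
- by case: (s1).
have isoA : isomorphic A A' by exists g.
have ropA' := rop_isomorphic isoA ropA.
have wA' : walk A' = map g s1 ++ g b :: map g s2.
  by rewrite (isomorphism_walk isog) wA map_cat.
rewrite size_rcons in obA.
have [|_ [C [v [XA XG]]]] := one_block_glue ropA' ropP rP obA wA'.
  by rewrite size_map leqnn lt0n size_eq0 s10.
exists C, v; rewrite (Xi_map_rop_isomorphic isoA ropA) XA size_map; split=> //.
rewrite size_map in XG; rewrite -XG.
apply: (Xi_map_rop_isomorphic _ (glue_rop ropA ropP ob rP)).
have [bijg ge gr grt] := isog.
have bijid : bijective (@id DP) by exists id.
exact: (@glue_isomorphic _ _ _ _ A P A' P g id bijg bijid).
Qed.

End XiStructure.

Section SmallerParts.

Variables (D DA DP : finType) (M : premap D) (A : premap DA) (P : premap DP).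
Variables (b : DA) (c : DP) (f : D -> DA + DP).
Hypothesis isof : isomorphism M (glue A b P c) f.

Lemma card_glue_l : #|DA| < #|D|.
Proof.
have [bijf _ _ _] := isof.
by rewrite (bij_eq_card bijf) card_sum -addn1 leq_add2l (cardD1 c) inE.
Qed.

Lemma card_glue_r : #|DP| < #|D|.
Proof.
have [bijf _ _ _] := isof.
by rewrite (bij_eq_card bijf) card_sum addnC -addn1 leq_add2l (cardD1 b) inE.
Qed.

End SmallerParts.

Lemma sumn_tree_size_nseq n :
  sumn [seq tree_size u | u <- nseq n (leaf : ltree (seq map_class))] = n.
Proof. by elim: n => //= n ->. Qed.

(** The vertex that a gluing identifies corresponds to the root shared by the two trees, or to the
    leaf that [Xi P] replaces, so sizes change in the same way on both sides. *)
Lemma Xi_well_decorated (D : finType) (M : premap D) : rop_spec M ->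
  well_decorated (Xi_map M) /\ tree_size (Xi_map M) = nvertices M.
Proof.
have [n] := ubnP #|D|; elim: n D M => // n IHn D M leDn ropM.
case rM : (root M) => [r|]; last first.
  rewrite Xi_map_rootless // /= /Rsize big_nil eqxx; split=> //.
  by rewrite /nvertices (rop_rootless ropM rM).
have IHA DA (A : premap DA) : #|DA| < #|D| -> rop_spec A ->
    well_decorated (Xi_map A) /\ tree_size (Xi_map A) = nvertices A.
  by move=> ltA; apply: IHn; apply: leq_trans ltA _.
case: (decompose ropM rM) => [nM|DA DP A P b c f ropA ropP rA rP lP isof|
                              DA DP A P b c f t1 t2 ropA ropP rP wA t10 lt1 isof].
- have nE := nvertices_nonseparable ropM rM nM.
  rewrite (Xi_whole ropM rM nM) /= Cout_class //= Rsize1 class_nverticesE // nE size_nseq eqxx.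
  split; first by rewrite all_nseq /= /Rsize big_nil eqxx orbT.
  by rewrite sumn_tree_size_nseq (walk_cons rM).
- have [wdA tsA] := IHA _ _ (card_glue_l isof) ropA.
  have [wdP tsP] := IHA _ _ (card_glue_r isof) ropP.
  have ob : outer_dart A b by rewrite /outer_dart rA connect0.
  have ropG := glue_rop ropA ropP ob rP.
  have iso : isomorphic M (glue A b P c) by exists f.
  rewrite (Xi_map_rop_isomorphic iso ropM).
  rewrite (isomorphic_nvertices iso (rop_ok ropM) (rop_ok ropG)).
  have nG := glue_nvertices b c (rop_ok ropA) (rop_ok ropP).
  case XA : (Xi_map A) wdA tsA => [RA lA] /= /and3P[wRA /eqP sA wA] tsA.
  case XP : (Xi_map P) wdP tsP => [RP lP'] /= /and3P[wRP /eqP sP wP] tsP.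
  rewrite (Xi_glue_root ropA ropP rP ob rA XA XP) /= /is_Robj !all_cat Rsize_cat size_cat.
  rewrite -!/(is_Robj _) wRA wRP wA wP sA sP eqxx map_cat sumn_cat; split=> //.
  by move: nG; rewrite -tsA -tsP addSn addnS => -[->].
have [wdA tsA] := IHA _ _ (card_glue_l isof) ropA.
have [wdP tsP] := IHA _ _ (card_glue_r isof) ropP.
have ob : outer_dart A b by rewrite -mem_walk wA mem_cat mem_head orbT.
have ropG := glue_rop ropA ropP ob rP.
have iso : isomorphic M (glue A b P c) by exists f.
rewrite (Xi_map_rop_isomorphic iso ropM).
rewrite (isomorphic_nvertices iso (rop_ok ropM) (rop_ok ropG)).
have nG := glue_nvertices b c (rop_ok ropA) (rop_ok ropP).
have [C [v [XA ->]]] := Xi_at_vertex ropA ropP rP wA t10 lt1.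
rewrite XA in wdA tsA; move: wdA tsA => /= /and3P[-> /eqP-> wts] tsA.
move: wts; rewrite !size_cat /= !all_cat /= => /and3P[-> _ ->]; rewrite wdP eqxx; split=> //.
move: tsA nG; rewrite -tsP !map_cat !sumn_cat /=.
by move: (sumn _) (sumn _) (tree_size _) (nvertices _) (nvertices _); clear; lia.
Qed.

(** * Injectivity *)

Lemma isomorphic_rootless (D D' : finType) (M : premap D) (M' : premap D') :
  rop_spec M -> rop_spec M' -> root M = None -> root M' = None -> isomorphic M M'.
Proof.
move=> ropM ropM' rM rM'; have D0 := card0_eq (rop_rootless ropM rM).
have f (x : D) : D' by have := D0 x.
exists f; split=> [|x|x|]; last by rewrite rM rM'.
- apply: inj_card_bij => [x|]; first by have := D0 x.
  by rewrite (rop_rootless ropM rM) (rop_rootless ropM' rM').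
- by have := D0 x.
- by have := D0 x.
Qed.

Lemma isomorphic_glue (DA DP DA' DP' : finType) (A : premap DA) (P : premap DP)
    (A' : premap DA') (P' : premap DP') b c b' c' g :
    isomorphism A A' g -> g b = b' -> isomorphic P P' -> root P = Some c -> root P' = Some c' ->
  isomorphic (glue A b P c) (glue A' b' P' c').
Proof.
move=> [bijg ge gr grt] <- [k [bijk ke kr krt]] rP rP'.
have <- : k c = c' by move: krt; rewrite rP rP' => -[].
exact: (glue_isomorphic bijg bijk ge ke gr kr grt b c).
Qed.

(** The tree reveals which case of [decomposition] holds: one block with only leaf children, at
    least two blocks, or one block with a non-leaf child. In equal cases it also yields the trees of
    [A] and [P] and the place of gluing, so the induction hypothesis applies to both parts; the
    mixed cases are contradictory. *)
Lemma Xi_inj (D D' : finType) (M : premap D) (M' : premap D') :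
  rop_spec M -> rop_spec M' -> Xi_map M = Xi_map M' -> isomorphic M M'.
Proof.
have [n] := ubnP #|D|; elim: n D D' M M' => // n IHn D D' M M' leDn ropM ropM' eqX.
case rM : (root M) => [r|]; last first.
  case rM' : (root M') => [r'|]; last exact: isomorphic_rootless.
  by case: (Xi_rooted_neq ropM' rM'); rewrite -eqX Xi_map_rootless.
case rM' : (root M') => [r'|]; last first.
  by case: (Xi_rooted_neq ropM rM); rewrite eqX Xi_map_rootless.
have IHA DA DA' (A : premap DA) (A' : premap DA') : #|DA| < #|D| -> rop_spec A -> rop_spec A' ->
    Xi_map A = Xi_map A' -> isomorphic A A'.
  by move=> ltA; apply: IHn; apply: leq_trans ltA _.
have via_glue DA DP DA' DP' (A : premap DA) (P : premap DP) (A' : premap DA') (P' : premap DP')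
    b c b' c' f f' : isomorphism M (glue A b P c) f -> isomorphism M' (glue A' b' P' c') f' ->
    isomorphic (glue A b P c) (glue A' b' P' c') -> isomorphic M M'.
  move=> isof isof' iso; apply: isomorphic_trans (_ : isomorphic _ (glue A b P c)) _.
    by exists f.
  by apply: isomorphic_trans iso (isomorphic_sym _); exists f'.
have root_form DA DP (A : premap DA) (P : premap DP) b c (N : finType) (M0 : premap N) f :
    rop_spec M0 -> rop_spec A -> rop_spec P -> root A = Some b -> root P = Some c -> lone P c ->
    isomorphism M0 (glue A b P c) f ->
    exists C R E tsA tsP, [/\ Xi_map A = LNode (C :: R) tsA, Xi_map P = LNode [:: E] tsP
      & Xi_map M0 = LNode (rcons (C :: R) E) (tsA ++ tsP)].
  move=> ropM0 ropA ropP rA rP lP isof.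
  have [C [R [tsA XA]]] := Xi_rooted ropA rA; have [E [tsP XP]] := Xi_lone ropP rP lP.
  exists C, R, E, tsA, tsP; split=> //.
  have ob : outer_dart A b by rewrite /outer_dart rA connect0.
  rewrite -cats1 -(Xi_glue_root ropA ropP rP ob rA XA XP).
  by apply: Xi_map_rop_isomorphic => //; exists f.
have vertex_form DA DP (A : premap DA) (P : premap DP) b c (N : finType) (M0 : premap N) f s1 s2 :
    rop_spec M0 -> rop_spec A -> rop_spec P -> root P = Some c ->
    walk A = s1 ++ b :: s2 -> s1 != [::] -> all (lone A) (rcons s1 b) ->
    isomorphism M0 (glue A b P c) f ->
    exists C v, Xi_map A = LNode [:: C] (nseq (size s1).-1 leaf ++ leaf :: v)
      /\ Xi_map M0 = LNode [:: C] (nseq (size s1).-1 leaf ++ Xi_map P :: v).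
  move=> ropM0 ropA ropP rP wA s10 ls1 isof.
  have [C [v [XA XG]]] := Xi_at_vertex ropA ropP rP wA s10 ls1; exists C, v; split=> //.
  by rewrite -XG; apply: Xi_map_rop_isomorphic => //; exists f.
case: (decompose ropM rM) => [nM|DA DP A P b c f ropA ropP rA rP lP isof|
                              DA DP A P b c f s1 s2 ropA ropP rP wA s10 ls1 isof];
case: (decompose ropM' rM') => [nM'|DA' DP' A' P' b' c' f' ropA' ropP' rA' rP' lP' isof'|
                      DA' DP' A' P' b' c' f' s1' s2' ropA' ropP' rP' wA' s10' ls1' isof'].
- move: eqX; rewrite (Xi_whole ropM rM nM) (Xi_whole ropM' rM' nM') => -[eqC _].
  exact/class_of_eqP.
- have [C [R [E [tsA [tsP [_ _ XM']]]]]] :=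
    root_form _ _ _ _ _ _ _ _ _ ropM' ropA' ropP' rA' rP' lP' isof'.
  move: eqX; rewrite XM' (Xi_whole ropM rM nM) => -[_ /(congr1 size)].
  by rewrite size_rcons.
- have [C [v [_ XM']]] :=
    vertex_form _ _ _ _ _ _ _ _ _ _ _ ropM' ropA' ropP' rP' wA' s10' ls1' isof'.
  move: eqX; rewrite XM' (Xi_whole ropM rM nM) => -[_ eqts]; have XP := nseq_cat_eq eqts.
  by case: (Xi_rooted_neq ropP' rP').
- have [C [R [E [tsA [tsP [_ _ XM]]]]]] :=
    root_form _ _ _ _ _ _ _ _ _ ropM ropA ropP rA rP lP isof.
  move: eqX; rewrite XM (Xi_whole ropM' rM' nM') => -[_ /(congr1 size)].
  by rewrite size_rcons.
- have [C [R [E [tsA [tsP [XA XP XM]]]]]] :=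
    root_form _ _ _ _ _ _ _ _ _ ropM ropA ropP rA rP lP isof.
  have [C' [R' [E' [tsA' [tsP' [XA' XP' XM']]]]]] :=
    root_form _ _ _ _ _ _ _ _ _ ropM' ropA' ropP' rA' rP' lP' isof'.
  move: eqX; rewrite XM XM' => -[eqC /rcons_inj[eqR eqE] eqts].
  (* The children of [A] are as many as [Rsize] of its blocks, so equal blocks cut the list of
     children at the same place. *)
  subst C' R' E'; have [|eqA eqP] := cat_inj _ eqts.
    have [+ _] := Xi_well_decorated ropA; rewrite XA /= => /and3P[_ /eqP<- _].
    by have [+ _] := Xi_well_decorated ropA'; rewrite XA' /= => /and3P[_ /eqP<- _].
  subst tsA' tsP'.
  have [g isog] : isomorphic A A' by apply: (IHA _ _ _ _ (card_glue_l isof)); rewrite ?XA.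
  have isoP : isomorphic P P' by apply: (IHA _ _ _ _ (card_glue_r isof)); rewrite ?XP.
  apply: (via_glue _ _ _ _ _ _ _ _ _ _ _ _ _ _ isof isof').
  apply: (isomorphic_glue isog _ isoP rP rP').
  by case: isog => _ _ _; rewrite rA rA' => -[].
- have [C [R [E [tsA [tsP [_ _ XM]]]]]] :=
    root_form _ _ _ _ _ _ _ _ _ ropM ropA ropP rA rP lP isof.
  have [C' [v [_ XM']]] :=
    vertex_form _ _ _ _ _ _ _ _ _ _ _ ropM' ropA' ropP' rP' wA' s10' ls1' isof'.
  move: eqX; rewrite XM XM' => -[_ /(congr1 size)].
  by rewrite size_rcons.
- have [C [v [_ XM]]] :=
    vertex_form _ _ _ _ _ _ _ _ _ _ _ ropM ropA ropP rP wA s10 ls1 isof.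
  move: eqX; rewrite XM (Xi_whole ropM' rM' nM') => -[_ eqts]; have XP := nseq_cat_eq (esym eqts).
  by case: (Xi_rooted_neq ropP rP).
- have [C' [v [_ XM]]] :=
    vertex_form _ _ _ _ _ _ _ _ _ _ _ ropM ropA ropP rP wA s10 ls1 isof.
  have [C [R [E [tsA [tsP [_ _ XM']]]]]] :=
    root_form _ _ _ _ _ _ _ _ _ ropM' ropA' ropP' rA' rP' lP' isof'.
  move: eqX; rewrite XM XM' => -[_ /(congr1 size)].
  by rewrite size_rcons.
- have [C [v [XA XM]]] :=
    vertex_form _ _ _ _ _ _ _ _ _ _ _ ropM ropA ropP rP wA s10 ls1 isof.
  have [C' [v' [XA' XM']]] :=
    vertex_form _ _ _ _ _ _ _ _ _ _ _ ropM' ropA' ropP' rP' wA' s10' ls1' isof'.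
  move: eqX; rewrite XM XM' => -[eqC eqts]; subst C'.
  (* Both [P] and [P'] are rooted, so their trees are not leaves and mark the first non-leaf
     child. *)
  have [eqk eqP eqv] := nseq_cat_inj (Xi_rooted_neq ropP rP) (Xi_rooted_neq ropP' rP') eqts.
  subst v'; have [g isog] : isomorphic A A'.
    by apply: (IHA _ _ _ _ (card_glue_l isof)); rewrite // XA XA' eqk.
  have isoP : isomorphic P P' by apply: (IHA _ _ _ _ (card_glue_r isof)).
  apply: (via_glue _ _ _ _ _ _ _ _ _ _ _ _ _ _ isof isof').
  apply: (isomorphic_glue isog _ isoP rP rP').
  (* The gluing darts have the same index on the two walks, and an isomorphism of [A] and [A']
     carries walk to walk. *)
  have eqsz : size s1 = size s1'.
    by case: (s1) (s1') s10 s10' eqk => [|x t] [|x' t'] //= _ _ ->.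
  have := isomorphism_walk isog; rewrite wA wA' map_cat => /esym eqw.
  by have [|_ []] := cat_inj _ eqw; rewrite ?size_map.
Qed.

(** * Surjectivity *)

Lemma cat_nseqS (T : Type) (x : T) k s : nseq k.+1 x ++ s = nseq k x ++ x :: s.
Proof. by elim: k => //= k ->. Qed.

Definition empty_map : premap void := Premap [ffun x => x] [ffun x => x] None.

Lemma empty_map_rop : rop_spec empty_map.
Proof.
split; try by case.
- by split; case.
- by apply/connected_inP; case.
- by rewrite /nvertices /nfaces /nedges card_void.
- by rewrite card_void.
Qed.

Definition in_image (t : ltree (seq map_class)) : Prop :=
  exists (D : finType) (M : premap D), rop_spec M /\ Xi_map M = t.

Lemma one_block_leq (D : finType) (M : premap D) r B n m :
  m <= n -> one_block M r B n -> one_block M r B m.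
Proof.
move=> mn [rM bM dM tM oM]; split=> //; first by rewrite -(take_takel _ mn) tM take_takel.
by move=> x xm; apply: oM; move: xm; rewrite -(take_takel _ mn); apply: mem_take.
Qed.

(* Pendants are attached from the last vertex of the block to the first, so    *)
(* that the next one always goes to a vertex that the outer walk meets once.   *)
Lemma block_in_image C ts : Cout C -> (class_nvertices C).-1 = size ts ->
  (forall i, i < size ts -> in_image (nth leaf ts i)) -> in_image (LNode [:: C] ts).
Proof.
move=> /andP[/ropP ropC nC] szC imts.
(* After [j] rounds the last [j] children are in place and the others are leaves; the successor in
   the bound of [one_block] accounts for the root. *)
suff claim j : j <= size ts -> exists (D : finType) (M : premap D) r B,
    [/\ rop_spec M, one_block M r B (size ts - j).+1, size ts - j < size (walk M)
      & Xi_map M = LNode [:: C] (nseq (size ts - j) leaf ++ drop (size ts - j) ts)].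
  have [D [M [r [B [ropM _ _ XM]]]]] := claim _ (leqnn _).
  by exists D, M; rewrite XM subnn drop0.
elim: j => [_|j IHj ltj].
  case rC : (root (repr_map C)) => [r|]; last first.
    have /and4P[/set0Pn[x _] _ _ _] := nC.
    by have := card0_eq (rop_rootless ropC rC) x.
  have nE := nvertices_nonseparable ropC rC nC.
  exists _, (repr_map C), r, setT; rewrite subn0 drop_size cats0; split=> //.
  - exact: whole_one_block.
  - by rewrite -nE -szC /class_nvertices nE (walk_cons rC).
  - by rewrite (Xi_whole ropC rC nC) repr_mapK -nE -szC.
have [D [M [r [B [ropM obM szM XM]]]]] := IHj (ltnW ltj).
move: obM szM XM; set k := size ts - j.+1; have kE : size ts - j = k.+1 by rewrite /k; lia.
rewrite {}kE => obM szM XM; have ltk : k < size ts by rewrite /k; lia.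
have [DP [P [ropP XP]]] := imts k ltk.
have dropE : drop k ts = Xi_map P :: drop k.+1 ts by rewrite XP -drop_nth.
(* If [P] is the single vertex, the required child is the leaf already present. *)
case rP : (root P) => [c|]; last first.
  exists D, M, r, B; split=> //; [exact: one_block_leq obM|exact: ltnW|].
  by rewrite XM dropE Xi_map_rootless // cat_nseqS.
have [s1 [b [s2 [wM szs1]]]] : exists s1 b s2, walk M = s1 ++ b :: s2 /\ size s1 = k.+1.
  exists (take k.+1 (walk M)), (nth r (walk M) k.+1), (drop k.+2 (walk M)).
  by rewrite -drop_nth // cat_take_drop size_take szM.
have [|obG [C' [v [XM' XG]]]] := one_block_glue ropM ropP rP obM wM (b := b).
  by rewrite szs1 ltnS leqnn.
rewrite szs1 /= in obG XM' XG; move: XM'; rewrite XM => -[eqC eqts]; subst C'.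
have eqts' : nseq k leaf ++ leaf :: drop k.+1 ts = nseq k leaf ++ leaf :: v.
  by rewrite -eqts -cat_nseqS.
have [_ [eqv]] := cat_inj (erefl _) eqts'; subst v.
have ob : outer_dart M b by rewrite -mem_walk wM mem_cat mem_head orbT.
exists _, (glue M b P c), (inl r), (inl @: B); split=> //.
- exact: glue_rop.
- rewrite (glue_walk_in (rop_ok ropM) (rop_ok ropP) rP wM); last by case: (s1) szs1.
  by rewrite size_cat size_map szs1 addSn ltnS leq_addr.
- by rewrite XG dropE.
Qed.

(** The last block takes the last children; the rest is realized by induction, and the two maps are
    glued at their roots. *)
Lemma node_in_image R ts : is_Robj R -> Rsize R = size ts ->
  (forall i, i < size ts -> in_image (nth leaf ts i)) -> in_image (LNode R ts).
Proof.
elim/last_ind: R ts => [|R C IHR] ts.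
  rewrite /Rsize big_nil => _ /esym/size0nil -> _; exists void, empty_map.
  by split; [exact: empty_map_rop | exact: Xi_map_empty card_void].
rewrite -cats1 /is_Robj all_cat Rsize_cat Rsize1 /= andbT => /andP[oR oC] szts imts.
have leR : Rsize R <= size ts by rewrite -szts leq_addr.
have szR : Rsize R = size (take (Rsize R) ts) by rewrite size_takel.
have [||DP [P [ropP XP]]] := block_in_image (ts := drop (Rsize R) ts) oC.
- by rewrite size_drop -szts addKn.
- by move=> i; rewrite size_drop nth_drop => lti; apply: imts; lia.
have [|DA [A [ropA XA]]] := IHR _ oR szR.
  by move=> i; rewrite -szR => lti; rewrite nth_take //; apply: imts; lia.
case rP : (root P) => [c|]; last by move: XP; rewrite Xi_map_rootless.
(* If [A] is the single vertex there is no dart to glue at; then no blocks precede [C], and [P]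
   alone is the answer. *)
case rA : (root A) => [b|]; last first.
  move: XA; rewrite Xi_map_rootless // => -[R0 _]; exists DP, P; split=> //.
  by rewrite XP -R0 /Rsize big_nil drop0.
have ob : outer_dart A b by rewrite /outer_dart rA connect0.
exists _, (glue A b P c); split; first exact: glue_rop.
by rewrite (Xi_glue_root ropA ropP rP ob rA XA XP) cat_take_drop.
Qed.

Lemma Xi_onto t : well_decorated t -> in_image t.
Proof.
have [n] := ubnP (tree_size t); elim: n t => // n IHn [R ts] /= lets /and3P[oR /eqP szR wts].
apply: node_in_image => // i lti.
have nth_le : tree_size (nth leaf ts i) <= sumn [seq tree_size u | u <- ts].
  elim: ts i lti {lets szR wts} => //= u ts IHts [|i] lti; first exact: leq_addr.
  exact: leq_trans (IHts i lti) (leq_addl _ _).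
apply: IHn; first exact: leq_ltn_trans nth_le lets.
exact: (all_nthP leaf wts).
Qed.

Theorem theorem2p1 :
  [/\ (* the construction does not depend on the representative of a map *)
      forall (D : finType) (M : premap D),
        rooted_outerplanar M -> Xi (class_of M) = Xi_map M,
      set_bij Mout decorated_trees Xi
    & forall m : map_class, Mout m -> tree_size (Xi m) = class_nvertices m].
Proof.
have XiE (D : finType) (M : premap D) : rop_spec M -> Xi (class_of M) = Xi_map M.
  move=> ropM; apply/esym/(Xi_map_rop_isomorphic _ ropM)/isomorphic_sym.
  exact: repr_map_isomorphic.
split=> [D M /ropP|  |m /ropP ropm]; first exact: XiE.
  split.
  - by move=> m /ropP ropm; have [] := Xi_well_decorated ropm.
  - move=> m m'; rewrite !in_setE => /ropP ropm /ropP ropm' eqX.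
    rewrite -(repr_mapK m) -(repr_mapK m'); apply/class_of_eqP.
    exact: Xi_inj.
  - move=> t /Xi_onto[D [M [ropM <-]]]; exists (class_of M); last exact: XiE.
    by apply/ropP/(rop_isomorphic _ ropM)/isomorphic_sym; apply: repr_map_isomorphic.
by have [] := Xi_well_decorated ropm.
Qed.
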